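(* Assume that $f,a,B$ are Lipschitz continuous on the torus $\mathcal X$ and that there exists $\alpha\in L^\infty(\mathcal X;\mathbb R^m)$ with $a(x)=B(x)\alpha(x)$ for all $x\in\mathcal X$. Consider a candidate pair $(w,\mu)$ with $\mu:\mathcal X\to\mathbb R_+$ and $w:\mathcal X\to\mathbb R^m$. If $(w,\mu)$ is such that $u_c:=w/\mu$ is continuously differentiable and $\sup_{x\in\mathcal X}\|u_c(x)\|_2\le C_u$, then $$\mathrm{Perf}(u_c)-\mathrm{Perf}(u^* )\le J(w,\mu)-J(w^*,\mu^* ),$$ where $\mu^*$ is the optimal occupation measure and $w^*=\mu^*u^*$.
   Context: Setting. $d,m\ge1$, $\rho>0$, $q\in(1,2]$, $1/q+1/q'=1$; $\mathcal X=[0,1]^d$ is the $d$-dimensional torus (functions on $\mathcal X$ are 1-periodic in each coordinate). $f:\mathcal X\to\mathbb R_+$, $a:\mathcal X\to\mathbb R^d$, $B:\mathcal X\to\mathbb R^{d\times m}$, $R(u)=\|u\|^q/q$, $R^*(v)=\|v\|^{q'}/q'$. $V^*(x)=\inf_{u}\rho\int_0^\infty e^{-\rho t}(f(x_t)+R(u_t))\,\mathrm dt$ subject to $\dot x_t=a(x_t)+B(x_t)u_t$, $x_0=x$, over measurable $u:\mathbb R_+\to\mathbb R^m$. $\mu_0$ is a probability measure on $\mathcal X$ with full support and bounded density, also denoted $\mu_0$. $u^*(x)=\nabla R^*(-\rho^{-1}B(x)^\top\nabla V^*(x))$ for a.e. $x$ is the optimal controller (under $a=B\alpha$ the distribution $B^\top\nabla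 V^*$ is an $L^\infty$ function). $\mu^*(A)=\int_{\mathcal X}\rho\int_0^\infty e^{-\rho t}\mathbf 1_A(x(t\mid x_0))\,\mathrm dt\,\mathrm d\mu_0(x_0)$, where $x(\cdot\mid x_0)$ is the optimal trajectory $\dot x=a(x)+B(x)u^*(x)$, $x(0)=x_0$ (understood to be well defined and optimal for $\mu_0$-a.e. $x_0$); it satisfies $\mu^*+\frac1\rho\mathrm{div}(b(\cdot,u^* )\mu^* )=\mu_0$ in the sense of distributions, $b(x,u)=a(x)+B(x)u$. $C_u=\big(2q'\|f\|_\infty+2^q(q'-1)\|\alpha\|_\infty^q\big)^{1/q}$, which satisfies $\|u^*(x)\|\le C_u$ for a.e. $x$, and $C_V=\|f\|_\infty+C_u^q/q$. For a controller $u:\mathcal X\to\mathbb R^m$, $\mathrm{Perf}(u)=\mathbb E_{x_0\sim\mu_0}\big\{\rho\int_0^\infty e^{-\rho t}(f(x_t)+R(u(x_t)))\,\mathrm dt\big\}$ with $\dot x_t=a(x_t)+B(x_t)u(x_t)$. Moreover $$J(w,\mu)=\int_{\mathcal X}\Big[f(x)+R\Big(\frac{w(x)}{\mu(x)}\Big)\Big]\mu(x)\,\mathrm dx+C_V\int_{\mathcal X}\Big[\mu_0(x)-\mu(x)-\frac1\rho\mathrm{div}(a(x)\mu(x)+B(x)w(x))\Big]_+\mathrm dx,$$ $[y]_+=\max(y,0)$, divergences being in the sense of distributions, and the integral of the positive part of a distribution $T$ being $\sup\{\langle T,V\rangle:V\in C^1(\mathcal X),0\le V\le1\}$; if $\mu^*$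 has no density, $J(w^*,\mu^* )$ is understood in the corresponding sense of measures. It is understood that $w=\mu u_c$. *)

(* Defs.v *)
From HB Require Import structures.
From mathcomp Require Import all_boot all_order all_algebra.
From mathcomp Require Import all_classical all_reals all_analysis.

Set Implicit Arguments.
Unset Strict Implicit.
Unset Printing Implicit Defensive.

Import Order.TTheory GRing.Theory Num.Theory.
Import numFieldNormedType.Exports.

Local Open Scope classical_set_scope.
Local Open Scope ring_scope.

(** A function on the torus is a function on the column vectors ['cV[R]_d]
    that is 1-periodic in each coordinate, and a trajectory on the torus is
    represented by its lift to ['cV[R]_d]. *)

(** Product (= Borel) sigma-algebra on matrices. *)
Section matrix_measurable.
Context {R : realType} (m n : nat).

Definition entry_cylinders : set (set 'M[R]_(m, n)) :=
  [set A | exists i j, exists2 Y : set R, measurable Y &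
     A = (fun M : 'M[R]_(m, n) => M i j) @^-1` Y].

HB.instance Definition _ := @isMeasurable.Build
  (sigma_display entry_cylinders) 'M[R]_(m, n) <<s entry_cylinders >>
  (@sigma_algebra0 _ setT entry_cylinders)
  (@sigma_algebraC _ entry_cylinders)
  (@sigma_algebra_bigcup _ setT entry_cylinders).

Lemma measurable_entry i j :
  measurable_fun [set: 'M[R]_(m, n)] (fun M : 'M[R]_(m, n) => M i j).
Proof.
move=> _ Y mY; rewrite setTI; apply: sub_sigma_algebra.
by exists i, j, Y.
Qed.

Lemma measurable_fun_mxP d (T : measurableType d) (D : set T)
    (F : T -> 'M[R]_(m, n)) : measurable D ->
  measurable_fun D F <-> forall i j, measurable_fun D (fun x => F x i j).
Proof.
move=> mD; split=> [mF i j|mF].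
  exact: (measurableT_comp (measurable_entry i j) mF).
apply: (@measurability _ _ _ _ D F entry_cylinders) => //.
move=> _ [_ [i [j [Y mY ->]]] <-].
exact: mF.
Qed.

End matrix_measurable.

Section torus_measure.
Context {R : realType}.

Definition cons_cV n (p : measurableTypeR R * 'cV[R]_n) : 'cV[R]_n.+1 :=
  col_mx (p.1 : R)%:M p.2.

Lemma measurable_cons_cV n : measurable_fun setT (@cons_cV n).
Proof.
apply/measurable_fun_mxP => // i j.
rewrite /cons_cV.
case: (splitP (i : 'I_(1 + n))) => k ik.
- have -> : (fun p : measurableTypeR R * 'cV[R]_n => (col_mx (p.1 : R)%:M p.2 : 'cV_(1 + n)) i j) = fst.
    apply/funext => p; have -> : i = lshift n k by exact: val_inj.
    by rewrite col_mxEu !mxE !ord1 eqxx mulr1n.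
  exact: measurable_fst.
- have -> : (fun p : measurableTypeR R * 'cV[R]_n => (col_mx (p.1 : R)%:M p.2 : 'cV_(1 + n)) i j) =
            (fun M : 'cV[R]_n => M k j) \o snd.
    apply/funext => p; have -> : i = rshift 1 k by exact: val_inj.
    by rewrite /= col_mxEd.
  apply: measurableT_comp; [exact: measurable_entry|exact: measurable_snd].
Qed.

HB.instance Definition _ n :=
  isMeasurableFun.Build _ _ _ _ (@cons_cV n) (@measurable_cons_cV n).

(** The Lebesgue measure of [0,1]^n, as a probability on ['cV[R]_n]: the
    n-fold product of the uniform law on [0,1]. *)
Fixpoint torus_measure n : probability 'cV[R]_n R :=
  match n with
  | 0 => \d_(0 : 'cV[R]_0)
  | n'.+1 => distribution (uniform_prob (@ltr01 R) \x torus_measure n')%E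
               (@cons_cV n')
  end.

Lemma uniform01_itv (s t : R) : 0 <= s -> s <= t -> t <= 1 ->
  uniform_prob (@ltr01 R) `[s, t] = (t - s)%:E.
Proof.
move=> s0 st t1; rewrite /uniform_prob integral_uniform_pdf.
rewrite setIidl; last first.
  move=> x /=; rewrite !in_itv/= => /andP[sx xt].
  by rewrite (le_trans s0 sx) (le_trans xt t1).
rewrite (eq_integral (cst 1%E)); last first.
  move=> x; rewrite inE/= in_itv/= => /andP[sx xt].
  rewrite /uniform_pdf (le_trans s0 sx) (le_trans xt t1)/=.
  by rewrite subr0 invr1.
rewrite integral_cst//= mul1e lebesgue_measure_itv/= lte_fin.
by case: ltgtP st => // -> _; rewrite subrr.
Qed.

Lemma torus_measure_box n (s t : 'cV[R]_n) :
  (forall i, 0 <= s i 0 /\ s i 0 <= t i 0 /\ t i 0 <= 1) ->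
  torus_measure n [set x | forall i, s i 0 <= x i 0 <= t i 0] =
  (\prod_i (t i 0 - s i 0))%:E.
Proof.
elim: n s t => [|n IH] s t st.
  rewrite big_ord0 /= diracE mem_set//; case=> //.
pose s' : 'cV[R]_n := \col_j s (lift 0 j) 0.
pose t' : 'cV[R]_n := \col_j t (lift 0 j) 0.
rewrite big_ord_recl /= /distribution /pushforward.
have -> : @cons_cV n @^-1` [set x | forall i, s i 0 <= x i 0 <= t i 0] =
    (`[s 0 0, t 0 0]%classic : set (measurableTypeR R)) `*`
    [set x : 'cV[R]_n | forall i, s' i 0 <= x i 0 <= t' i 0].
  have c0 p : (@cons_cV n p) 0 0 = p.1.
    rewrite /cons_cV; have -> : (0 : 'I_n.+1) = lshift n (0 : 'I_1) by exact: val_inj.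
    by rewrite (@col_mxEu _ 1 n 1) !mxE mulr1n.
  have cS p k : (@cons_cV n p) (lift 0 k) 0 = p.2 k 0.
    rewrite /cons_cV; have -> : lift 0 k = rshift 1 k by exact: val_inj.
    by rewrite (@col_mxEd _ 1 n 1).
  apply/seteqP; split=> [p /= H|p /= [H0 H] i].
    split=> [|k]; first by have := H 0; rewrite c0 in_itv.
    by have := H (lift 0 k); rewrite cS !mxE.
  have [k|] := unliftP 0 i => ->; last by rewrite c0; move: H0; rewrite in_itv.
  by rewrite cS; have := H k; rewrite !mxE.
have [s00 [st0 t01]] := st 0.
rewrite product_measure1E//=; last first.
  have -> : [set x : 'cV[R]_n | forall i, s' i 0 <= x i 0 <= t' i 0] =
      \bigcap_(i in [set: 'I_n]) ((fun M : 'cV[R]_n => M i 0) @^-1`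
       `[s' i 0, t' i 0]).
    apply/seteqP; split=> [x H i _|x H i] /=; first by rewrite in_itv; exact: H.
    by have := H i I; rewrite /= in_itv.
  apply: fin_bigcap_measurable => // i _.
  by rewrite -[_ @^-1` _]setTI; exact: measurable_entry.
rewrite EFinM; congr (_ * _)%E.
  exact: uniform01_itv.
rewrite IH; last by move=> i; rewrite !mxE; exact: st.
by congr EFin; apply: eq_bigr => i _; rewrite !mxE.
Qed.

End torus_measure.

Section torus_functions.
Context {R : realType} (d : nat).

Definition torus_periodic (T : Type) (F : 'cV[R]_d -> T) : Prop :=
  forall x i, F (x + delta_mx i 0) = F x.

Definition torus_rep (x : 'cV[R]_d) : 'cV[R]_d :=
  \col_i (x i 0 - (Num.floor (x i 0))%:~R).

Definition unit_cube : set 'cV[R]_d :=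
  [set x | forall i, 0 <= x i 0 <= 1].

Definition C1 (W : normedModType R) (F : 'cV[R]_d -> W) : Prop :=
  (forall x, differentiable F x) /\
  (forall v, continuous (fun x => 'd F x v)).

Definition C1_torus (F : 'cV[R]_d -> R) : Prop := torus_periodic F /\ C1 F.

Definition grad (F : 'cV[R]_d -> R) (x : 'cV[R]_d) : 'cV[R]_d :=
  \col_i 'D_(delta_mx i 0) F x.

End torus_functions.

Section norms.
Context {R : realType}.

(** The library norm on matrices is the sup norm. *)
Definition norm2 n (u : 'cV[R]_n) : R := Num.sqrt (\sum_i u i 0 ^+ 2).

Definition dot n (u v : 'cV[R]_n) : R := \sum_i u i 0 * v i 0.

Definition linf_norm d (F : 'cV[R]_d -> R) : \bar R :=
  'N[torus_measure d]_(+oo) [EFin \o F].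

Definition power_cost (q : R) n (u : 'cV[R]_n) : R := norm2 u `^ q / q.

End norms.

Section control_problem.
Context {R : realType} (d m : nat).
Variables (rho q q' : R) (f : 'cV[R]_d -> R).
Variables (a : 'cV[R]_d -> 'cV[R]_d) (B : 'cV[R]_d -> 'M[R]_(d, m)).

Local Notation leb := (@lebesgue_measure R).

Definition dynamics (x : 'cV[R]_d) (u : 'cV[R]_m) : 'cV[R]_d :=
  a x + B x *m u.

(** Caratheodory solutions: x is absolutely continuous and solves the
    equation for almost every t >= 0. Values at t < 0 are irrelevant. *)
Definition is_trajectory (x0 : 'cV[R]_d) (u : R -> 'cV[R]_m)
    (x : R -> 'cV[R]_d) : Prop :=
  forall t, 0 <= t -> forall i,
    leb.-integrable `[0, t] (fun s => (dynamics (x s) (u s) i 0)%:E) /\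
    x t i 0 = x0 i 0 + \int[leb]_(s in `[0, t]) dynamics (x s) (u s) i 0.

Definition discounted_cost (x : R -> 'cV[R]_d) (u : R -> 'cV[R]_m) : \bar R :=
  (rho%:E * \int[leb]_(t in `[0%R, +oo[)
     (expR (- rho * t) * (f (x t) + power_cost q (u t)))%:E)%E.

Definition value_function (x0 : 'cV[R]_d) : \bar R :=
  ereal_inf [set c | exists (u : R -> 'cV[R]_m) (x : R -> 'cV[R]_d),
    [/\ measurable_fun (`[0, +oo[ : set R) u, is_trajectory x0 u x &
        c = discounted_cost x u]].

(** The function [g] represents the distribution B^T (grad V) on the torus. As
    B is Lipschitz, the product of the distribution D_i V and B_ij is
    phi |-> - int V D_i (B_ij phi), and D_i (B_ij phi) exists almost
    everywhere. *)
Definition is_Btgrad (V : 'cV[R]_d -> R) (g : 'cV[R]_d -> 'cV[R]_m) : Prop :=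
  forall (phi : 'cV[R]_d -> R) (j : 'I_m), C1_torus phi ->
    \int[torus_measure d]_x (g x j 0 * phi x) =
    - \int[torus_measure d]_x
        (V x * \sum_i 'D_(delta_mx i 0) (fun y => B y i j * phi y) x).

Definition is_optimal_controller (ustar : 'cV[R]_d -> 'cV[R]_m) : Prop :=
  [/\ measurable_fun setT ustar, torus_periodic ustar &
   exists g : 'cV[R]_d -> 'cV[R]_m,
   [/\ measurable_fun setT g,
       (linf_norm (@norm2 R m \o g) < +oo)%E,
       is_Btgrad (fine \o value_function) g &
       {ae torus_measure d, forall x,
          ustar x = grad (@power_cost R q' m) (- rho^-1 *: g x)}]].

(** A solution of the closed-loop equation with feedback [u]; on t >= 0 it is
    the solution whenever the equation is well posed (e.g. [u] Lipschitz). *)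
Definition closed_loop (u : 'cV[R]_d -> 'cV[R]_m) (x0 : 'cV[R]_d) :
    R -> 'cV[R]_d :=
  xget (fun=> x0) [set x | is_trajectory x0 (u \o x) x].

(** [X x0] is the closed-loop trajectory x( . | x0) of the feedback [u]. *)
Definition perf (mu0 : probability 'cV[R]_d R) (u : 'cV[R]_d -> 'cV[R]_m)
    (X : 'cV[R]_d -> R -> 'cV[R]_d) : \bar R :=
  (\int[mu0]_x0 discounted_cost (X x0) (u \o X x0))%E.

(** [X x0 t] is a lift, [torus_rep] brings it back to the unit cube. *)
Definition occupation (mu0 : probability 'cV[R]_d R)
    (X : 'cV[R]_d -> R -> 'cV[R]_d) (A : set 'cV[R]_d) : \bar R :=
  (\int[mu0]_x0 (rho%:E * \int[leb]_(t in `[0%R, +oo[)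
     (expR (- rho * t) * \1_A (torus_rep (X x0 t)))%:E))%E.

Definition pos_part_mass (T : ('cV[R]_d -> R) -> R) : \bar R :=
  ereal_sup [set (T V)%:E | V in
    [set V | C1_torus V /\ forall x, 0 <= V x <= 1]].

(** The distribution mu0 - mu - rho^-1 div (a mu + B w), where
    <div F, V> = - int F . grad V. *)
Definition residual (mu0 : 'cV[R]_d -> R) (w : 'cV[R]_d -> 'cV[R]_m)
    (mu : 'cV[R]_d -> R) (V : 'cV[R]_d -> R) : R :=
  \int[torus_measure d]_x ((mu0 x - mu x) * V x) +
  rho^-1 * \int[torus_measure d]_x dot (mu x *: a x + B x *m w x) (grad V x).

(** Where mu x = 0 the first integrand vanishes. *)
Definition J (CV : R) (mu0 : 'cV[R]_d -> R) (w : 'cV[R]_d -> 'cV[R]_m)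
    (mu : 'cV[R]_d -> R) : \bar R :=
  (\int[torus_measure d]_x
     ((f x + power_cost q ((mu x)^-1 *: w x)) * mu x)%:E
   + CV%:E * pos_part_mass (residual mu0 w mu))%E.

(** [residual_measure] and [J_measure] are [residual] and [J] for an
    arbitrary measure [mu] and the vector measure w = u mu. *)
Definition residual_measure (mu0 : 'cV[R]_d -> R) (u : 'cV[R]_d -> 'cV[R]_m)
    (mu : {measure set 'cV[R]_d -> \bar R}) (V : 'cV[R]_d -> R) : R :=
  \int[torus_measure d]_x (mu0 x * V x) - \int[mu]_x V x +
  rho^-1 * \int[mu]_x dot (dynamics x (u x)) (grad V x).

Definition J_measure (CV : R) (mu0 : 'cV[R]_d -> R)
    (u : 'cV[R]_d -> 'cV[R]_m) (mu : {measure set 'cV[R]_d -> \bar R}) :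
    \bar R :=
  (\int[mu]_x (f x + power_cost q (u x))%:E
   + CV%:E * pos_part_mass (residual_measure mu0 u mu))%E.

Definition Cu (alpha : 'cV[R]_d -> 'cV[R]_m) : R :=
  (2 * q' * fine (linf_norm f)
   + 2 `^ q * (q' - 1) * fine (linf_norm (@norm2 R m \o alpha)) `^ q)
  `^ q^-1.

Definition CV (alpha : 'cV[R]_d -> 'cV[R]_m) : R :=
  fine (linf_norm f) + Cu alpha `^ q / q.

End control_problem.

(* Main.v *)
From HB Require Import structures.
Require Import Defs.
From mathcomp Require Import all_boot all_order all_algebra.
From mathcomp Require Import all_classical all_reals all_analysis.
From mathcomp Require Import measurable_realfun ess_sup_inf lra.

(** The penalised functional [J] is an upper bound for the performance of every
    candidate feedback, and at the optimal pair it is at most the optimal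
    performance. The theorem is the difference of these two inequalities.

    Upper bound ([perf_feedback_le_J]). Let b be the closed-loop field of uc and
    l = f + R(uc) its running cost, so that 0 <= l <= CV. The discounted cost V_T
    of the feedback up to a horizon T satisfies rho (V_T - l) <= b . grad V_T:
    this is dynamic programming, where the cost beyond the horizon is dropped
    because l >= 0. If V_T were C1, then V_T / CV would be a test function with
    values in [0, 1], and pairing it with the residual
    mu0 - mu - rho^-1 div(b mu) would give
      int mu0 V_T - int mu l <= CV * (mass of the positive part of the residual).
    As V_T is only Lipschitz, the differential inequality is stated with
    difference quotients along Euler steps ([subsolution]). In this form it holds
    for V_T ([trunc_value_subsolution]) and survives averaging over small
    translations ([avg_subsolution]) with a small loss; averaging once along each
    coordinate axis makes V_T a C1 function ([mollify_C1]). Letting the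
    mollification vanish, and then T tend to infinity, bounds the performance
    by [J] ([feedback_cost_le]).

    Optimal pair ([J_measure_le_perf]). Discounting at rate rho is observing the
    trajectory at an independent exponential time. Hence the occupation measure
    is the law of the position at that time ([occupation_pushforward]), and the
    running cost integrates against it to the performance ([occupation_cost]).
    The chain rule for absolutely continuous trajectories ([chain_rule]) and
    Fubini's theorem ([discount_law_primitive]) show that it solves the
    continuity equation against C1 functions ([occupation_stationary]). The
    residual then vanishes on all test functions and the penalty is at most 0.
    The integrals involved are finite because the optimal cost is at most the
    cost of the null control ([value_function_bounded]). *)

Set Implicit Arguments.
Unset Strict Implicit.
Unset Printing Implicit Defensive.

Import Order.TTheory GRing.Theory Num.Theory.
Import numFieldNormedType.Exports.

Local Open Scope classical_set_scope.
Local Open Scope ring_scope.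

(** * Periodic functions on the torus *)

Lemma entry_le_norm (R : realType) m n (x : 'M[R]_(m, n)) i j :
  `|x i j| <= `|x|.
Proof.
rewrite [leRHS]/Num.norm /= mx_normrE; apply/bigmax_geP; right => /=.
by exists (i, j).
Qed.

Lemma norm_le_entries (R : realType) m n (x : 'M[R]_(m, n)) c : 0 <= c ->
  (forall i j, `|x i j| <= c) -> `|x| <= c.
Proof.
move=> c0 xc; rewrite [leLHS]/Num.norm /= mx_normrE.
by apply/bigmax_leP; split => // -[i j] _ /=; exact: xc.
Qed.

Lemma norm_le_col (R : realType) n (x : 'cV[R]_n) c : 0 <= c ->
  (forall i, `|x i 0| <= c) -> `|x| <= c.
Proof. by move=> c0 xc; apply: norm_le_entries => // i j; rewrite ord1. Qed.

Lemma norm_delta_le1 (R : realType) n (i : 'I_n) : `|delta_mx i 0 : 'cV[R]_n| <= 1.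
Proof.
apply: norm_le_entries => // j k; rewrite mxE.
by case: (_ && _); rewrite ?normr1 ?normr0.
Qed.
Lemma norm_trmx (R : realType) m n (x : 'M[R]_(m, n)) : `|x^T| = `|x|.
Proof.
apply/eqP; rewrite eq_le; apply/andP; split; apply: norm_le_entries => // i j.
  by rewrite mxE entry_le_norm.
by have := entry_le_norm x^T j i; rewrite mxE.
Qed.

Lemma lipschitzP (R : realType) (V W : normedModType R) (F : V -> W) :
  lipschitz F -> exists2 L, 0 <= L & forall x y, `|F x - F y| <= L * `|x - y|.
Proof.
move=> /pinfty_ex_gt0[L L0 FL]; exists L; first exact: ltW.
by move=> x y; exact: (FL (x, y)).
Qed.

Lemma lip_continuous (R : realType) (V W : normedModType R) (F : V -> W) L :
  (forall x y, `|F x - F y| <= L * `|x - y|) -> continuous F.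
Proof.
move=> FL x; apply/cvgrPdist_le => e e0.
have M0 : 0 < Num.max L 1 by rewrite lt_max ltr01 orbT.
near=> y; rewrite (le_trans (FL _ _))//.
rewrite (@le_trans _ _ (Num.max L 1 * `|x - y|))//.
  by rewrite ler_wpM2r// le_max lexx.
rewrite -ler_pdivlMl// mulrC; near: y.
apply: cvgr_dist_le; [exact: cvg_id|by rewrite divr_gt0].
Unshelve. all: by end_near. Qed.

(** Transposition reduces the claim to boxes of row vectors. *)
Lemma compact_cVbox (R : realType) n (a b : R) :
  compact [set x : 'cV[R]_n | forall i, a <= x i 0 <= b].
Proof.
have -> : [set x : 'cV[R]_n | forall i, a <= x i 0 <= b] =
  trmx @` [set v : 'rV[R]_n | forall i, `[a, b]%classic (v ord0 i)].
  apply/seteqP; split=> [x /= xab|_ /= [v vab <-] i].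
    exists x^T; last by rewrite trmxK.
    by move=> i; rewrite mxE/= in_itv/=; exact: xab.
  by rewrite mxE; have := vab i; rewrite /= in_itv.
apply: continuous_compact; last first.
  by apply: (@rV_compact _ _ (fun=> `[a, b]%classic)) => i; exact: segment_compact.
apply: continuous_subspaceT; apply: (@lip_continuous _ _ _ _ 1) => x y.
by rewrite mul1r -linearB norm_trmx.
Qed.

Section periodic.
Context {R : realType} {d : nat} {T : Type}.
Variables (F : 'cV[R]_d -> T) (Fper : torus_periodic F).

Lemma periodic_int x i (z : int) : F (x + z%:~R *: delta_mx i 0) = F x.
Proof.
have nat_case (n : nat) y : F (y + (delta_mx i 0) *+ n) = F y.
  by elim: n => [|n IH]; rewrite ?mulr0n ?addr0// mulrSr addrA Fper.
rewrite scaler_int; case: z => n; first exact: nat_case.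
by rewrite NegzE mulrNz -[LHS](nat_case n.+1) subrK.
Qed.

Lemma periodic_lattice x y : F (y + (torus_rep x - x)) = F y.
Proof.
have sum_case (s : seq 'I_d) (z : 'I_d -> int) :
    F (y + \sum_(i <- s) (z i)%:~R *: delta_mx i 0) = F y.
  elim: s y => [|i s IH] v; first by rewrite big_nil addr0.
  by rewrite big_cons addrA IH periodic_int.
rewrite -[RHS](sum_case (index_enum 'I_d) (fun i => - Num.floor (x i 0))).
congr (F (_ + _)); apply/colP => i; rewrite !mxE summxE (bigD1 i)//= big1 ?addr0.
  by rewrite !mxE !eqxx /= mulr1 mulrNz addrAC subrr add0r.
move=> j ji; rewrite !mxE [i == j]eq_sym (negbTE ji) /=.
exact: mulr0.
Qed.

Lemma periodic_torus_rep x : F (torus_rep x) = F x.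
Proof. by rewrite -[RHS](periodic_lattice x) addrC subrK. Qed.

End periodic.

Lemma torus_rep_itv (R : realType) d (x : 'cV[R]_d) i :
  0 <= torus_rep x i 0 < 1.
Proof.
by rewrite mxE subr_ge0 floor_le ltrBlDl -[X in _ + X]/(1%:~R) -intrD floorD1_gt.
Qed.

Section periodic_continuous.
Context {R : realType} {d : nat} {W : normedModType R}.
Variables (g : 'cV[R]_d -> W) (gper : torus_periodic g) (gcont : continuous g).

Lemma periodic_bounded : exists2 M, 0 <= M & forall x, `|g x| <= M.
Proof.
have /compact_bounded[M [_ gM]] : compact (g @` @unit_cube R d).
  apply: continuous_compact; [exact: continuous_subspaceT|exact: compact_cVbox].
exists (`|M| + 1) => [|x]; first by rewrite addr_ge0.
apply: gM; first by rewrite (le_lt_trans (ler_norm M))// ltrDl.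
exists (torus_rep x); last exact: periodic_torus_rep.
by move=> i; have /andP[-> /ltW ->] := torus_rep_itv x i.
Qed.

(** Both points are translated by the lattice vector that brings the first one
    into the unit cube, so that compactness of the cube gives a common radius. *)
Lemma periodic_unif_continuous (e : R) : 0 < e ->
  exists2 delta, 0 < delta & forall x y, `|x - y| <= delta -> `|g x - g y| <= e.
Proof.
move=> e0; have e20 : 0 < e / 2 by rewrite divr_gt0.
have := @compact_cVbox R d 0 1; rewrite compact_near_coveringP.
move=> /(_ R (0 : R)^'+
  (fun delta x => forall y, `|x - y| <= delta -> `|g x - g y| <= e))[].
  move=> x _; have /cvgrPdist_le/(_ _ e20) := @gcont x.
  move=> /nbhs_normP[r /= r0 xr].
  exists (ball x (r / 2), [set t | t < r / 2]).
    split => /=; first by apply: nbhsx_ballx; rewrite divr_gt0.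
    by apply: nbhs_right_lt; rewrite divr_gt0.
  move=> [z t] /= [xz tr] y zy; rewrite -(subrKA (g x)).
  rewrite (le_trans (ler_normD _ _))// [e]splitr lerD//.
    rewrite distrC; apply: xr => /=.
    by move: xz; rewrite -ball_normE /=; lra.
  apply: xr => /=; rewrite -(subrKA z) (le_lt_trans (ler_normD _ _))//.
  by move: xz; rewrite -ball_normE /=; lra.
move=> delta /= delta0 H.
near (0 : R)^'+ => s.
have s0 : 0 < s by [].
exists s => // x y xy.
rewrite -(periodic_lattice gper x x) -(periodic_lattice gper x y).
apply: (H s) => //.
- by rewrite /= sub0r normrN gtr0_norm.
- by move=> i; rewrite addrC subrK; have /andP[-> /ltW ->] := torus_rep_itv x i.
- by rewrite opprD addrACA subrr addr0.
Unshelve. all: by end_near. Qed.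

End periodic_continuous.

(** An open set is the union of the boxes with rational centre and radius
    [k.+1%:R^-1] that it contains, and there are countably many of them. *)
Lemma open_measurable_cV (R : realType) d (U : set 'cV[R]_d) :
  open U -> measurable U.
Proof.
move=> oU.
pose box (p : 'cV[rat]_d * nat) : set 'cV[R]_d :=
  [set x | forall i, `|x i 0 - ratr (p.1 i 0)| < p.2.+1%:R^-1].
have mbox p : measurable (box p).
  have -> : box p = \bigcap_(i in [set: 'I_d])
      ((fun M : 'cV[R]_d => M i 0) @^-1` ball (ratr (p.1 i 0) : R) p.2.+1%:R^-1).
    apply/seteqP; split=> x xp i; first by rewrite /ball /= distrC => _; exact: xp.
    by have := xp i I; rewrite /ball /= distrC.
  apply: fin_bigcap_measurable => // i _; rewrite -[_ @^-1` _]setTI.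
  by apply: measurable_entry => //; exact: measurable_ball.
have -> : U = \bigcup_p (if `[< box p `<=` U >] then box p else set0).
  apply/seteqP; split => [x Ux|x [p _]]; last by case: asboolP => // + ?; exact.
  have /nbhs_normP[r /= r0 xrU] : nbhs x U by exact: open_nbhs_nbhs.
  have [k [e [ke e0 er]]] : exists k (e : R),
      [/\ k.+1%:R^-1 = e, 0 < e & e < r / 2].
    have r20 : 0 < r / 2 by rewrite divr_gt0.
    have [k _ /(_ k (leqnn k)) kr] := near_infty_natSinv_lt (PosNum r20).
    by exists k, k.+1%:R^-1; split => //; rewrite invr_gt0.
  have /choice[c cP] i : exists q : rat, `|x i 0 - ratr q| < e.
    have [q] : exists q : rat, ratr q \in `](x i 0 - e), (x i 0 + e)[.
      by apply: rat_in_itvoo; lra.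
    rewrite in_itv/= => qx; exists q.
    by rewrite ltr_norml; move: (ratr q) qx => ? ?; lra.
  have xbox : box (\col_i c i, k) x by move=> i; rewrite /= mxE ke; exact: cP.
  exists (\col_i c i, k) => //; rewrite asboolT// => y ybox; apply: xrU => /=.
  rewrite (@le_lt_trans _ _ (e + e))//; last by lra.
  apply: norm_le_col => [|i]; first by rewrite addr_ge0// ltW.
  have := ybox i; have := xbox i; rewrite !mxE /= ke.
  move: (x i 0) (y i 0) (ratr _) => X Y c' Xc Yc.
  by rewrite -(subrKA c') (le_trans (ler_normD _ _))// [X in _ + X]distrC; lra.
apply: countable_bigcupT_measurable => // p.
by case: asboolP => // _; exact: measurable0.
Qed.

Lemma continuous_measurable_cV (R : realType) d (F : 'cV[R]_d -> R) :
  continuous F -> measurable_fun setT F.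
Proof.
move=> Fc; apply: (measurability _ (RGenOpens.measurableE R)).
move=> _ [_ [a [b ->] <-]]; rewrite setTI.
by apply: open_measurable_cV; apply: open_comp; last exact: interval_open.
Qed.

(** Where a continuous function exceeds its essential supremum it does so on a
    neighbourhood, which contains a box of positive measure. The box starts at
    the representative [x] of the point and extends to the right only, so as to
    stay in the unit cube. *)
Lemma le_linf_norm (R : realType) d (F : 'cV[R]_d -> R) :
  torus_periodic F -> continuous F -> forall x, `|F x| <= fine (linf_norm F).
Proof.
move=> Fper Fc x0; set S := fine _.
rewrite -(periodic_torus_rep Fper); have x01 := torus_rep_itv x0.
move: (torus_rep x0) x01 => {x0} x x01.
have [M M0 FM] := periodic_bounded Fper Fc.
have linfE : linf_norm F = ess_sup (torus_measure d) (abse \o (EFin \o F)).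
  have P1 : torus_measure d [set: 'cV[R]_d] = 1%E by exact: probability_setT.
  by rewrite /linf_norm unlock /= P1 lte01.
have linf_fin : linf_norm F \is a fin_num.
  rewrite ge0_fin_numE; last by rewrite /linf_norm Lnorm_ge0.
  rewrite (@le_lt_trans _ _ M%:E)// ?ltry// linfE.
  by apply/ess_supP; apply: aeW => y /=; rewrite lee_fin.
have /ess_supP : (ess_sup (torus_measure d) (abse \o (EFin \o F)) <= S%:E)%E.
  by rewrite -linfE /S fineK.
rewrite leNgt => SF; apply/negP => Sx.
have /nbhs_normP[r /= r0 xr] : nbhs x [set y | S < `|F y|].
  have Fnc : continuous (fun y => `|F y|).
    by move=> y; apply: continuous_comp; [exact: Fc|exact: norm_continuous].
  by have := Fnc x; move=> /cvgr_gt; exact.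
pose s := \big[Num.min/(r / 2)]_i (1 - x i 0).
have s0 : 0 < s.
  apply/bigmin_gtP; split; first by rewrite divr_gt0.
  by move=> i _; rewrite subr_gt0; have /andP[] := x01 i.
have sr : s < r.
  rewrite (@le_lt_trans _ _ (r / 2))//; last by lra.
  exact: bigmin_le_id.
pose A := [set y : 'cV[R]_d | forall i, x i 0 <= y i 0 <= (\col_i (x i 0 + s)) i 0].
have : (0 < torus_measure d A)%E.
  rewrite torus_measure_box; last first.
    move=> i; rewrite mxE lerDl (ltW s0) -lerBrDl; have /andP[-> _] := x01 i.
    by split=> //; split=> //; exact: bigmin_le_cond.
  by rewrite lte_fin prodr_gt0// => i _; rewrite mxE addrC addKr.
apply/negP; rewrite -leNgt.
have mA : measurable A.
  have -> : A = \bigcap_(i in [set: 'I_d])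
      ((fun y : 'cV[R]_d => y i 0) @^-1` `[x i 0, x i 0 + s]).
    apply/seteqP; split=> y yA i.
      by have := yA i; rewrite mxE /= in_itv.
    by have := yA i I; rewrite mxE /= in_itv.
  apply: fin_bigcap_measurable => // i _; rewrite -[_ @^-1` _]setTI.
  exact: measurable_entry.
have -> : torus_measure d A = 0%E; last by [].
apply/eqP; rewrite -measure_le0.
case: SF => N [mN N0 SN]; rewrite -N0 le_measure ?inE//.
apply: subset_trans SN => y yA /=; rewrite lee_fin.
apply/negP; rewrite -ltNge; apply: xr => /=.
rewrite (le_lt_trans _ sr)//; apply: norm_le_col => [|i]; first exact: ltW.
have := yA i; rewrite !mxE; move: (x i 0) (y i 0) => X Y.
by rewrite ler_norml => /andP[]; lra.
Qed.

Lemma continuous_estimate (R : realType) (V W : normedModType R) (g : V -> W) x :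
  {for x, continuous g} -> forall e : R, 0 < e ->
  exists2 r : R, 0 < r & forall y, `|y| < r -> `|g (x + y) - g x| <= e.
Proof.
move=> gx e e0; have /cvgrPdist_le/(_ _ e0) := gx.
move=> /nbhs_normP[r /= r0 xr]; exists r => // y yr.
by rewrite distrC; apply: xr; rewrite /= opprD addrA subrr add0r normrN.
Qed.

Section line_derivative.
Context {R : realType} {V : normedModType R}.
Variables (F : V -> R).

Lemma is_derive_line (x v : V) (t l : R) :
  is_derive (x + t *: v) v F l -> is_derive t 1 (fun s : R => F (x + s *: v)) l.
Proof.
have E (h : R) : ((fun s : R => F (x + s *: v)) \o shift t) (h *: 1) =
    (F \o shift (x + t *: v)) (h *: v).
  by rewrite /= [h *: 1]mulr1 scalerDl addrCA.
move=> [dF DF]; have EE : (fun h => h^-1 *: (((fun s : R => F (x + s *: v)) \o shift t)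
    (h *: 1) - F (x + t *: v))) = (fun h => h^-1 *:
    ((F \o shift (x + t *: v)) (h *: v) - F (x + t *: v))).
  by apply/funext => h; rewrite E.
by split; [rewrite /derivable EE|rewrite -DF /derive EE].
Qed.

(** Both signs of [s] are needed: [s] will be a coordinate of an increment. *)
Lemma line_MVT (G : V -> R) (x v : V) (s : R) :
  (forall y, is_derive y v F (G y)) ->
  exists2 t, `|t| <= `|s| & F (x + s *: v) - F x = s * G (x + t *: v).
Proof.
move=> FG; pose phi (t : R) := F (x + t *: v).
have dphi (t : R) : is_derive t 1 phi (G (x + t *: v)) by exact/is_derive_line.
have cphi A : {within A, continuous phi}.
  apply: continuous_subspaceT => t; apply: differentiable_continuous.
  by apply/derivable1_diffP; have [] := dphi t.
have [s0|/ltW s0] := leP 0 s.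
  have [t] := MVT_segment s0 (fun t _ => dphi t) (cphi _).
  rewrite in_itv/= /phi scale0r addr0 subr0 mulrC => /andP[t0 ts] E.
  by exists t; rewrite // !ger0_norm.
have [t] := MVT_segment s0 (fun t _ => dphi t) (cphi _).
rewrite in_itv/= /phi scale0r addr0 sub0r => /andP[st t0] E; exists t.
  by rewrite !ler0_norm// lerN2.
by rewrite -opprB E mulrN opprK mulrC.
Qed.

End line_derivative.

Section differential_cV.
Context {R : realType} {d : nat}.

Definition linear_form (c v : 'cV[R]_d) : R := dot v c.

Fact linear_form_is_linear c : linear (linear_form c : 'cV[R]_d -> R^o).
Proof.
move=> k u v; rewrite /linear_form /dot scaler_sumr -big_split/=.
by apply: eq_bigr => i _; rewrite !mxE mulrDl -mulrA.
Qed.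

HB.instance Definition _ c := GRing.isLinear.Build R 'cV[R]_d R^o _
  (linear_form c) (linear_form_is_linear c).

Lemma le_dot (u v : 'cV[R]_d) : `|dot u v| <= d%:R * `|u| * `|v|.
Proof.
rewrite /dot (le_trans (ler_norm_sum _ _ _))//.
rewrite (@le_trans _ _ (\sum_(i < d) `|u| * `|v|))//.
  by apply: ler_sum => i _; rewrite normrM ler_pM// entry_le_norm.
by rewrite sumr_const card_ord -mulrA mulr_natl.
Qed.

Lemma linear_form_continuous c : continuous (linear_form c).
Proof.
apply: (@lip_continuous _ _ _ _ (d%:R * `|c|)) => x y.
rewrite -[_ - _]/(linear_form c x - linear_form c y : R^o).
by rewrite -linearB mulrAC; exact: le_dot.
Qed.

Lemma differentiable_of_estimate (F : 'cV[R]_d -> R) x c :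
  (forall e, 0 < e -> exists2 r, 0 < r &
    forall v, `|v| < r -> `|F (x + v) - F x - dot v c| <= e * `|v|) ->
  differentiable F x.
Proof.
move=> H.
have E : F \o shift x = cst (F x) + linear_form c +o_ (0 : 'cV[R]_d) id.
  apply/eqaddoP => e e0; have [r r0 Hr] := H _ e0.
  have : nbhs (0 : 'cV[R]_d) [set v | `|v| < r].
    exact: (@nbhs0_lt R (matrix R d 1) r r0).
  apply: filterS => v vr.
  change (`|F (v + x) - (F x + dot v c)| <= e * `|v|).
  by rewrite opprD addrA [v + x]addrC; exact: Hr.
have D := diff_unique (@linear_form_continuous c) E.
apply/diff_locallyP; rewrite D; split => //.
exact: linear_form_continuous.
Qed.

Lemma cV_sum_delta (v : 'cV[R]_d) : v = \sum_i v i 0 *: delta_mx i 0.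
Proof.
apply/colP => i; rewrite summxE (bigD1 i)//= big1 ?addr0; last first.
  by move=> j ji; rewrite !mxE [i == j]eq_sym (negbTE ji) /= mulr0.
by rewrite !mxE !eqxx /= mulr1.
Qed.

Lemma dot_grad (F : 'cV[R]_d -> R) x v : differentiable F x ->
  'd F x v = dot v (grad F x).
Proof.
move=> dF; rewrite {1}[v]cV_sum_delta linear_sum; apply: eq_bigr => i _.
by rewrite linearZ /= mxE deriveE.
Qed.

(** The increment from [x] to [x + v] is split into moves along one axis at a
    time. The mean value theorem turns each move into a partial derivative at a
    point close to [x]. *)
Lemma C1_of_partials (F : 'cV[R]_d -> R) (G : 'I_d -> 'cV[R]_d -> R) :
  (forall i, continuous (G i)) ->
  (forall i x, is_derive x (delta_mx i 0) F (G i x)) -> C1 F.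
Proof.
move=> Gc FG.
have gradE x : grad F x = \col_i G i x.
  by apply/colP => i; rewrite !mxE; have [] := FG i x.
have dF x : differentiable F x.
  apply: (@differentiable_of_estimate F x (\col_i G i x)) => e e0.
  have ed0 : 0 < e / d.+1%:R by rewrite divr_gt0.
  have [r r0 rG] : exists2 r : R, 0 < r &
      forall y, `|y| < r -> forall i, `|G i (x + y) - G i x| <= e / d.+1%:R.
    have /choice[r rP] i : exists r : R, 0 < r /\
        forall y, `|y| < r -> `|G i (x + y) - G i x| <= e / d.+1%:R.
      by have [r r0 H] := continuous_estimate (@Gc i x) ed0; exists r.
    exists (\big[Num.min/1]_i r i).
      by apply/bigmin_gtP; split => // i _; have [] := rP i.
    by move=> y /bigmin_gtP[_ yr] i; have [_] := rP i; apply; exact: yr.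
  exists (r / d.+1%:R); first by rewrite divr_gt0.
  move=> v vr.
  have vr' : d.+1%:R * `|v| < r by rewrite mulrC -ltr_pdivlMr.
  have sumv (s : seq 'I_d) :
      `|\sum_(i <- s) v i 0 *: (delta_mx i 0 : 'cV[R]_d)| <= (size s)%:R * `|v|.
    elim: s => [|i s IH]; first by rewrite big_nil normr0 mul0r.
    rewrite big_cons (le_trans (ler_normD _ _))//= -[(size s).+1]add1n natrD mulrDl.
    rewrite lerD// mul1r normrZ -[leRHS]mulr1 ler_pM// ?entry_le_norm//.
    exact: norm_delta_le1.
  have step (s : seq 'I_d) : (size s <= d)%N ->
      `|F (x + \sum_(i <- s) v i 0 *: delta_mx i 0) - F x
        - \sum_(i <- s) v i 0 * G i x| <= (size s)%:R * (e / d.+1%:R) * `|v|.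
    elim: s => [|i s IH] sd.
      by rewrite !big_nil addr0 !subrr normr0 !mul0r.
    rewrite !big_cons [v i 0 *: _ + _]addrC addrA.
    set y := \sum_(j <- s) _; set z := \sum_(j <- s) _.
    have [t tv E] := line_MVT (x + y) (v i 0) (FG i).
    rewrite -[X in `|X|](_ : (F (x + y + v i 0 *: delta_mx i 0) - F (x + y)
      - v i 0 * G i x) + (F (x + y) - F x - z) = _); last by lra.
    rewrite E -mulrBr (le_trans (ler_normD _ _))//=.
    rewrite -[(size s).+1]add1n natrD !mulrDl lerD ?IH//; last exact: ltnW.
    rewrite mul1r normrM mulrC ler_pM// ?entry_le_norm// -addrA.
    apply: rG; rewrite (le_lt_trans _ vr')// (le_trans (ler_normD _ _))//.
    rewrite -[X in X%:R * _]addn1 natrD mulrDl mul1r lerD//.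
      by rewrite (le_trans (sumv _))// ler_wpM2r// ler_nat ltnW.
    rewrite normrZ -[leRHS]mulr1 ler_pM//.
      by rewrite (le_trans tv)// entry_le_norm.
    exact: norm_delta_le1.
  have := step (index_enum 'I_d).
  have -> : size (index_enum 'I_d) = d.
    by rewrite /index_enum unlock /= -enumT size_enum_ord.
  move=> /(_ (leqnn d)).
  have <- : v = \sum_i v i 0 *: delta_mx i 0 := cV_sum_delta v.
  have -> : dot v (\col_i G i x) = \sum_i v i 0 * G i x.
    by apply: eq_bigr => i _; rewrite mxE.
  move=> /le_trans; apply; rewrite ler_wpM2r// mulrCA ger_pMr//.
  by rewrite ler_pdivrMr// mul1r ler_nat.
split => // v.
rewrite (_ : (fun x => _) = fun x => \sum_i v i 0 * G i x).
  apply: (continuous_big (op := +%R)) => [|i _]; first exact: add_continuous.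
  by move=> x; apply: (cvgM (cvg_cst (v i 0)) (@Gc i x)).
apply/funext => x; rewrite dot_grad// gradE.
by apply: eq_bigr => i _; rewrite mxE.
Qed.
End differential_cV.

Section C1_periodic.
Context {R : realType} {d : nat}.

Lemma diff_periodic (W : normedModType R) (F : 'cV[R]_d -> W) v :
  torus_periodic F -> C1 F -> torus_periodic (fun x => 'd F x v).
Proof.
move=> Fper [dF _] x i.
have E (y : 'cV[R]_d) : 'd F y v = 'D_v F y.
  by apply/esym; apply: deriveE; exact: dF.
apply: etrans (E _) (etrans _ (esym (E _))); rewrite /derive.
set u := fun h => _; set w := fun h => _.
suff -> : u = w by [].
by apply/funext => h; rewrite /u /w /= addrA !Fper.
Qed.

Lemma C1_periodic_diff_le (W : normedModType R) (F : 'cV[R]_d -> W) :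
  torus_periodic F -> C1 F ->
  exists2 M, 0 <= M & forall x v, `|'d F x v| <= M * `|v|.
Proof.
move=> Fper FC1; have [dF cF] := FC1.
have /choice[M MP] (i : 'I_d) : exists M : R, 0 <= M /\
    forall x, `|'d F x (delta_mx i 0)| <= M.
  by have [M M0 FM] := periodic_bounded (diff_periodic (delta_mx i 0) Fper FC1)
    (cF (delta_mx i 0)); exists M.
exists (\sum_i M i) => [|x v]; first by apply: sumr_ge0 => i _; have [] := MP i.
rewrite [v in 'd F x v]cV_sum_delta linear_sum (le_trans (ler_norm_sum _ _ _))//.
rewrite mulr_suml; apply: ler_sum => i _; rewrite linearZ normrZ mulrC.
by rewrite ler_pM// ?entry_le_norm//; have [_ ->] := MP i.
Qed.

Lemma C1_periodic_lipschitz m (F : 'cV[R]_d -> 'cV[R]_m) :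
  torus_periodic F -> C1 F ->
  exists2 L, 0 <= L & forall x y, `|F x - F y| <= L * `|x - y|.
Proof.
move=> Fper FC1; have [L L0 FL] := C1_periodic_diff_le Fper FC1.
exists L => // x y; apply: norm_le_col => [|j]; first by rewrite mulr_ge0.
have [dF _] := FC1.
have der z : is_derive z (x - y) (fun u => F u j 0) (('d F z (x - y)) j 0).
  have dz : derivable F z (x - y) by exact: diff_derivable.
  split; first by have /derivable_mxP := dz; apply.
  have <- : 'D_(x - y) F z = 'd F z (x - y) by apply: deriveE; exact: dF.
  by rewrite derive_mx// mxE.
have [t _] := line_MVT y 1 der.
rewrite /= scale1r mul1r [y + _]addrC subrK => E; rewrite !mxE E.
by rewrite (le_trans (entry_le_norm _ _ _))// FL.
Qed.

Lemma grad_unif_continuous (F : 'cV[R]_d -> R) : C1_torus F ->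
  forall e, 0 < e -> exists2 r, 0 < r & forall x y, `|x - y| <= r ->
    forall i, `|grad F x i 0 - grad F y i 0| <= e.
Proof.
move=> [Fper FC1] e e0; have [dF cF] := FC1.
have /choice[r rP] (i : 'I_d) : exists r : R, 0 < r /\ forall x y,
    `|x - y| <= r -> `|grad F x i 0 - grad F y i 0| <= e.
  have [r r0 H] := periodic_unif_continuous (diff_periodic (delta_mx i 0) Fper FC1)
    (cF (delta_mx i 0)) e0.
  by exists r; split=> // x y xy; rewrite !mxE !(deriveE _ (dF _)); exact: H.
exists (\big[Num.min/1]_i r i).
  by apply/bigmin_gtP; split => // i _; have [] := rP i.
by move=> x y /bigmin_geP[_ xy] i; have [_] := rP i; apply; exact: xy.
Qed.

(** The error is uniform in the base point because the gradient of a periodic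
    C1 function is uniformly continuous. *)
Lemma C1_torus_estimate (F : 'cV[R]_d -> R) : C1_torus F ->
  forall e, 0 < e -> exists2 r, 0 < r & forall x v, `|v| <= r ->
    `|F (x + v) - F x - dot v (grad F x)| <= e * `|v|.
Proof.
move=> F1 e e0; have [_ [dF _]] := F1.
have ed0 : 0 < e / d.+1%:R by rewrite divr_gt0.
have [r r0 gradr] := grad_unif_continuous F1 ed0; exists r => // x v vr.
have der y : is_derive y v F (dot v (grad F y)).
  by split; [exact: diff_derivable|rewrite (deriveE _ (dF y)) dot_grad].
have [t tv] := line_MVT x 1 der; rewrite scale1r mul1r => ->.
rewrite normr1 in tv.
rewrite /dot -sumrB (le_trans (ler_norm_sum _ _ _))//.
rewrite (@le_trans _ _ (\sum_(i < d) (e / d.+1%:R * `|v|)))//.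
  apply: ler_sum => i _; rewrite -mulrBr normrM mulrC ler_pM// ?entry_le_norm//.
  apply: gradr; rewrite addrAC subrr add0r normrZ.
  by rewrite (le_trans _ vr)// -[leRHS]mul1r ler_wpM2r.
rewrite sumr_const card_ord -[X in X <= _]mulr_natl mulrA ler_wpM2r// mulrCA ger_pMr//.
by rewrite ler_pdivrMr// mul1r ler_nat.
Qed.

End C1_periodic.

(** * Integrals of continuous functions on intervals *)

Section integrals_of_continuous_functions.
Context {R : realType}.
Local Notation leb := (@lebesgue_measure R).
Implicit Types (g h : R -> R) (a b c t : R).

Lemma continuous_integrable g a b : continuous g ->
  leb.-integrable `[a, b] (EFin \o g).
Proof.
move=> gc; apply: continuous_compact_integrable; first exact: segment_compact.
exact: continuous_subspaceT.
Qed.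

Lemma le_Rintegral_itv g h t : leb.-integrable `[0, t] (EFin \o g) ->
  leb.-integrable `[0, t] (EFin \o h) -> (forall s, 0 <= s <= t -> g s <= h s) ->
  \int[leb]_(s in `[0, t]) g s <= \int[leb]_(s in `[0, t]) h s.
Proof. by move=> gi hi gh; apply: le_Rintegral. Qed.

Lemma Rintegral_itv_cst c t : 0 <= t -> \int[leb]_(s in `[0, t]) c = c * t.
Proof.
move=> t0; rewrite Rintegral_cst// /= lebesgue_measure_itv/= lte_fin.
by case: ltgtP t0 => //= [_|<-] _; rewrite ?oppr0 ?addr0.
Qed.

Lemma normr_Rintegral_itv g c t : 0 <= t ->
  leb.-integrable `[0, t] (EFin \o g) -> (forall s, 0 <= s <= t -> `|g s| <= c) ->
  `|\int[leb]_(s in `[0, t]) g s| <= c * t.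
Proof.
move=> t0 gi gc; rewrite (le_trans (le_normr_Rintegral _ gi))//.
rewrite -Rintegral_itv_cst//; apply: le_Rintegral_itv => //.
- exact: integrable_norm.
- by apply: continuous_integrable => s; exact: cvg_cst.
Qed.

Lemma normr_Rintegral_itv_increment g c (s t : R) : 0 <= c -> 0 <= s -> s <= t ->
  leb.-integrable `[0, t] (EFin \o g) -> (forall r, `|g r| <= c) ->
  `|\int[leb]_(r in `[0, t]) g r - \int[leb]_(r in `[0, s]) g r| <= c * (t - s).
Proof.
move=> c0 s0 st it gc; have ts0 : 0 <= t - s by rewrite subr_ge0.
rewrite Rintegral_itvB//.
have ist : leb.-integrable `]s, t] (EFin \o g).
  by apply: (integrableS _ _ _ it) => //; apply: subset_itvr; rewrite bnd_simp.
rewrite (le_trans (le_normr_Rintegral _ ist))//.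
rewrite (@le_trans _ _ (\int[leb]_(r in `]s, t]) c))//.
  apply: le_Rintegral => //.
  - exact: integrable_norm.
  - have ci : leb.-integrable `[s, t] (EFin \o (fun=> c)).
      by apply: continuous_integrable => r; exact: cvg_cst.
    by apply: (integrableS _ _ _ ci) => //; exact: subset_itv_oc_cc.
rewrite Rintegral_cst// /= lebesgue_measure_itv/= lte_fin.
by case: ifPn => //= _; rewrite mulr0 mulr_ge0.
Qed.

Lemma Rintegral_affine g a c t : continuous g -> 0 < c -> 0 <= t ->
  \int[leb]_(s in `[a, a + c * t]) g s = c * \int[leb]_(s in `[0, t]) g (a + c * s).
Proof.
move=> gc c0 t0; pose F s := a + c * s.
have dF (s : R) : is_derive s (1 : R) F (c : R).
  have := is_deriveD (is_derive_cst a s 1) (is_deriveZ c (is_derive_id s (1 : R))).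
  by rewrite add0r [c *: 1]mulr1.
have F1 : derive1 F = cst c by apply/funext => s; rewrite derive1E; have [] := dF s.
have Fc : continuous F.
  by move=> s; apply: differentiable_continuous; apply/derivable1_diffP; have [] := dF s.
have gFc : continuous (g \o F).
  by move=> s; apply: continuous_comp; [exact: Fc|exact: gc].
rewrite -RintegralZl//; last exact: continuous_integrable.
rewrite /Rintegral; congr fine.
have -> : `[a, a + c * t]%classic = `[F 0, F t]%classic by rewrite /F mulr0 addr0.
rewrite (@integration_by_substitution_increasing _ F g)//.
- by apply: eq_integral => s _; rewrite F1 /= mulrC.
- by move=> x y _ _ xy; rewrite ltrD2l ltr_pM2l.
- by rewrite F1 => x _; exact: cvg_cst.
- by rewrite F1; exact: is_cvg_cst.
- by rewrite F1; exact: is_cvg_cst.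
- split; first by move=> x _; have [] := dF x.
    by apply: cvg_at_right_filter; exact: Fc.
  by apply: cvg_at_left_filter; exact: Fc.
- exact: continuous_subspaceT.
Qed.

Lemma Rintegral_itvB_cc g a (h : R) t : continuous g -> a <= h -> h <= t ->
  \int[leb]_(s in `[a, t]) g s - \int[leb]_(s in `[a, h]) g s =
  \int[leb]_(s in `[h, t]) g s.
Proof.
move=> gc ah ht; rewrite Rintegral_itvB//; last exact: continuous_integrable.
rewrite Rintegral_itv_obnd_cbnd//.
apply: (integrableS _ _ _ (@continuous_integrable g h t gc)) => //.
exact: subset_itv_oc_cc.
Qed.

Lemma Rintegral_itvD g t (h : R) : continuous g -> 0 <= h -> 0 <= t ->
  \int[leb]_(s in `[0, t + h]) g s =
  \int[leb]_(s in `[0, h]) g s + \int[leb]_(s in `[0, t]) g (s + h).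
Proof.
move=> gc h0 t0; rewrite [RHS]addrC; apply/eqP; rewrite -subr_eq; apply/eqP.
rewrite Rintegral_itvB_cc ?lerDr//.
have := Rintegral_affine h gc ltr01 t0; rewrite !mul1r addrC => ->.
by apply: eq_Rintegral => s _; rewrite mul1r addrC.
Qed.

Lemma Rintegral_expR c t : 0 <= t ->
  \int[leb]_(s in `[0, t]) (c * expR (c * s)) = expR (c * t) - 1.
Proof.
rewrite le_eqVlt => /predU1P[<-|t0].
  by rewrite set_itv1 Rintegral_set1 mulr0 expR0 subrr.
pose F s := expR (c * s).
have dF (s : R) : is_derive s 1 F (c * F s).
  have dc : is_derive s 1 (fun s => c * s) c.
    have := is_deriveZ c (is_derive_id s (1 : R)).
    by rewrite [c *: 1]mulr1.
  by rewrite mulrC; exact: is_derive1_comp.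
have Fc : continuous F.
  by move=> s; apply: differentiable_continuous; apply/derivable1_diffP; have [] := dF s.
rewrite /Rintegral (@continuous_FTC2 _ _ F 0 t)//.
- by rewrite /F mulr0 expR0.
- by apply: continuous_subspaceT => s; apply: cvgM (cvg_cst c) (@Fc s).
- split; first by move=> x _; have [] := dF x.
    by apply: cvg_at_right_filter; exact: Fc.
  by apply: cvg_at_left_filter; exact: Fc.
- by move=> x _; rewrite derive1E; have [] := dF x.
Qed.

End integrals_of_continuous_functions.

Lemma le_of_le_geometric (R : realType) (a b c : R) :
  (forall n, a <= b + c * 2^-1 ^+ n) -> a <= b.
Proof.
move=> H; have bc : (fun n => b + c * 2^-1 ^+ n) @ \oo --> b.
  rewrite -[X in _ --> X]addr0 -[X in _ + X](mulr0 c).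
  apply: cvgD; first exact: cvg_cst.
  apply: cvgM; first exact: cvg_cst.
  by apply: cvg_expr; rewrite ger0_norm// invf_lt1// ltr1n.
by apply: (ler_cvg_to (cvg_cst a) bc); apply: nearW.
Qed.

(** The explicit rate allows the Picard iterates to be passed to the limit
    inside integrals by estimates alone. *)
Lemma cvg_of_geometric_increments (R : realType) (u : R ^nat) (c : R) :
  (forall n, `|u n.+1 - u n| <= c * 2^-1 ^+ n) ->
  exists l, forall n, `|l - u n| <= 2 * c * 2^-1 ^+ n.
Proof.
move=> uc.
have c0 : 0 <= c by have := uc 0%N; rewrite expr0 mulr1; apply: le_trans.
have um n k : `|u (n + k)%N - u n| <= 2 * c * 2^-1 ^+ n * (1 - 2^-1 ^+ k).
  elim: k => [|k IH]; first by rewrite addn0 !subrr normr0 mulr0.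
  rewrite addnS -(subrKA (u (n + k)%N)) (le_trans (ler_normD _ _))//.
  rewrite (le_trans (lerD (uc _) IH))// exprD exprS; lra.
have um' n m : (n <= m)%N -> `|u m - u n| <= 2 * c * 2^-1 ^+ n.
  move=> nm; rewrite -(subnKC nm) (le_trans (um _ _))// ler_piMr//.
    by rewrite !mulr_ge0// exprn_ge0.
have cu : cvgn u.
  apply/cauchy_cvgP/cauchy_exP => e e0.
  have geo : (fun n => 2 * c * 2^-1 ^+ n : R) @ \oo --> (0 : R).
    rewrite -[X in _ --> X](mulr0 (2 * c)).
    apply: cvgM; first exact: cvg_cst.
    by apply: cvg_expr; rewrite ger0_norm// invf_lt1// ltr1n.
  have /cvgrPdist_lt/(_ _ e0)[n _ /(_ n (leqnn n))] := geo.
  rewrite /= sub0r normrN => ne; exists (u n).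
  exists n => // m /= nm; rewrite /ball /= distrC.
  by rewrite (le_lt_trans (um' _ _ nm))// (le_lt_trans _ ne)// ler_norm.
exists (limn u) => n.
have : (fun m => `|u m - u n|) @ \oo --> `|limn u - u n|.
  by apply: cvg_norm; apply: cvgB => //; exact: cvg_cst.
move=> /ler_cvg_to/(_ (cvg_cst (2 * c * 2^-1 ^+ n))); apply.
by exists n => // m /= nm; exact: um'.
Qed.

(** * Ordinary differential equations with a Lipschitz field *)

Lemma continuous_expR_scale (R : realType) (c : R) :
  continuous (fun t : R => expR (c * t)).
Proof.
move=> t; apply: (@continuous_comp _ _ _ (fun t => c * t) expR).
  exact: cvgM (cvg_cst c) cvg_id.
exact: continuous_expR.
Qed.

Section ordinary_differential_equation.
Context {R : realType} {d : nat}.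
Variables (b : 'cV[R]_d -> 'cV[R]_d) (L M : R).
Hypotheses (L_gt0 : 0 < L) (M_ge0 : 0 <= M)
  (b_lip : forall x y, `|b x - b y| <= L * `|x - y|)
  (b_le : forall x, `|b x| <= M).
Local Notation leb := (@lebesgue_measure R).

(** Integral form of the Cauchy problem x' = b(x), x(0) = z on t >= 0. *)
Definition solves (z : 'cV[R]_d) (x : R -> 'cV[R]_d) := forall t, 0 <= t ->
  forall i, leb.-integrable `[0, t] (fun s => (b (x s) i 0)%:E) /\
    x t i 0 = z i 0 + \int[leb]_(s in `[0, t]) b (x s) i 0.

Lemma solves_at0 z x : solves z x -> x 0 = z.
Proof.
move=> H; apply/colP => i; have [_ ->] := H 0 (lexx _) i.
by rewrite set_itv1 Rintegral_set1 addr0.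
Qed.

Lemma solves_increment z x s t : solves z x -> 0 <= s -> s <= t ->
  `|x t - x s| <= M * (t - s).
Proof.
move=> H s0 st; apply: norm_le_col => [|i]; first by rewrite mulr_ge0// subr_ge0.
have [it xt] := H t (le_trans s0 st) i; have [_ xs] := H s s0 i.
rewrite !mxE xt xs opprD addrACA subrr add0r.
apply: normr_Rintegral_itv_increment => // r.
by rewrite (le_trans (entry_le_norm _ _ _)).
Qed.

(** Precomposition with the absolute value extends a forward solution to a
    function that is continuous on the whole line. *)
Definition even_ext (x : R -> 'cV[R]_d) (t : R) := x `|t|.

Lemma even_ext_lip z x : solves z x ->
  forall s t, `|even_ext x t - even_ext x s| <= M * `|t - s|.
Proof.
move=> H; have half s t : `|s| <= `|t| ->
    `|even_ext x t - even_ext x s| <= M * `|t - s|.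
  move=> st; rewrite (le_trans (solves_increment H _ st))//.
  by rewrite ler_wpM2l// lerB_dist.
move=> s t; have [/half//|/ltW ts] := leP `|s| `|t|.
by rewrite distrC [`|t - s|]distrC; exact: half.
Qed.

Lemma even_ext_continuous z x : solves z x -> continuous (even_ext x).
Proof.
move=> H; apply: (@lip_continuous _ _ _ _ M) => s t.
exact: (even_ext_lip H).
Qed.

Lemma field_continuous i (x : R -> 'cV[R]_d) : continuous x ->
  continuous (fun s => b (x s) i 0).
Proof.
move=> xc; have bc : continuous (fun y => b y i 0).
  apply: (@lip_continuous _ _ _ _ L) => y z.
  by rewrite (le_trans _ (b_lip y z))//; have := entry_le_norm (b y - b z) i 0; rewrite !mxE.
by move=> s; exact: (@continuous_comp _ _ _ x (fun y => b y i 0) s (@xc s) (@bc (x s))).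
Qed.

Lemma even_ext_solves z x : solves z x -> solves z (even_ext x).
Proof.
move=> H t t0 i; have [it xt] := H t t0 i.
have E s : s \in `[0, t]%classic -> even_ext x s = x s.
  by rewrite inE /= in_itv/= => /andP[s0 _]; rewrite /even_ext ger0_norm.
split; first by apply: eq_integrable it => // s /E ->.
by rewrite {1}/even_ext ger0_norm// xt; congr (_ + _); apply: eq_Rintegral => s /E ->.
Qed.

(** Gronwall's inequality by a weighted maximum: let [K] be the maximum over
    [0, T] of the distance divided by [expR (2 * L * t)], reached at [c]. The
    integral equation bounds the distance at [c] by [`|z - z'|] plus half of
    [K * (expR (2 * L * c) - 1)], so that [K] is at most [`|z - z'|]. *)
Lemma solves_stable z z' x x' : solves z x -> solves z' x' ->
  forall t, 0 <= t -> `|x t - x' t| <= `|z - z'| * expR (2 * L * t).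
Proof.
move=> H H' T T0; pose y := even_ext x; pose y' := even_ext x'.
have yH : solves z y by exact: even_ext_solves.
have yH' : solves z' y' by exact: even_ext_solves.
have yc : continuous y := even_ext_continuous H.
have yc' : continuous y' := even_ext_continuous H'.
pose phi t := `|y t - y' t|.
have phic : continuous phi.
  move=> t; apply: cvg_norm; apply: cvgB; [exact: yc|exact: yc'].
have e_gt0 t : 0 < expR (2 * L * t) := expR_gt0 _.
pose g t := phi t / expR (2 * L * t).
have gc : continuous g.
  move=> t; apply: cvgM; first exact: phic.
  apply: cvgV; first by rewrite gt_eqF.
  exact: continuous_expR_scale.
have [c] := EVT_max T0 (continuous_subspaceT gc).
rewrite in_itv/= => /andP[c0 cT] gmax; pose K := g c.
have phiK t : 0 <= t <= T -> phi t <= K * expR (2 * L * t).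
  by move=> tT; rewrite -ler_pdivrMr//; apply: gmax; rewrite in_itv.
have phi_int : leb.-integrable `[0, c] (EFin \o (fun s => L * phi s)).
  apply: continuous_integrable => s; apply: cvgM; [exact: cvg_cst|exact: (@phic s)].
have K0 : 0 <= K by rewrite /K /g divr_ge0 ?normr_ge0// ltW.
have exp_cont : continuous (fun s => 2 * L * expR (2 * L * s)).
  by move=> s; apply: cvgM; [exact: cvg_cst|exact: continuous_expR_scale].
have exp_int : leb.-integrable `[0, c] (EFin \o (fun s => 2 * L * expR (2 * L * s))).
  exact: continuous_integrable.
have e1 : 1 <= expR (2 * L * c).
  by rewrite -[leLHS]expR0 ler_expR !mulr_ge0// ltW.
have gron : phi c <= `|z - z'| + K / 2 * (expR (2 * L * c) - 1).
  apply: norm_le_col => [|i].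
    by rewrite addr_ge0// mulr_ge0 ?subr_ge0// divr_ge0.
  have [iy yE] := yH c c0 i; have [iy' yE'] := yH' c c0 i.
  rewrite !mxE yE yE' opprD addrACA -RintegralB//.
  rewrite (le_trans (ler_normD _ _))// lerD//.
    by have := entry_le_norm (z - z') i 0; rewrite !mxE.
  have ib : leb.-integrable `[0, c] (EFin \o (fun s => b (y s) i 0 - b (y' s) i 0)).
    exact: (integrableB _ iy iy').
  rewrite (le_trans (le_normr_Rintegral _ ib))//.
  rewrite -Rintegral_expR// -RintegralZl//.
  apply: le_Rintegral_itv => //.
  - exact: integrable_norm.
  - apply: continuous_integrable => s.
    by apply: cvgM; [exact: cvg_cst|exact: exp_cont].
  - move=> s /andP[s0 sc]; rewrite (@le_trans _ _ (L * phi s))//.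
      rewrite (le_trans _ (b_lip _ _))//.
      by have := entry_le_norm (b (y s) - b (y' s)) i 0; rewrite !mxE.
    have := phiK s; rewrite s0 (le_trans sc cT) => /(_ isT).
    by rewrite -(ler_pM2l L_gt0); lra.
have phicE : phi c = K * expR (2 * L * c) by rewrite /K /g divfK// gt_eqF.
have KZ : K <= `|z - z'|.
  move: gron; rewrite phicE; move: (expR _) e1 => E E1; nra.
have := phiK T; rewrite T0 lexx => /(_ isT).
rewrite /phi /y /y' /even_ext ger0_norm// => /le_trans; apply.
by rewrite ler_wpM2r// ltW.
Qed.

Lemma solves_unique z x x' : solves z x -> solves z x' ->
  forall t, 0 <= t -> x t = x' t.
Proof.
move=> H H' t t0; apply/eqP; rewrite -subr_eq0 -normr_le0.
by rewrite (le_trans (solves_stable H H' t0))// subrr normr0 mul0r.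
Qed.

(** The Picard operator, extended evenly in time so that it preserves
    continuity on the whole line. *)
Definition picard (z : 'cV[R]_d) (x : R -> 'cV[R]_d) (t : R) : 'cV[R]_d :=
  z + \col_i \int[leb]_(s in `[0, `|t|]) b (x s) i 0.

Lemma picard_lip z x : continuous x ->
  forall s t, `|picard z x t - picard z x s| <= M * `|t - s|.
Proof.
move=> xc; have half s t : `|s| <= `|t| ->
    `|picard z x t - picard z x s| <= M * `|t - s|.
  move=> st; apply: norm_le_col => [|i]; first by rewrite mulr_ge0.
  rewrite /picard opprD addrACA subrr add0r !mxE.
  rewrite (@le_trans _ _ (M * (`|t| - `|s|)))//; last by rewrite ler_wpM2l// lerB_dist.
  apply: normr_Rintegral_itv_increment => //; last first.
    by move=> r; rewrite (le_trans (entry_le_norm _ _ _)).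
  by apply: continuous_integrable; exact: field_continuous.
move=> s t; have [/half//|/ltW ts] := leP `|s| `|t|.
by rewrite distrC [`|t - s|]distrC; exact: half.
Qed.

(** In the norm weighted by [expR (2 * L * `|t|)] the Picard operator contracts
    by 1/2, so that its iterates converge geometrically at all times at once. *)
Lemma solves_exists z : exists x, solves z x.
Proof.
pose x n := iter n (picard z) (cst z).
have xS n : x n.+1 = picard z (x n) by [].
have [xc xlip] : (forall n, continuous (x n)) /\
    (forall n s t, `|x n t - x n s| <= M * `|t - s|).
  have H n : continuous (x n) /\ forall s t, `|x n t - x n s| <= M * `|t - s|.
    elim: n => [|n [xc _]].
      split; first by move=> t; exact: cvg_cst.
      by move=> s t; rewrite subrr normr0 mulr_ge0.
    suff W : forall s t, `|x n.+1 t - x n.+1 s| <= M * `|t - s|.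
      by split => //; apply: (@lip_continuous _ _ _ _ M) => s t; exact: W.
    exact: picard_lip.
  by split=> n; have [] := H n.
pose C := M / (2 * L); pose E (t : R) : R := expR (2 * L * `|t|).
have L20 : 0 < 2 * L by rewrite mulr_gt0.
have C0 : 0 <= C by rewrite divr_ge0// ltW.
have E0 t : 0 <= E t by exact: expR_ge0.
have CE0 t : 0 <= C * E t by exact: mulr_ge0.
have geo0 n : 0 <= 2^-1 ^+ n :> R by apply: exprn_ge0.
have b_int n i t : leb.-integrable `[0, t] (EFin \o (fun s => b (x n s) i 0)).
  by apply: continuous_integrable; exact: field_continuous.
have incr n t : `|x n.+1 t - x n t| <= C * E t * 2^-1 ^+ n.
  elim: n t => [|n IH] t; apply: norm_le_col => [|i].
  - exact: mulr_ge0.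
  - rewrite xS /picard /= addrAC subrr add0r mxE expr0 mulr1.
    rewrite (@le_trans _ _ (M * `|t|))//.
      apply: normr_Rintegral_itv => //; first exact: (b_int 0%N).
      by move=> s _; rewrite (le_trans (entry_le_norm _ _ _)).
    rewrite /C /E -mulrA ler_wpM2l// -(ler_pM2l L20) mulVKf ?gt_eqF//.
    by rewrite (le_trans _ (expR_ge1Dx _))// lerDr.
  - exact: mulr_ge0.
  rewrite [x n.+2]xS [x n.+1 in X in _ - X]xS /picard opprD addrACA subrr add0r !mxE.
  rewrite -RintegralB//.
  have ib : leb.-integrable `[0, `|t|]
      (EFin \o (fun s => b (x n.+1 s) i 0 - b (x n s) i 0)).
    exact: (integrableB _ (b_int n.+1 i `|t|) (b_int n i `|t|)).
  rewrite (le_trans (le_normr_Rintegral _ ib))//.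
  pose c := C * 2^-1 ^+ n.+1.
  have ec : continuous (fun s => c * (2 * L * expR (2 * L * s))).
    move=> s; apply: cvgM; first exact: cvg_cst.
    by apply: cvgM; [exact: cvg_cst|exact: continuous_expR_scale].
  rewrite (@le_trans _ _ (\int[leb]_(s in `[0, `|t|]) (c * (2 * L * expR (2 * L * s)))))//.
    apply: le_Rintegral_itv.
    - exact: integrable_norm.
    - exact: continuous_integrable.
    - move=> s /andP[s0 _].
      have := entry_le_norm (b (x n.+1 s) - b (x n s)) i 0; rewrite !mxE => /le_trans; apply.
      rewrite (le_trans (b_lip _ _))//.
      have := IH s; rewrite -(ler_pM2l L_gt0) => /le_trans; apply.
      by rewrite /E ger0_norm// /c exprS; lra.
  rewrite RintegralZl//; last first.
    apply: continuous_integrable => s.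
    by apply: cvgM; [exact: cvg_cst|exact: continuous_expR_scale].
  rewrite Rintegral_expR// /c /E -[leRHS]mulrA [leRHS]mulrCA mulrC.
  by apply: ler_wpM2r; [exact: mulr_ge0|rewrite gerBl].
have /choice[y yP] (t : R) : exists yt : 'cV[R]_d, forall n i,
    `|yt i 0 - x n t i 0| <= 2 * (C * E t) * 2^-1 ^+ n.
  have /choice[l lP] i : exists l, forall n, `|l - x n t i 0| <= 2 * (C * E t) * 2^-1 ^+ n.
    apply: cvg_of_geometric_increments => n; rewrite (le_trans _ (incr n t))//.
    by have := entry_le_norm (x n.+1 t - x n t) i 0; rewrite !mxE.
  by exists (\col_i l i) => n i; rewrite mxE; exact: lP.
have K0 t n : 0 <= 2 * (C * E t) * 2^-1 ^+ n.
  by apply: mulr_ge0 => //; exact: mulr_ge0.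
have yP' t n : `|y t - x n t| <= 2 * (C * E t) * 2^-1 ^+ n.
  by apply: norm_le_col => // i; rewrite !mxE; exact: yP.
have ylip s t : `|y t - y s| <= M * `|t - s|.
  apply: (@le_of_le_geometric _ _ _ (2 * (C * E t) + 2 * (C * E s))) => n.
  rewrite -(subrKA (x n t)) (le_trans (ler_normD _ _))//.
  rewrite -(subrKA (x n s) (x n t)).
  rewrite (le_trans (lerD (yP' _ n) (ler_normD _ _)))//.
  by have := xlip n s t; have := yP' s n; rewrite distrC mulrDl; lra.
have yc : continuous y by apply: (@lip_continuous _ _ _ _ M) => s t; exact: ylip.
have by_int i t : leb.-integrable `[0, t] (EFin \o (fun s => b (y s) i 0)).
  by apply: continuous_integrable; exact: field_continuous.
exists y => t t0 i; split; first exact: by_int.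
apply/eqP; rewrite -subr_eq0 -normr_le0.
apply: (@le_of_le_geometric _ _ _ (2 * (C * E t) + L * (2 * (C * E t)) * t)) => n.
rewrite add0r -(subrKA (x n.+1 t i 0)) (le_trans (ler_normD _ _))// mulrDl lerD//.
  rewrite (le_trans (yP t n.+1 i))// ler_wpM2l//.
    exact: mulr_ge0.
  by rewrite exprS ler_piMl ?exprn_ge0// invf_le1// ler1n.
rewrite xS /picard !mxE (ger0_norm t0) opprD addrACA subrr add0r -RintegralB//.
rewrite mulrAC; apply: normr_Rintegral_itv => //.
  exact: (integrableB _ (b_int n i t) (by_int i t)).
move=> s /andP[s0 st].
have := entry_le_norm (b (x n s) - b (y s)) i 0; rewrite !mxE => /le_trans; apply.
rewrite (le_trans (b_lip _ _))// -mulrA ler_wpM2l ?(ltW L_gt0)//.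
rewrite distrC (le_trans (yP' s n))// ler_wpM2r ?exprn_ge0//.
rewrite !ler_wpM2l// /E ler_expR ler_wpM2l ?(ltW L20)//.
by rewrite !ger0_norm.
Qed.

Lemma solves_shift z x h : solves z x -> 0 <= h ->
  solves (x h) (fun t => x (t + h)).
Proof.
move=> H h0 t t0 i; pose y := even_ext x.
have yH : solves z y := even_ext_solves H.
have yc : continuous y := even_ext_continuous H.
have ybc : continuous (fun s => b (y s) i 0) := field_continuous yc.
have shc : continuous (fun s : R => b (y (s + h)) i 0).
  move=> s; apply: (@continuous_comp _ _ _ (+%R^~ h) (fun s => b (y s) i 0)); last exact: ybc.
  exact: cvgD cvg_id (cvg_cst h).
have E s : s \in `[0, t]%classic -> x (s + h) = y (s + h).
  rewrite inE /= in_itv/= => /andP[s0 _].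
  by rewrite /y /even_ext ger0_norm// addr_ge0.
split.
  have : leb.-integrable `[0, t] (EFin \o (fun s => b (y (s + h)) i 0)).
    exact: continuous_integrable.
  by apply: eq_integrable => // s /E ->.
have th0 : 0 <= t + h by exact: addr_ge0.
have xy r : 0 <= r -> x r = y r by move=> r0; rewrite /y /even_ext ger0_norm.
rewrite (xy _ th0) (xy _ h0); have [_ ->] := yH _ th0 i; have [_ ->] := yH _ h0 i.
rewrite -addrA Rintegral_itvD//; congr (_ + (_ + _)).
by apply: eq_Rintegral => s /E ->.
Qed.

Lemma solves_periodic z x i : torus_periodic b -> solves z x ->
  solves (z + delta_mx i 0) (fun t => x t + delta_mx i 0).
Proof.
move=> bper H t t0 j; have [it xt] := H t t0 j; split.
  by apply: eq_integrable it => // s _; rewrite bper.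
by rewrite !mxE xt addrAC; congr (_ + _ + _); apply: eq_Rintegral => s _; rewrite bper.
Qed.
End ordinary_differential_equation.

(** * The discounted cost over a finite horizon *)

(** Arithmetic of one step of length [h] of dynamic programming. [V] is the
    value at the initial point, [I] the integral of the running cost, [V2] the
    value at the position reached and [V1] the value at the Euler point. All
    errors are of order [h ^+ 2], also the one from replacing
    [expR (rho * h) - 1] by [rho * h]. *)
Lemma discount_step (R : realType) (rho h l lmax c V I V1 V2 k : R) :
  0 < rho -> 0 <= h -> h <= 1 -> 0 <= l -> l <= lmax -> 0 <= c -> 0 <= V ->
  I <= (l + c * h) * h -> expR (rho * h) * (V - rho * I) <= V2 ->
  `|V1 - V2| <= k * h ^+ 2 ->
  h * rho * (V - l) - (rho * (rho * expR rho * lmax) + rho * expR rho * c + k) * h ^+ 2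
  <= V1 - V.
Proof.
move=> rho_gt0 hge0 h1 lz0 lzM c0 V0 Ile dpp V12.
have e1 : 1 + rho * h <= expR (rho * h) by exact: expR_ge1Dx.
have e2 : expR (rho * h) <= expR rho by rewrite ler_expR ger_pMr.
have rhoh0 : 0 <= rho * h by rewrite mulr_ge0// ltW.
have e3 : expR (rho * h) - 1 <= rho * h * expR rho.
  have := expR_ge1Dx (- (rho * h)); rewrite expRN => /(ler_wpM2l (expR_ge0 (rho * h))).
  rewrite divff ?gt_eqF ?expR_gt0// => e4.
  rewrite (@le_trans _ _ (rho * h * expR (rho * h)))//; last by rewrite ler_wpM2l.
  by move: (expR _) e4 => e e4; lra.
move: (expR (rho * h)) (expR rho) e1 e2 e3 dpp => e E e1 e2 e3 dpp.
have := ler_norm (V2 - V1); rewrite distrC => V21.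
have rho0 := ltW rho_gt0.
have e0 : 0 <= e by lra.
have s1 : V2 >= e * V - e * rho * ((l + c * h) * h).
  rewrite (le_trans _ dpp)// mulrBr lerD2l lerN2 -mulrA ler_wpM2l//.
  by rewrite ler_wpM2l.
have s2 : (1 + rho * h) * V <= e * V by rewrite ler_wpM2r.
have s3 : e * rho * (l * h) <= rho * h * l + rho * (rho * E * lmax) * h ^+ 2.
  have : (e - 1) * (rho * h * l) <= rho * h * E * (rho * h * lmax).
    apply: ler_pM => //; first by lra.
      exact: mulr_ge0.
    by rewrite ler_wpM2l.
  by lra.
have s4 : e * rho * (c * h * h) <= rho * E * c * h ^+ 2.
  have : e * (rho * c * h ^+ 2) <= E * (rho * c * h ^+ 2).
    apply: ler_wpM2r => //; apply: mulr_ge0; last exact: exprn_ge0.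
    exact: mulr_ge0.
  by lra.
lra.
Qed.

(** Finite-horizon truncation of the discounted cost: unlike the value of the
    feedback itself, it is Lipschitz whatever the discount rate. *)
Section truncated_value.
Context {R : realType} {d : nat}.
Variables (b : 'cV[R]_d -> 'cV[R]_d) (L M : R) (l : 'cV[R]_d -> R) (Ll Ml : R).
Variables (X : 'cV[R]_d -> R -> 'cV[R]_d) (rho : R).
Hypotheses (L_gt0 : 0 < L) (M_ge0 : 0 <= M)
  (b_lip : forall x y, `|b x - b y| <= L * `|x - y|)
  (b_le : forall x, `|b x| <= M)
  (Ll_ge0 : 0 <= Ll) (l_lip : forall x y, `|l x - l y| <= Ll * `|x - y|)
  (l_ge0 : forall x, 0 <= l x) (l_le : forall x, l x <= Ml)
  (X_sol : forall z, solves b z (X z)) (rho_gt0 : 0 < rho).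
Local Notation leb := (@lebesgue_measure R).

Let Y z := even_ext (X z).
Let Yc z : continuous (Y z) := even_ext_continuous M_ge0 b_le (X_sol z).

Definition running (z : 'cV[R]_d) (t : R) := expR (- rho * t) * l (even_ext (X z) t).

Lemma running_continuous z : continuous (running z).
Proof.
move=> t; apply: cvgM; first exact: continuous_expR_scale.
apply: (@continuous_comp _ _ _ (Y z) l); first exact: Yc.
exact: (lip_continuous l_lip).
Qed.

Definition trunc_value T z := rho * \int[leb]_(t in `[0, T]) running z t.

Lemma running_ge0 z t : 0 <= running z t.
Proof. by rewrite mulr_ge0// expR_ge0. Qed.

Let running_int z a c : leb.-integrable `[a, c] (EFin \o running z).
Proof. exact: continuous_integrable (@running_continuous z). Qed.

Lemma trunc_value_ge0 T z : 0 <= trunc_value T z.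
Proof.
rewrite /trunc_value mulr_ge0 ?(ltW rho_gt0)// Rintegral_ge0// => t _.
exact: running_ge0.
Qed.

Lemma trunc_value_le T z : 0 <= T -> trunc_value T z <= Ml.
Proof.
move=> T0; have Ml0 : 0 <= Ml by exact: le_trans (l_ge0 0) (l_le 0).
have ec : continuous (fun t => - Ml * (- rho * expR (- rho * t))).
  move=> t; apply: cvgM; first exact: cvg_cst.
  by apply: cvgM; [exact: cvg_cst|exact: continuous_expR_scale].
have ec' : continuous (fun t => - rho * expR (- rho * t)).
  by move=> t; apply: cvgM; [exact: cvg_cst|exact: continuous_expR_scale].
rewrite /trunc_value -RintegralZl//.
rewrite (@le_trans _ _ (\int[leb]_(t in `[0, T]) (- Ml * (- rho * expR (- rho * t)))))//.
  apply: le_Rintegral_itv.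
  - by apply: continuous_integrable => t; apply: cvgM (cvg_cst _) (@running_continuous z t).
  - exact: continuous_integrable.
  - move=> t _; rewrite (_ : - Ml * _ = rho * (expR (- rho * t) * Ml)).
      by rewrite ler_wpM2l ?(ltW rho_gt0)// ler_wpM2l ?expR_ge0.
    by move: (expR _) => e; lra.
rewrite RintegralZl//; last exact: continuous_integrable.
rewrite Rintegral_expR// mulNr -mulrN opprB.
by rewrite ler_piMr ?gerBl ?expR_ge0.
Qed.

Lemma trunc_value_lip T : 0 <= T -> exists2 K, 0 <= K &
  forall z z', `|trunc_value T z - trunc_value T z'| <= K * `|z - z'|.
Proof.
move=> T0; exists (rho * (Ll * expR (2 * L * T) * T)).
  by rewrite !mulr_ge0 ?expR_ge0// ltW.
move=> z z'; rewrite /trunc_value -mulrBr normrM (ger0_norm (ltW rho_gt0)).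
rewrite -RintegralB// -[leRHS]mulrA ler_wpM2l ?(ltW rho_gt0)// [leRHS]mulrAC.
apply: normr_Rintegral_itv => // [|t /andP[t0 tT]].
  exact: (integrableB _ (running_int z 0 T) (running_int z' 0 T)).
rewrite /running -mulrBr normrM ger0_norm ?expR_ge0//.
rewrite (@le_trans _ _ `|l (even_ext (X z) t) - l (even_ext (X z') t)|)//.
  by rewrite ler_piMl// -expR0 ler_expR mulNr oppr_le0 mulr_ge0// ltW.
rewrite (le_trans (l_lip _ _))// -[leRHS]mulrA ler_wpM2l//.
rewrite /even_ext ger0_norm// mulrC.
rewrite (le_trans (solves_stable L_gt0 M_ge0 b_lip b_le (X_sol z) (X_sol z') t0))//.
by apply: ler_wpM2l => //; rewrite ler_expR ler_wpM2l// mulr_ge0// ltW.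
Qed.

Lemma trunc_value_periodic T : torus_periodic b -> torus_periodic l ->
  torus_periodic (trunc_value T).
Proof.
move=> bper lper z i; congr (_ * _); apply: eq_Rintegral => t _.
rewrite /running /even_ext; congr (_ * _).
have := solves_unique L_gt0 M_ge0 b_lip b_le (X_sol (z + delta_mx i 0))
  (solves_periodic i bper (X_sol z)) (normr_ge0 t).
by move=> ->; rewrite lper.
Qed.

(** Difference form of [rho * (V x - l x) - k <= dot (b x) (grad V x)] along Euler
    steps. It makes sense for a Lipschitz [V], and translating [V] changes it
    only through the Lipschitz constants of [V], [b] and [l]; it can therefore
    be averaged. *)
Definition subsolution (V : 'cV[R]_d -> R) (k : R) := exists K, forall h x,
  0 < h <= 1 ->
  h * rho * (V x - l x) - h * k - K * h ^+ 2 <= V (x + h *: b x) - V x.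

Lemma euler_step z h : 0 <= h -> `|z + h *: b z - even_ext (X z) h| <= L * M * h ^+ 2.
Proof.
move=> h0; have yH := even_ext_solves (X_sol z).
have ylip := even_ext_lip M_ge0 b_le (X_sol z).
have y0 : even_ext (X z) 0 = z by exact: solves_at0 yH.
have LM0 : 0 <= L * M by rewrite mulr_ge0// ltW.
apply: norm_le_col => [|i]; first by rewrite mulr_ge0// exprn_ge0.
have [iy yE] := yH h h0 i.
have cst_int : leb.-integrable `[0, h] (EFin \o (fun=> b z i 0)).
  by apply: continuous_integrable => s; exact: cvg_cst.
rewrite !mxE yE opprD addrACA subrr add0r [h * _]mulrC -(Rintegral_itv_cst (b z i 0) h0) -RintegralB//.
rewrite expr2 mulrA; apply: normr_Rintegral_itv => //.
  exact: (integrableB _ cst_int iy).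
move=> s /andP[s0 sh].
have := entry_le_norm (b z - b (even_ext (X z) s)) i 0; rewrite !mxE => /le_trans; apply.
rewrite (le_trans (b_lip _ _))// -mulrA ler_wpM2l ?(ltW L_gt0)//.
rewrite -{1}y0 (le_trans (ylip _ _))// sub0r normrN ger0_norm//.
by rewrite ler_wpM2l.
Qed.

(** Dynamic programming. The horizon after the step is still [T] instead of
    [T - h]; since the running cost is nonnegative this only increases the
    right-hand side. *)
Lemma trunc_value_dpp T z h : 0 <= T -> 0 <= h ->
  expR (rho * h) * (trunc_value T z - rho * \int[leb]_(t in `[0, h]) running z t)
  <= trunc_value T (even_ext (X z) h).
Proof.
move=> T0 h0; rewrite /trunc_value -mulrBr mulrCA ler_wpM2l ?(ltW rho_gt0)//.
have shiftE t : 0 <= t -> running (even_ext (X z) h) t = expR (rho * h) * running z (t + h).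
  move=> t0; rewrite /running mulrA -expRD; congr (expR _ * l _); first by lra.
  have sh := solves_shift M_ge0 b_lip b_le (even_ext_solves (X_sol z)) h0.
  have := solves_unique L_gt0 M_ge0 b_lip b_le (X_sol (even_ext (X z) h)) sh t0.
  by move=> <-; rewrite /even_ext (ger0_norm t0).
have -> : \int[leb]_(t in `[0, T]) running (even_ext (X z) h) t =
    \int[leb]_(t in `[0, T]) (expR (rho * h) * running z (t + h)).
  apply: eq_Rintegral => t; rewrite inE /= in_itv/= => /andP[t0 _].
  by rewrite shiftE.
have rc := @running_continuous z.
have rshc (c : R) : continuous (fun t => running z (t + c)).
  move=> t; apply: (@continuous_comp _ _ _ (+%R^~ c) (running z)); last exact: rc.
  exact: cvgD cvg_id (cvg_cst c).
rewrite RintegralZl//; last exact: continuous_integrable.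
rewrite ler_wpM2l ?expR_ge0// lerBlDl -Rintegral_itvD//.
rewrite [T + h]addrC Rintegral_itvD// lerDl Rintegral_ge0// => t _.
exact: running_ge0.
Qed.

(** The dynamic programming inequality, where the trajectory is replaced by its
    Euler step and the running cost is frozen at the initial point. *)
Lemma trunc_value_subsolution T : 0 <= T -> subsolution (trunc_value T) 0.
Proof.
move=> T0; have [KV KV0 Vlip] := trunc_value_lip T0.
have Ml0 : 0 <= Ml by exact: le_trans (l_ge0 0) (l_le 0).
exists (rho * (rho * expR rho * Ml) + rho * expR rho * (Ll * M) + KV * (L * M)).
move=> h z /andP[h0 h1]; have hge0 := ltW h0.
have euler := euler_step z hge0; have dpp := trunc_value_dpp z T0 hge0.
have lipE := Vlip (z + h *: b z) (even_ext (X z) h).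
have {euler}lipE := le_trans lipE (ler_wpM2l KV0 euler).
have int_le : \int[leb]_(t in `[0, h]) running z t <= (l z + Ll * M * h) * h.
  rewrite -Rintegral_itv_cst//; apply: le_Rintegral_itv => //.
    by apply: continuous_integrable => s; exact: cvg_cst.
  move=> s /andP[s0 sh]; rewrite /running.
  rewrite (@le_trans _ _ (l (even_ext (X z) s)))//.
    by rewrite ler_piMl// -expR0 ler_expR mulNr oppr_le0 mulr_ge0// ltW.
  rewrite -lerBlDl (le_trans (ler_norm _))// (le_trans (l_lip _ _))//.
  rewrite -mulrA ler_wpM2l// -[X in _ - X](solves_at0 (even_ext_solves (X_sol z))).
  rewrite (le_trans (even_ext_lip M_ge0 b_le (X_sol z) _ _))// subr0 ger0_norm//.
  by rewrite ler_wpM2l.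
have V0 := trunc_value_ge0 T z.
rewrite mulr0 subr0.
apply: (discount_step rho_gt0 hge0 h1 (l_ge0 z) (l_le z) _ V0 int_le dpp) => //.
  exact: mulr_ge0.
by rewrite (le_trans lipE)// !mulrA.
Qed.

End truncated_value.

(** * Mollification by coordinate averages *)

Section coordinate_average.
Context {R : realType} {d : nat}.
Local Notation leb := (@lebesgue_measure R).
Variables (e : R) (e_gt0 : 0 < e).
Implicit Types (V : 'cV[R]_d -> R) (x y : 'cV[R]_d) (i j : 'I_d).

(** Steklov average over a segment of length [e] in the direction of a
    coordinate axis. *)
Definition avg i V x : R := \int[leb]_(s in `[0, 1]) V (x + (e * s) *: delta_mx i 0).

Lemma line_lip x i (s t : R) :
  `|(x + (e * s) *: delta_mx i 0) - (x + (e * t) *: delta_mx i 0)| <= e * `|s - t|.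
Proof.
rewrite opprD addrACA subrr add0r -scalerBl -mulrBr normrZ normrM (ger0_norm (ltW e_gt0)).
rewrite -[leRHS]mulr1 ler_pM ?mulr_ge0 ?(ltW e_gt0)//.
exact: norm_delta_le1.
Qed.

Lemma line_continuous V x i : continuous V ->
  continuous (fun s : R => V (x + (e * s) *: delta_mx i 0)).
Proof.
move=> Vc s.
apply: (@continuous_comp _ _ _ (fun s : R => x + (e * s) *: delta_mx i 0) V); last exact: Vc.
by apply: (@lip_continuous _ _ _ _ e) => u v; exact: line_lip.
Qed.

Definition lip_torus (K C : R) V := [/\ forall x y, `|V x - V y| <= K * `|x - y|,
  forall x, 0 <= V x <= C & torus_periodic V].

Section average_of_lipschitz.
Variables (K C : R) (V : 'cV[R]_d -> R) (K_ge0 : 0 <= K) (V_lip : lip_torus K C V).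

Lemma lip_torus_continuous : continuous V.
Proof. by have [Vl _ _] := V_lip; exact: lip_continuous Vl. Qed.

Let line_int x i : leb.-integrable `[0, 1]
  (EFin \o (fun s => V (x + (e * s) *: delta_mx i 0))).
Proof. exact: continuous_integrable (line_continuous lip_torus_continuous). Qed.

Let cst_int c : leb.-integrable `[0, 1] (EFin \o (fun=> c)).
Proof. by apply: continuous_integrable => s; exact: cvg_cst. Qed.

Lemma le_avg i x c : (forall s, 0 <= s <= 1 -> V (x + (e * s) *: delta_mx i 0) <= c) ->
  avg i V x <= c.
Proof.
move=> Vc; rewrite -[leRHS]mulr1 -Rintegral_itv_cst//.
exact: le_Rintegral_itv.
Qed.

Lemma ge_avg i x c : (forall s, 0 <= s <= 1 -> c <= V (x + (e * s) *: delta_mx i 0)) ->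
  c <= avg i V x.
Proof.
move=> Vc; rewrite -[leLHS]mulr1 -Rintegral_itv_cst//.
exact: le_Rintegral_itv.
Qed.

Lemma avg_lip i : lip_torus K C (avg i V).
Proof.
have [Vl V0C Vper] := V_lip; split.
- move=> x y; rewrite -RintegralB//.
  rewrite -[leRHS]mulr1; apply: normr_Rintegral_itv => //.
    exact: (integrableB _ (line_int x i) (line_int y i)).
  move=> s _; rewrite (le_trans (Vl _ _))//.
  by rewrite opprD addrACA subrr addr0.
- move=> x; apply/andP; split.
    by apply: ge_avg => s _; have /andP[] := V0C (x + (e * s) *: delta_mx i 0).
  by apply: le_avg => s _; have /andP[] := V0C (x + (e * s) *: delta_mx i 0).
- by move=> x j; apply: eq_Rintegral => s _; rewrite addrAC Vper.
Qed.

Lemma avg_close i x : `|avg i V x - V x| <= K * e.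
Proof.
have [Vl _ _] := V_lip; rewrite -[X in _ - X]mulr1 -Rintegral_itv_cst// -RintegralB//.
rewrite -[leRHS]mulr1; apply: normr_Rintegral_itv => //.
  exact: (integrableB _ (line_int x i) (cst_int (V x))).
move=> s /andP[s0 s1]; rewrite (le_trans (Vl _ _))// ler_wpM2l//.
have := line_lip x i s 0; rewrite mulr0 scale0r addr0 subr0 => /le_trans; apply.
by rewrite ger_pMr// ger0_norm.
Qed.

(** Rewriting averages as expectations makes Fubini's theorem applicable. *)
Lemma avg_uniform i x :
  (avg i V x)%:E = (\int[uniform_prob (@ltr01 R)]_s (V (x + (e * s) *: delta_mx i 0))%:E)%E.
Proof.
have [_ V0C _] := V_lip.
rewrite integral_uniform; last 2 first.
- apply/measurable_EFinP; apply: continuous_measurable_fun.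
  exact: line_continuous lip_torus_continuous.
- by move=> s; rewrite lee_fin; have /andP[] := V0C (x + (e * s) *: delta_mx i 0).
rewrite subr0 invr1 mul1e /avg /Rintegral fineK//.
exact: (integrable_fin_num _ (line_int x i)).
Qed.

End average_of_lipschitz.

Lemma avg_comm K C V i j : lip_torus K C V -> avg i (avg j V) = avg j (avg i V).
Proof.
move=> V_lip; have [_ V0C _] := V_lip; apply/funext => x; apply: EFin_inj.
pose line s r := x + (e * s) *: delta_mx i 0 + (e * r) *: delta_mx j 0.
apply: etrans (avg_uniform (avg_lip V_lip j) i x) _.
apply: etrans _ (esym (avg_uniform (avg_lip V_lip i) j x)).
transitivity (\int[uniform_prob (@ltr01 R)]_s
    \int[uniform_prob (@ltr01 R)]_r (V (line s r))%:E)%E.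
  by apply: eq_integral => s _; exact: (avg_uniform V_lip).
apply: etrans (@fubini_tonelli _ _ (measurableTypeR R) (measurableTypeR R) R
  (uniform_prob (@ltr01 R)) (uniform_prob (@ltr01 R))
  (fun p => (V (line p.1 p.2))%:E) _ _) _.
- apply/measurable_EFinP; apply: (@measurableT_comp _ _ _ _ _ _ V).
    exact: continuous_measurable_cV (lip_torus_continuous V_lip).
  apply/measurable_fun_mxP => // k k'.
  rewrite (_ : (fun p => _) = (fun p : measurableTypeR R * measurableTypeR R =>
    x k k' + (e * p.1) * delta_mx i 0 k k' + (e * p.2) * delta_mx j 0 k k')); last first.
    by apply/funext => p; rewrite /line !mxE.
  apply: measurable_funD; first apply: measurable_funD => //.
  - by apply: measurable_funM => //; apply: measurable_funM => //; exact: measurable_fst.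
  - by apply: measurable_funM => //; apply: measurable_funM => //; exact: measurable_snd.
- by move=> [s r]; rewrite lee_fin; have /andP[] := V0C (line s r).
- apply: eq_integral => r _; rewrite (avg_uniform V_lip); apply: eq_integral => s _.
  by rewrite /line addrAC.
Qed.

Lemma is_derive_of_line (F : 'cV[R]_d -> R) (x v : 'cV[R]_d) (l : R) :
  is_derive (0 : R) (1 : R) (fun s : R => F (x + s *: v)) l -> is_derive x v F l.
Proof.
have E (h : R) : (F \o shift x) (h *: v) =
    ((fun s : R => F (x + s *: v)) \o shift 0) (h *: 1).
  by rewrite /= [h *: 1]mulr1 addr0 addrC.
have F0 : F (x + 0 *: v) = F x by rewrite scale0r addr0.
move=> [dF DF]; have EE : (fun h : R => h^-1 *: ((F \o shift x) (h *: v) - F x)) =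
    (fun h : R => h^-1 *: (((fun s : R => F (x + s *: v)) \o shift 0) (h *: 1) - F (x + 0 *: v))).
  by apply/funext => h; rewrite E F0.
by split; [rewrite /derivable EE|rewrite -DF /derive EE].
Qed.

(** The average is a difference of values of a primitive of [V] along the axis,
    so its derivative along that axis is a difference quotient. *)
Lemma avg_is_derive V i x : continuous V ->
  is_derive x (delta_mx i 0) (avg i V) (e^-1 * (V (x + e *: delta_mx i 0) - V x)).
Proof.
move=> Vc; pose g (s : R) := V (x + s *: delta_mx i 0).
have gc : continuous g.
  move=> s; apply: (@continuous_comp _ _ _ (fun s : R => x + s *: delta_mx i 0) V); last exact: Vc.
  by apply: cvgD; [exact: cvg_cst|apply: cvgZr_tmp; exact: cvg_id].
pose G u := \int[leb]_(s in `[-1, u]) g s.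
have dG (u : R) : -1 < u -> is_derive u 1 G (g u).
  move=> u1; have uu1 : u < u + 1 by rewrite ltrDl.
  have [dGu G'u] := continuous_FTC1_closed uu1 (continuous_integrable _ _ gc) u1 (@gc u).
  by split; [exact: dGu|rewrite -derive1E].
apply: is_derive_of_line.
have avgE t : -1 < t -> avg i V (x + t *: delta_mx i 0) = e^-1 * (G (t + e) - G t).
  move=> t1; rewrite /G Rintegral_itvB_cc ?lerDl ?(ltW e_gt0) ?(ltW t1)//.
  have := Rintegral_affine t gc e_gt0 ler01; rewrite mulr1 => ->.
  rewrite mulKf ?gt_eqF//; apply: eq_Rintegral => s _.
  by rewrite /g scalerDl addrA.
have dH : is_derive (0 : R) (1 : R) (fun t => e^-1 * (G (t + e) - G t)) (e^-1 * (g e - g 0)).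
  have d1 : is_derive (0 : R) (1 : R) (fun t => G (t + e)) (g e).
    have dsh : is_derive (0 : R) (1 : R) (fun t => t + e) (1 : R).
      by have := is_deriveD (is_derive_id (0 : R) (1 : R)) (is_derive_cst e (0 : R) (1 : R)); rewrite addr0.
    have dGe : is_derive (0 + e) 1 G (g e).
      by rewrite add0r; apply: dG; rewrite (lt_trans _ e_gt0)// ltrN10.
    by have := @is_derive1_comp _ G (fun t => t + e) 0 (g e) 1 dGe dsh; rewrite mulr1.
  have d0 : is_derive (0 : R) (1 : R) G (g 0) by apply: dG; rewrite ltrN10.
  exact: is_deriveZ (is_deriveB d1 d0).
rewrite /g scale0r addr0 in dH.
apply: near_eq_is_derive dH.
near=> t; rewrite avgE//.
near: t; apply: lt_nbhsr; exact: ltrN10.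
Unshelve. all: by end_near. Qed.

Lemma foldr_avg_lip K C V (s : seq 'I_d) : lip_torus K C V ->
  lip_torus K C (foldr avg V s).
Proof. by move=> V_lip; elim: s => //= i s IH; exact: avg_lip. Qed.

(** Averages commute, so any axis can be taken as the last one averaged. *)
Lemma foldr_avg_rem K C V (s : seq 'I_d) i : lip_torus K C V -> i \in s ->
  foldr avg V s = avg i (foldr avg V (rem i s)).
Proof.
move=> V_lip; elim: s => //= j s IH; rewrite inE.
have [->//|ij /= si] := eqVneq i j.
exact: etrans (congr1 (avg j) (IH si)) (avg_comm j i (foldr_avg_lip _ V_lip)).
Qed.

(** The partial derivative along an axis is a difference quotient of the average
    over all other axes, which is continuous. *)
Lemma mollify_C1 K C V : lip_torus K C V ->
  C1_torus (foldr avg V (enum 'I_d)).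
Proof.
move=> V_lip; have [_ _ Vper] := foldr_avg_lip (enum 'I_d) V_lip.
split => //; pose U i := foldr avg V (rem i (enum 'I_d)).
have Uc i : continuous (U i) by exact: lip_torus_continuous (foldr_avg_lip _ V_lip).
apply: (@C1_of_partials _ _ _ (fun i x => e^-1 * (U i (x + e *: delta_mx i 0) - U i x))).
  move=> i x; apply: (cvgM (cvg_cst e^-1) (cvgB _ (@Uc i x))).
  apply: (@continuous_comp _ _ _ (fun x => x + e *: delta_mx i 0) (U i)); last exact: Uc.
  exact: cvgD cvg_id (cvg_cst _).
move=> i x.
have -> : foldr avg V (enum 'I_d) = avg i (U i) := foldr_avg_rem V_lip (mem_enum _ i).
exact: (avg_is_derive i x (Uc i)).
Qed.

Lemma mollify_close K C V (s : seq 'I_d) x : 0 <= K -> lip_torus K C V ->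
  `|foldr avg V s x - V x| <= (size s)%:R * (K * e).
Proof.
move=> K0 V_lip; elim: s => /= [|i s IH]; first by rewrite subrr normr0 mul0r.
rewrite -(subrKA (foldr avg V s x)) (le_trans (ler_normD _ _))//.
rewrite -[(size s).+1]add1n natrD mulrDl mul1r lerD//.
exact: avg_close (foldr_avg_lip _ V_lip) _ _.
Qed.
End coordinate_average.

(** * Smooth subsolutions *)
Section smooth_subsolution.
Context {R : realType} {d : nat}.
Variables (b : 'cV[R]_d -> 'cV[R]_d) (L M : R) (l : 'cV[R]_d -> R) (Ll rho : R).
Hypotheses (L_ge0 : 0 <= L) (M_ge0 : 0 <= M)
  (b_lip : forall x y, `|b x - b y| <= L * `|x - y|)
  (b_le : forall x, `|b x| <= M)
  (Ll_ge0 : 0 <= Ll) (l_lip : forall x y, `|l x - l y| <= Ll * `|x - y|)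
  (rho_gt0 : 0 < rho).
Local Notation leb := (@lebesgue_measure R).

(** At a point at distance at most [e] from [x], the field and the running cost
    differ from their values at [x] by at most [L * e] and [Ll * e]. With these
    values frozen at [x] the inequalities at the translated points can be
    integrated. *)
Lemma avg_subsolution e i V K C k : 0 < e -> 0 <= K -> lip_torus K C V ->
  subsolution b l rho V k ->
  subsolution b l rho (avg e i V) (k + (rho * Ll + K * L) * e).
Proof.
move=> e0 K0 V_lip [K2 sub]; have [Vl _ _] := V_lip; exists K2 => h x h01.
have Vc := lip_torus_continuous V_lip.
have /andP[h0 _] := h01; have h0' := ltW h0; have e0' := ltW e0; have rho0 := ltW rho_gt0.
pose z (s : R) : 'cV[R]_d := x + (e * s) *: delta_mx i 0.
pose c := - (h * rho * (l x + Ll * e)) - h * k - K2 * h ^+ 2 - K * (h * (L * e)).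
have zx s : 0 <= s <= 1 -> `|z s - x| <= e.
  move=> /andP[s0 s1]; have := line_lip e0 x i s 0; rewrite mulr0 scale0r addr0 subr0.
  by move=> /le_trans; apply; rewrite ger_pMr// ger0_norm.
have pt s : 0 <= s <= 1 -> (1 + h * rho) * V (z s) + c <=
    V ((x + h *: b x) + (e * s) *: delta_mx i 0).
  move=> s01; have zs := zx s s01.
  have S := sub h (z s) h01.
  have B : `|V (z s + h *: b (z s)) - V (z s + h *: b x)| <= K * (h * (L * e)).
    rewrite (le_trans (Vl _ _))// ler_wpM2l// opprD addrACA subrr add0r -scalerBr.
    rewrite normrZ ger0_norm// ler_wpM2l// (le_trans (b_lip _ _))//.
    by rewrite ler_wpM2l.
  have lz : l (z s) <= l x + Ll * e.
    rewrite -lerBlDl (le_trans (ler_norm _))// (le_trans (l_lip _ _))//.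
    by rewrite ler_wpM2l.
  have lz' : h * rho * l (z s) <= h * rho * (l x + Ll * e).
    by rewrite ler_wpM2l// mulr_ge0.
  have := le_trans (ler_norm _) B.
  rewrite (_ : x + h *: b x + (e * s) *: delta_mx i 0 = z s + h *: b x); last by rewrite addrAC.
  move: (V _) (V _) (V _) S lz' => a1 a2 a3 S lz' a12.
  by rewrite /c; lra.
have Vzc : continuous (fun s => V (z s)) by exact: line_continuous.
have mulc : continuous (fun s => (1 + h * rho) * V (z s)).
  by move=> s; exact: cvgM (cvg_cst _) (@Vzc s).
have intE : \int[leb]_(s in `[0, 1]) ((1 + h * rho) * V (z s) + c) =
    (1 + h * rho) * avg e i V x + c.
  rewrite RintegralD//.
  - by rewrite RintegralZl ?Rintegral_itv_cst ?mulr1//; exact: continuous_integrable.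
  - exact: continuous_integrable.
  - by apply: continuous_integrable => s; exact: cvg_cst.
have := @le_Rintegral_itv R (fun s => (1 + h * rho) * V (z s) + c)
  (fun s => V ((x + h *: b x) + (e * s) *: delta_mx i 0)) 1.
rewrite intE => H.
have : (1 + h * rho) * avg e i V x + c <= avg e i V (x + h *: b x).
  apply: H => //; apply: continuous_integrable; last exact: line_continuous.
  by move=> s; exact: cvgD (@mulc s) (cvg_cst c).
move: (avg _ _ _ _) (avg _ _ _ _) => A1 A2; rewrite /c; lra.
Qed.

Lemma foldr_avg_subsolution e (s : seq 'I_d) V K C k : 0 < e -> 0 <= K ->
  lip_torus K C V -> subsolution b l rho V k ->
  subsolution b l rho (foldr (avg e) V s) (k + (size s)%:R * ((rho * Ll + K * L) * e)).
Proof.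
move=> e0 K0 V_lip sub; elim: s => /= [|i s IH]; first by rewrite mul0r addr0.
rewrite -[(size s).+1]addn1 natrD mulrDl mul1r addrA.
exact: avg_subsolution (foldr_avg_lip e0 _ V_lip) IH.
Qed.

(** The difference inequality is divided by the step, which tends to 0. The step
    [h] below is small enough for the first-order expansion of [W] to hold, and
    for its error and the quadratic term to be at most [eta / 2] each. *)
Lemma subsolution_grad W k x : C1_torus W -> subsolution b l rho W k ->
  rho * (W x - l x) - k <= dot (b x) (grad W x).
Proof.
move=> W1 [K sub]; apply/ler_addgt0Pr => eta eta0.
have eM0 : 0 < eta / 2 / (M + 1) by rewrite !divr_gt0// ltr_wpDl.
have [r r0 est] := C1_torus_estimate W1 eM0.
pose h := Num.min 1 (Num.min (r / (M + 1)) (eta / 2 / (`|K| + 1))).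
have M1 : 0 < M + 1 by rewrite ltr_wpDl.
have K1 : 0 < `|K| + 1 by rewrite ltr_wpDl.
have h0 : 0 < h by rewrite !lt_min ltr01 !divr_gt0.
have h1 : h <= 1 by rewrite ge_min lexx.
have hr : h * (M + 1) <= r by rewrite -ler_pdivlMr// !ge_min lexx orbT.
have hK : h * (`|K| + 1) <= eta / 2 by rewrite -ler_pdivlMr// !ge_min lexx !orbT.
have hb : `|h *: b x| <= h * M.
  by rewrite normrZ ger0_norm ?(ltW h0)// ler_wpM2l// ltW.
have hbr : `|h *: b x| <= r by rewrite (le_trans hb)// (le_trans _ hr)// ler_wpM2l ?(ltW h0)// lerDl.
have S := sub h x; rewrite h0 h1 in S; have {}S := S isT.
have := est x (h *: b x) hbr.
have -> : dot (h *: b x) (grad W x) = h * dot (b x) (grad W x).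
  by rewrite /dot mulr_sumr; apply: eq_bigr => i _; rewrite mxE mulrA.
move=> /(le_trans (ler_norm _)) E.
have eb : eta / 2 / (M + 1) * `|h *: b x| <= h * (eta / 2).
  rewrite (le_trans (ler_wpM2l (ltW eM0) hb))// mulrCA ler_wpM2l ?(ltW h0)//.
  have eta20 : 0 <= eta / 2 by rewrite divr_ge0// ltW.
  by rewrite mulrAC ler_pdivrMr// ler_wpM2l// lerDl.
have Kh : K * h ^+ 2 <= h * (eta / 2).
  rewrite expr2 mulrCA ler_wpM2l ?(ltW h0)// (le_trans _ hK)// mulrC.
  by rewrite ler_wpM2l ?(ltW h0)// (le_trans (ler_norm K))// lerDl.
rewrite -(ler_pM2l h0).
move: (W (x + _)) S E => W1' S E; move: (dot _ _) E => D E; move: (W x) S E => W0 S E.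
lra.
Qed.

(** Test functions for the penalty: C1, with the bounds of [V], close to [V] and
    satisfying the differential inequality up to [A * e]. *)
Lemma smooth_subsolution V K C : 0 <= K -> lip_torus K C V ->
  subsolution b l rho V 0 ->
  exists2 A, 0 <= A & forall e, 0 < e -> exists W, [/\ C1_torus W,
    forall x, 0 <= W x <= C, forall x, V x - A * e <= W x &
    forall x, rho * (W x - l x) - A * e <= dot (b x) (grad W x)].
Proof.
move=> K0 V_lip sub; have rho0 := ltW rho_gt0.
have c0 : 0 <= rho * Ll + K * L by rewrite addr_ge0 ?mulr_ge0.
exists (d%:R * (K + (rho * Ll + K * L))); first by rewrite mulr_ge0// addr_ge0.
move=> e e0; have W1 := mollify_C1 e0 V_lip; exists (foldr (avg e) V (enum 'I_d)).
split=> // [|x|x].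
- by have [] := foldr_avg_lip e0 (enum 'I_d) V_lip.
- have := mollify_close e0 (enum 'I_d) x K0 V_lip.
  rewrite size_enum_ord distrC => /(le_trans (ler_norm _)).
  have : 0 <= d%:R * (rho * Ll + K * L) * e by rewrite !mulr_ge0// ltW.
  by lra.
- have := subsolution_grad x W1 (foldr_avg_subsolution (enum 'I_d) e0 K0 V_lip sub).
  rewrite size_enum_ord; apply: le_trans.
  have : 0 <= d%:R * K * e by rewrite !mulr_ge0// ltW.
  by lra.
Qed.
End smooth_subsolution.

(** * The penalised cost bounds the cost of a feedback *)

(** The density agrees almost everywhere with the Radon-Nikodym derivative, for
    which the change of variables is known. *)
Lemma ge0_integral_density (R : realType) (disp : measure_display)
  (T : measurableType disp) (mu : {sigma_finite_measure set T -> \bar R})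
  (P : probability T R) (p : T -> R) (F : T -> \bar R) :
  measurable_fun setT p -> (forall x, 0 <= p x) ->
  (forall A, measurable A -> P A = (\int[mu]_(x in A) (p x)%:E)%E) ->
  measurable_fun setT F -> (forall x, 0 <= F x)%E ->
  (\int[P]_x F x = \int[mu]_x (F x * (p x)%:E))%E.
Proof.
move=> mp p0 Pp mF F0.
have Pmu : P `<< mu.
  apply/null_content_dominatesP => A mA muA0; rewrite Pp//.
  apply: null_set_integral => //; apply/measurable_EFinP.
  exact: measurable_funTS.
rewrite -(Radon_Nikodym_SigmaFinite.change_of_variables Pmu F0 measurableT mF).
apply: ae_eq_integral => //.
- apply: emeasurable_funM => //.
  exact: measurable_int (Radon_Nikodym_SigmaFinite.f_integrable Pmu).
- by apply: emeasurable_funM => //; exact/measurable_EFinP.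
- apply: ae_eqe_mul2l; apply: integral_ae_eq => //.
  + exact: Radon_Nikodym_SigmaFinite.f_integrable.
  + exact/measurable_EFinP.
  + move=> A _ mA; rewrite -Radon_Nikodym_SigmaFinite.f_integral//.
    exact: Pp.
Qed.

Lemma integrable_density (R : realType) (disp : measure_display)
  (T : measurableType disp) (mu : {sigma_finite_measure set T -> \bar R})
  (P : probability T R) (p : T -> R) :
  measurable_fun setT p -> (forall x, 0 <= p x) ->
  (forall A, measurable A -> P A = (\int[mu]_(x in A) (p x)%:E)%E) ->
  mu.-integrable setT (EFin \o p).
Proof.
move=> mp p0 Pp; apply/integrableP; split; first exact/measurable_EFinP.
have := Pp _ measurableT; rewrite probability_setT => /esym.
under eq_integral => x _ do rewrite -[X in X%:E]ger0_norm//.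
by rewrite /= => ->; rewrite ltry.
Qed.

Section weighted_torus_integrals.
Context {R : realType} {d : nat}.
Local Notation tau := (@torus_measure R d).

Lemma integrable_mul_continuous (g h : 'cV[R]_d -> R) C :
  tau.-integrable setT (EFin \o g) -> continuous h -> (forall x, `|h x| <= C) ->
  tau.-integrable setT (EFin \o (fun x => g x * h x)).
Proof.
move=> gi hc hC; have mh := continuous_measurable_cV hc.
have bh : [bounded h x | x in setT].
  by exists C; split; [exact: num_real|move=> M CM x _; exact: le_trans (hC x) (ltW CM)].
exact: (integrableMl _ gi mh bh).
Qed.
End weighted_torus_integrals.

Lemma continuous_dot_grad (R : realType) d (b : 'cV[R]_d -> 'cV[R]_d) (W : 'cV[R]_d -> R) :
  continuous b -> C1 W -> continuous (fun x => dot (b x) (grad W x)).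
Proof.
move=> bc [dW cW]; apply: (continuous_big (op := +%R)) => [|i _]; first exact: add_continuous.
have bic : continuous (fun x => b x i 0).
  move=> x; apply: (@continuous_comp _ _ _ b (fun y : 'cV[R]_d => y i 0)); first exact: bc.
  apply: (@lip_continuous _ _ _ _ 1) => y z.
  by rewrite mul1r; have := entry_le_norm (y - z) i 0; rewrite !mxE.
have gic : continuous (fun x => grad W x i 0).
  rewrite (_ : (fun x => _) = fun x => 'd W x (delta_mx i 0)); first exact: cW.
  by apply/funext => x; rewrite mxE; apply: deriveE; exact: dW.
by move=> x; exact: cvgM (@bic x) (@gic x).
Qed.

Lemma C1_torus_continuous (R : realType) d (W : 'cV[R]_d -> R) :
  C1_torus W -> continuous W.
Proof. by move=> [_ [dW _]] x; exact: differentiable_continuous. Qed.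

Lemma bounded_dot_grad (R : realType) d (b : 'cV[R]_d -> 'cV[R]_d) (W : 'cV[R]_d -> R) M :
  (forall x, `|b x| <= M) -> C1_torus W ->
  exists C, forall x, `|dot (b x) (grad W x)| <= C.
Proof.
move=> bM [Wper WC1]; have [K K0 WK] := C1_periodic_diff_le Wper WC1.
exists (K * M) => x; have [dW _] := WC1.
rewrite -(dot_grad _ (dW x)) (le_trans (WK _ _))//.
by rewrite ler_wpM2l.
Qed.

Section feedback_upper_bound.
Context {R : realType} {d m : nat}.
Local Notation tau := (@torus_measure R d).
Local Notation leb := (@lebesgue_measure R).
Variables (rho : R) (a : 'cV[R]_d -> 'cV[R]_d) (B : 'cV[R]_d -> 'M[R]_(d, m)).
Variables (uc w : 'cV[R]_d -> 'cV[R]_m) (mu mu0 : 'cV[R]_d -> R).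
Let b x := dynamics a B x (uc x).
Variables (L M : R) (X : 'cV[R]_d -> R -> 'cV[R]_d).
Hypotheses (rho_gt0 : 0 < rho) (L_gt0 : 0 < L) (M_ge0 : 0 <= M)
  (b_lip : forall x y, `|b x - b y| <= L * `|x - y|)
  (b_le : forall x, `|b x| <= M) (b_per : torus_periodic b)
  (X_sol : forall z, solves b z (X z))
  (w_mu : forall x, w x = mu x *: uc x) (mu_ge0 : forall x, 0 <= mu x)
  (mu_int : tau.-integrable setT (EFin \o mu))
  (mu0_ge0 : forall x, 0 <= mu0 x)
  (mu0_int : tau.-integrable setT (EFin \o mu0)).

(** As [w = mu uc], the two divergence terms combine into the derivative of the
    test function along the closed-loop field [b]. *)
Lemma residualE W : C1_torus W -> residual rho a B mu0 w mu W =
  \int[tau]_x (mu0 x * W x) - \int[tau]_x (mu x * W x) +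
  rho^-1 * \int[tau]_x (mu x * dot (b x) (grad W x)).
Proof.
move=> W1; have [Wper _] := W1; have Wc := C1_torus_continuous W1.
have [C _ WC] := periodic_bounded Wper Wc.
rewrite /residual; congr (_ + _ * _).
  rewrite -RintegralB//; last 2 first.
  - exact: integrable_mul_continuous mu0_int Wc WC.
  - exact: integrable_mul_continuous mu_int Wc WC.
  by apply: eq_Rintegral => x _; rewrite mulrBl.
apply: eq_Rintegral => x _; rewrite w_mu -scalemxAr -scalerDr /dot mulr_sumr.
by apply: eq_bigr => i _; rewrite mxE mulrA.
Qed.

Lemma le_weighted_integral (g h h' : 'cV[R]_d -> R) C C' : (forall x, 0 <= g x) ->
  tau.-integrable setT (EFin \o g) -> continuous h -> continuous h' ->
  (forall x, `|h x| <= C) -> (forall x, `|h' x| <= C') -> (forall x, h x <= h' x) ->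
  \int[tau]_x (g x * h x) <= \int[tau]_x (g x * h' x).
Proof.
move=> g0 gi hc hc' hC hC' hh'; apply: le_Rintegral => //.
- exact: integrable_mul_continuous gi hc hC.
- exact: integrable_mul_continuous gi hc' hC'.
- by move=> x _; rewrite ler_wpM2l.
Qed.

Lemma weighted_integral_linear (g h h' : 'cV[R]_d -> R) C C' k k' c :
  tau.-integrable setT (EFin \o g) -> continuous h -> continuous h' ->
  (forall x, `|h x| <= C) -> (forall x, `|h' x| <= C') ->
  \int[tau]_x (g x * (k * h x + k' * h' x + c)) =
  k * \int[tau]_x (g x * h x) + k' * \int[tau]_x (g x * h' x) + c * \int[tau]_x g x.
Proof.
move=> gi hc hc' hC hC'.
have scale (u : 'cV[R]_d -> R) r : tau.-integrable setT (EFin \o u) ->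
    tau.-integrable setT (EFin \o (fun x => r * u x)).
  by move=> ui; exact: (integrableZl measurableT r ui).
have ih := integrable_mul_continuous gi hc hC.
have ih' := integrable_mul_continuous gi hc' hC'.
have ikh := scale _ k ih; have ikh' := scale _ k' ih'; have icg := scale _ c gi.
have isum : tau.-integrable setT
    (EFin \o (fun x => k * (g x * h x) + k' * (g x * h' x))).
  exact: (integrableD measurableT ikh ikh').
transitivity (\int[tau]_x (k * (g x * h x) + k' * (g x * h' x) + c * g x)).
  by apply: eq_Rintegral => x _; move: (g x) (h x) (h' x) => *; lra.
by rewrite RintegralD// RintegralD// !RintegralZl.
Qed.

Section normalised_cost.
Variables (l : 'cV[R]_d -> R) (Ll : R).
Hypotheses (Ll_ge0 : 0 <= Ll) (l_lip : forall x y, `|l x - l y| <= Ll * `|x - y|)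
  (l_ge0 : forall x, 0 <= l x) (l_le1 : forall x, l x <= 1) (l_per : torus_periodic l).

Let norm01 (r : R) : 0 <= r <= 1 -> `|r| <= 1.
Proof. by move=> /andP[r0 r1]; rewrite ger0_norm. Qed.

(** A smooth subsolution [W] close to the truncated value is a competitor in the
    supremum that defines the positive part. In its pairing with the residual,
    [rho * (W - l) <= dot b (grad W)] bounds the transport term from below by
    the integral of [mu * (W - l)], and the integrals of [mu * W] cancel. *)
Lemma trunc_value_le_pos_part (T : R) : 0 <= T ->
  ((\int[tau]_x (mu0 x * trunc_value l X rho T x) - \int[tau]_x (mu x * l x))%:E
   <= pos_part_mass (residual rho a B mu0 w mu))%E.
Proof.
move=> T0; set V := trunc_value l X rho T.
have [K K0 Vlip] := trunc_value_lip L_gt0 M_ge0 b_lip b_le Ll_ge0 l_lip X_sol rho_gt0 T0.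
have V01 x : 0 <= V x <= 1.
  rewrite /V (trunc_value_ge0 _ l_ge0)//=.
  exact: (trunc_value_le M_ge0 b_le l_lip l_ge0 l_le1 X_sol rho_gt0).
have Vper : torus_periodic V.
  exact: (trunc_value_periodic _ L_gt0 M_ge0 b_lip b_le X_sol).
have V_lt : lip_torus K 1 V by [].
have sub := trunc_value_subsolution L_gt0 M_ge0 b_lip b_le Ll_ge0 l_lip l_ge0 l_le1 X_sol rho_gt0 T0.
have [A A0 smooth] := smooth_subsolution (ltW L_gt0) M_ge0 b_lip b_le Ll_ge0 l_lip rho_gt0 K0 V_lt sub.
set Imu0 := \int[tau]_x mu0 x; set Imu := \int[tau]_x mu x.
have Imu00 : 0 <= Imu0 by exact: Rintegral_ge0.
have Imu_0 : 0 <= Imu by exact: Rintegral_ge0.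
have rhoV0 : 0 <= rho^-1 by rewrite invr_ge0 ltW.
have D0 : 0 < A * (Imu0 + rho^-1 * Imu) + 1.
  by rewrite ltr_wpDl// mulr_ge0// addr_ge0// mulr_ge0.
apply/lee_subgt0Pr => eta eta0.
(* the mollification error is [A * e] against the weight [Imu0 + rho^-1 * Imu] *)
pose e := eta / (A * (Imu0 + rho^-1 * Imu) + 1).
have e0 : 0 < e by rewrite divr_gt0.
have [W [W1 W01 VW Wsub]] := smooth e e0.
apply: (@le_trans _ _ (residual rho a B mu0 w mu W)%:E); last first.
  by apply: ereal_sup_ubound; exists W.
rewrite -EFinB lee_fin residualE//.
have Vc := lip_torus_continuous V_lt; have Wc := C1_torus_continuous W1.
have lc : continuous l by exact: lip_continuous l_lip.
have bc : continuous b by exact: lip_continuous b_lip.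
have [_ WC1] := W1; have Dc := continuous_dot_grad bc WC1.
have [CD DC] := bounded_dot_grad b_le W1.
have W1' x : `|W x| <= 1 := norm01 (W01 x).
have V1' x : `|V x| <= 1 := norm01 (V01 x).
have l1' x : `|l x| <= 1 by apply: norm01; rewrite l_ge0 l_le1.
have i0V := integrable_mul_continuous mu0_int Vc V1'.
have imW := integrable_mul_continuous mu_int Wc W1'.
have iml := integrable_mul_continuous mu_int lc l1'.
have s1 : \int[tau]_x (mu0 x * V x) - A * e * Imu0 <= \int[tau]_x (mu0 x * W x).
  have cc : continuous (fun x => 1 * V x + 0 * V x + (- (A * e))).
    by move=> x; exact: cvgD (cvgD (cvgM (cvg_cst _) (@Vc x)) (cvgM (cvg_cst _) (@Vc x))) (cvg_cst _).
  have cb x : `|1 * V x + 0 * V x + (- (A * e))| <= 1 + `|A * e|.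
    by rewrite mul1r mul0r addr0 (le_trans (ler_normD _ _))// normrN lerD2r.
  have := le_weighted_integral mu0_ge0 mu0_int cc Wc cb W1'; rewrite (weighted_integral_linear _ _ _ mu0_int Vc Vc V1' V1').
  rewrite mul1r mul0r addr0 mulNr; apply=> x.
  by rewrite mul1r mul0r addr0.
have s2 : rho * \int[tau]_x (mu x * W x) - rho * \int[tau]_x (mu x * l x) - A * e * Imu <=
    \int[tau]_x (mu x * dot (b x) (grad W x)).
  have cc : continuous (fun x => rho * W x + (- rho) * l x + (- (A * e))).
    by move=> x; exact: cvgD (cvgD (cvgM (cvg_cst _) (@Wc x)) (cvgM (cvg_cst _) (@lc x))) (cvg_cst _).
  have cb x : `|rho * W x + (- rho) * l x + (- (A * e))| <= rho + rho + `|A * e|.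
    rewrite (le_trans (ler_normD _ _))// normrN lerD2r (le_trans (ler_normD _ _))//.
    by rewrite !normrM normrN gtr0_norm// lerD// ger_pMr.
  have := le_weighted_integral mu_ge0 mu_int cc Dc cb DC; rewrite (weighted_integral_linear _ _ _ mu_int Wc lc W1' l1').
  rewrite !mulNr; apply=> x.
  by rewrite (le_trans _ (Wsub x))// mulrBr mulNr.
have s3 : A * e * (Imu0 + rho^-1 * Imu) <= eta.
  rewrite mulrAC -[leRHS](divfK (lt0r_neq0 D0)) -/e mulrC ler_wpM2l ?(ltW e0)//.
  by rewrite lerDl.
have s4 : \int[tau]_x (mu x * W x) - \int[tau]_x (mu x * l x) - rho^-1 * (A * e * Imu) <=
    rho^-1 * \int[tau]_x (mu x * dot (b x) (grad W x)).
  have := ler_wpM2l rhoV0 s2; rewrite !mulrBr !mulKf ?gt_eqF//.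
move: s1 s3 s4; lra.
Qed.
End normalised_cost.

Section general_cost.
Variables (l : 'cV[R]_d -> R) (Ll C : R).
Hypotheses (Ll_ge0 : 0 <= Ll) (l_lip : forall x y, `|l x - l y| <= Ll * `|x - y|)
  (l_ge0 : forall x, 0 <= l x) (l_leC : forall x, l x <= C) (l_per : torus_periodic l).

Let C_ge0 : 0 <= C. Proof. exact: le_trans (l_ge0 0) (l_leC 0). Qed.

(** Test functions lie between 0 and 1, so the running cost is divided by its
    bound [C], which reappears as the weight of the penalty. *)
Lemma trunc_value_le_penalised (T : R) : 0 <= T ->
  ((\int[tau]_x (mu0 x * trunc_value l X rho T x))%:E
   <= (\int[tau]_x (mu x * l x))%:E
      + C%:E * pos_part_mass (residual rho a B mu0 w mu))%E.
Proof.
move=> T0; have [C0|C0] := eqVneq C 0.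
  rewrite C0 mul0e adde0 lee_fin.
  have l0 x : l x = 0 by apply/eqP; rewrite eq_le l_ge0 andbT -C0 l_leC.
  have V0 x : trunc_value l X rho T x = 0.
    apply/eqP; rewrite eq_le (trunc_value_ge0 _ l_ge0)// andbT -C0.
    exact: (trunc_value_le M_ge0 b_le l_lip l_ge0 l_leC X_sol rho_gt0).
  rewrite le_eqVlt; apply/orP; left; apply/eqP.
  by apply: eq_Rintegral => x _; rewrite V0 l0 !mulr0.
have Cgt0 : 0 < C by rewrite lt_neqAle eq_sym C0.
pose l1 x := C^-1 * l x.
have l1_lip x y : `|l1 x - l1 y| <= (C^-1 * Ll) * `|x - y|.
  rewrite /l1 -mulrBr normrM ger0_norm ?invr_ge0// -mulrA ler_wpM2l ?invr_ge0//.
have l1_ge0 x : 0 <= l1 x by rewrite mulr_ge0// invr_ge0.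
have l1_le1 x : l1 x <= 1 by rewrite /l1 mulrC ler_pdivrMr// mul1r.
have l1_per : torus_periodic l1 by move=> x i; rewrite /l1 l_per.
have Ll1 : 0 <= C^-1 * Ll by rewrite mulr_ge0// invr_ge0.
have := trunc_value_le_pos_part Ll1 l1_lip l1_ge0 l1_le1 l1_per T0.
have V1E x : trunc_value l1 X rho T x = C^-1 * trunc_value l X rho T x.
  rewrite /trunc_value mulrCA; congr (_ * _); rewrite -RintegralZl//.
    by apply: eq_Rintegral => t _; rewrite /running /l1 mulrCA.
  apply: continuous_integrable.
  exact: (running_continuous M_ge0 b_le l_lip X_sol).
have lc : continuous l by exact: lip_continuous l_lip.
have lC x : `|l x| <= C by rewrite ger0_norm.
have [K K0 Vlip] := trunc_value_lip L_gt0 M_ge0 b_lip b_le Ll_ge0 l_lip X_sol rho_gt0 T0.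
have Vc : continuous (trunc_value l X rho T) by exact: lip_continuous Vlip.
have VC x : `|trunc_value l X rho T x| <= C.
  rewrite ger0_norm ?(trunc_value_ge0 _ l_ge0)//.
  exact: (trunc_value_le M_ge0 b_le l_lip l_ge0 l_leC X_sol rho_gt0).
have -> : \int[tau]_x (mu0 x * trunc_value l1 X rho T x) =
    C^-1 * \int[tau]_x (mu0 x * trunc_value l X rho T x).
  rewrite -RintegralZl//; last exact: integrable_mul_continuous mu0_int Vc VC.
  by apply: eq_Rintegral => x _; rewrite V1E mulrCA.
have -> : \int[tau]_x (mu x * l1 x) = C^-1 * \int[tau]_x (mu x * l x).
  rewrite -RintegralZl//; last exact: integrable_mul_continuous mu_int lc lC.
  by apply: eq_Rintegral => x _; rewrite mulrCA.
rewrite -mulrBr EFinM EFinB.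
move=> /(@lee_wpmul2l _ C%:E); rewrite lee_fin => /(_ C_ge0).
have CC : (C%:E * (C^-1)%:E = 1)%E by rewrite -EFinM mulfV.
rewrite muleA CC mul1e => H.
by rewrite -leeBlDl.
Qed.

(** Monotone convergence, as the running cost is nonnegative. *)
Lemma discounted_cost_cvg (x : 'cV[R]_d) :
  (fun n => (trunc_value l X rho n%:R x)%:E) @ \oo -->
  (rho%:E * \int[leb]_(t in `[0%R, +oo[) (expR (- rho * t) * l (X x t))%:E)%E.
Proof.
have rc : continuous (running l X rho x).
  exact: (running_continuous M_ge0 b_le l_lip X_sol).
have -> : (\int[leb]_(t in `[0%R, +oo[) (expR (- rho * t) * l (X x t))%:E =
    \int[leb]_(t in \bigcup_n `[0%R, n%:R]%classic) (running l X rho x t)%:E)%E.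
  have -> : \bigcup_n `[0%R, n%:R]%classic = `[0%R, +oo[%classic :> set R.
    apply/seteqP; split => [t [n _]|t]; rewrite /= !in_itv/= ?andbT => t0.
      by case/andP: t0.
    exists (Num.truncn t).+1 => //=; rewrite in_itv/= t0/= ltW//.
    exact: truncnS_gt.
  apply: eq_integral => t; rewrite inE/= in_itv/= andbT => t0.
  by rewrite /running /even_ext ger0_norm.
have E n : (trunc_value l X rho n%:R x)%:E =
    (rho%:E * \int[leb]_(t in `[0%R, n%:R]) (running l X rho x t)%:E)%E.
  rewrite /trunc_value EFinM /Rintegral fineK//.
  apply: integrable_fin_num => //.
  exact: continuous_integrable.
under eq_fun do rewrite E.
apply: cvgeZl => //; apply: ge0_nondecreasing_set_cvg_integral.
- by move=> p q pq; apply/subsetPset; apply: subset_itvl; rewrite bnd_simp ler_nat.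
- by move=> i; exact: measurable_itv.
- move=> i; apply/measurable_EFinP; apply: measurable_funTS.
  exact: continuous_measurable_fun.
- by move=> i t _; rewrite lee_fin (running_ge0 _ _ l_ge0).
Qed.

Lemma feedback_cost_le (P0 : probability 'cV[R]_d R) :
  measurable_fun setT mu0 ->
  (forall A, measurable A -> P0 A = (\int[tau]_(x in A) (mu0 x)%:E)%E) ->
  (\int[P0]_x (rho%:E * \int[leb]_(t in `[0%R, +oo[) (expR (- rho * t) * l (X x t))%:E)
   <= (\int[tau]_x (mu x * l x))%:E
      + C%:E * pos_part_mass (residual rho a B mu0 w mu))%E.
Proof.
move=> mu0_meas P0_density.
have Vc n : continuous (trunc_value l X rho n%:R).
  have [K K0 Vlip] := trunc_value_lip L_gt0 M_ge0 b_lip b_le Ll_ge0 l_lip X_sol rho_gt0 (ler0n _ n).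
  exact: lip_continuous Vlip.
have mV n : measurable_fun setT (fun x => (trunc_value l X rho n%:R x)%:E).
  by apply/measurable_EFinP; exact: continuous_measurable_cV.
have V0 n x : (0 <= (trunc_value l X rho n%:R x)%:E)%E.
  by rewrite lee_fin (trunc_value_ge0 _ l_ge0).
have Vnd x p q : (p <= q)%N ->
    ((trunc_value l X rho p%:R x)%:E <= (trunc_value l X rho q%:R x)%:E)%E.
  move=> pq; rewrite lee_fin /trunc_value ler_wpM2l ?(ltW rho_gt0)//.
  have rc : continuous (running l X rho x).
    exact: (running_continuous M_ge0 b_le l_lip X_sol).
  rewrite -subr_ge0 Rintegral_itvB_cc ?ler_nat//.
  by rewrite Rintegral_ge0// => t _; rewrite (running_ge0 _ _ l_ge0).
rewrite (eq_integral (fun x => limn (fun n => (trunc_value l X rho n%:R x)%:E))); last first.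
  by move=> x _; apply/esym/cvg_lim => //; exact: discounted_cost_cvg.
rewrite monotone_convergence//; last by move=> x _ p q; exact: Vnd.
apply: lime_le.
  apply: ereal_nondecreasing_is_cvgn => p q pq; apply: ge0_le_integral => // x _.
  exact: Vnd.
apply: nearW => n.
rewrite (ge0_integral_density mu0_meas mu0_ge0 P0_density)//.
have := trunc_value_le_penalised (ler0n _ n); apply: le_trans.
rewrite /Rintegral fineK; last first.
  apply: integrable_fin_num => //.
  have VC x : `|trunc_value l X rho n%:R x| <= C.
    rewrite ger0_norm ?(trunc_value_ge0 _ l_ge0)//.
    exact: (trunc_value_le M_ge0 b_le l_lip l_ge0 l_leC X_sol rho_gt0).
  exact: integrable_mul_continuous mu0_int (Vc n) VC.
rewrite le_eqVlt; apply/orP; left; apply/eqP.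
by apply: eq_integral => x _; rewrite [RHS]EFinM muleC.
Qed.
End general_cost.
End feedback_upper_bound.

(** * Candidate controllers *)

Section euclidean_norm.
Context {R : realType} {n : nat}.
Implicit Types u v : 'cV[R]_n.

Lemma norm2_ge0 u : 0 <= norm2 u. Proof. exact: sqrtr_ge0. Qed.

Lemma sqr_norm2 u : norm2 u ^+ 2 = \sum_i u i 0 ^+ 2.
Proof. by rewrite sqr_sqrtr// sumr_ge0// => i _; rewrite sqr_ge0. Qed.

Lemma entry_le_norm2 u i : `|u i 0| <= norm2 u.
Proof.
rewrite -(@ler_pXn2r _ 2)// ?nnegrE ?norm2_ge0// sqr_norm2 real_normK ?num_real//.
by rewrite (bigD1 i)//= lerDl sumr_ge0// => j _; rewrite sqr_ge0.
Qed.

(** Cauchy-Schwarz, from the expansion of the squared norm of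
    [norm2 v *: u - norm2 u *: v]. *)
Lemma dot_le_norm2 u v : dot u v <= norm2 u * norm2 v.
Proof.
have [u0|u0] := eqVneq (norm2 u) 0.
  rewrite u0 mul0r /dot big1// => i _.
  by have := entry_le_norm2 u i; rewrite u0 normr_le0 => /eqP ->; rewrite mul0r.
have [v0|v0] := eqVneq (norm2 v) 0.
  rewrite v0 mulr0 /dot big1// => i _.
  by have := entry_le_norm2 v i; rewrite v0 normr_le0 => /eqP ->; rewrite mulr0.
have ab0 : 0 < norm2 u * norm2 v.
  by rewrite mulr_gt0// lt_neqAle eq_sym ?u0 ?v0 /= norm2_ge0.
have : 0 <= \sum_i (norm2 v * u i 0 - norm2 u * v i 0) ^+ 2.
  by rewrite sumr_ge0// => i _; rewrite sqr_ge0.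
have -> : \sum_i (norm2 v * u i 0 - norm2 u * v i 0) ^+ 2 =
    norm2 v ^+ 2 * norm2 u ^+ 2 + norm2 u ^+ 2 * norm2 v ^+ 2
    - 2 * (norm2 u * norm2 v) * dot u v.
  rewrite [X in _ * X + _]sqr_norm2 [X in _ + _ * X - _]sqr_norm2 /dot !mulr_sumr.
  rewrite -big_split -sumrB /=; apply: eq_bigr => i _.
  by move: (norm2 u) (norm2 v) (u i 0) (v i 0) => *; lra.
move=> H; rewrite -(ler_pM2l ab0); move: (norm2 u) (norm2 v) (dot u v) H => *; lra.
Qed.

Lemma norm2_triangle u v : norm2 (u + v) <= norm2 u + norm2 v.
Proof.
rewrite -(@ler_pXn2r _ 2)// ?nnegrE ?addr_ge0 ?norm2_ge0// sqr_norm2 sqrrD.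
have -> : \sum_i (u + v) i 0 ^+ 2 = norm2 u ^+ 2 + (dot u v) *+ 2 + norm2 v ^+ 2.
  rewrite !sqr_norm2 /dot -sumrMnl -!big_split /=.
  by apply: eq_bigr => i _; rewrite mxE sqrrD.
by rewrite lerD2r lerD2l lerMn2r dot_le_norm2.
Qed.

Lemma norm2_le_norm u : norm2 u <= n%:R * `|u|.
Proof.
rewrite -(@ler_pXn2r _ 2)// ?nnegrE ?norm2_ge0 ?mulr_ge0// sqr_norm2.
rewrite (@le_trans _ _ (\sum_(i < n) `|u| ^+ 2))//.
  apply: ler_sum => i _; rewrite -real_normK ?num_real//.
  by rewrite ler_pXn2r ?nnegrE// entry_le_norm.
rewrite sumr_const card_ord exprMn -[X in X <= _]mulr_natl.
rewrite ler_wpM2r ?exprn_ge0// -natrX ler_nat.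
by case: n => // k; rewrite leq_pmulr.
Qed.

Lemma norm2_lip u v : `|norm2 u - norm2 v| <= n%:R * `|u - v|.
Proof.
rewrite ler_norml; apply/andP; split.
  have := norm2_triangle u (v - u); have := norm2_le_norm (v - u).
  by rewrite [u + _]addrC subrK distrC; lra.
have := norm2_triangle v (u - v); have := norm2_le_norm (u - v).
by rewrite [v + _]addrC subrK; lra.
Qed.

End euclidean_norm.

Lemma powR_lip (R : realType) (q C s t : R) : 1 < q -> 0 <= s <= C -> 0 <= t <= C ->
  `|s `^ q - t `^ q| <= q * C `^ (q - 1) * `|s - t|.
Proof.
move=> q1; wlog st : s t / s <= t.
  move=> W; have [/W//|/ltW ts sC tC] := leP s t.
  by rewrite distrC [`|s - t|]distrC; exact: W.
move=> /andP[s0 sC] /andP[t0 tC]; have q0 : 0 < q by lra.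
have q10 : 0 <= q - 1 by lra.
have mono x y : 0 <= x -> x <= y -> x `^ (q - 1) <= y `^ (q - 1).
  by move=> x0 xy; apply: ge0_ler_powR; rewrite // nnegrE// (le_trans x0).
have mono' x y : 0 <= x -> x <= y -> x `^ q <= y `^ q.
  by move=> x0 xy; apply: ge0_ler_powR; rewrite ?(ltW q0)// nnegrE// (le_trans x0).
rewrite distrC [`|s - t|]distrC !ger0_norm ?subr_ge0//; last exact: mono'.
move: s0; rewrite le_eqVlt => /predU1P[<-|s0].
  rewrite powR0 ?gt_eqF// !subr0.
  have -> : t `^ q = t `^ (q - 1) * t.
    by rewrite -[X in _ * X]powRr1// -powRD ?subrK// gt_eqF// implybT.
  by rewrite ler_wpM2r// (le_trans (mono _ _ t0 tC))// ler_peMl ?powR_ge0// ltW.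
have der x : x \in `]s, t[ -> is_derive x 1 (fun x => x `^ q) (q * x `^ (q - 1)).
  rewrite in_itv/= => /andP[sx _]; apply: is_derive1_powR; exact: lt_trans sx.
have [|c] := @MVT_segment R (fun x => x `^ q) (fun x => q * x `^ (q - 1)) s t st der.
  apply: derivable_within_continuous => x; rewrite in_itv/= => /andP[sx _].
  have x0 : 0 < x by exact: lt_le_trans sx.
  by have [] := is_derive1_powR q x0.
rewrite in_itv/= => /andP[sc ct] ->; rewrite ler_wpM2r ?subr_ge0// ler_wpM2l ?(ltW q0)//.
by apply: mono; [exact: le_trans (ltW s0) sc|exact: le_trans ct tC].
Qed.

Section dynamics_estimates.
Context {R : realType} {d m : nat}.
Variables (a : 'cV[R]_d -> 'cV[R]_d) (B : 'cV[R]_d -> 'M[R]_(d, m)).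

Lemma norm_mulmx_le (A : 'M[R]_(d, m)) (u : 'cV[R]_m) : `|A *m u| <= m%:R * `|A| * `|u|.
Proof.
apply: norm_le_col => [|i]; first by rewrite !mulr_ge0.
rewrite mxE (le_trans (ler_norm_sum _ _ _))//.
rewrite (@le_trans _ _ (\sum_(k < m) `|A| * `|u|))//.
  by apply: ler_sum => k _; rewrite normrM ler_pM// entry_le_norm.
by rewrite sumr_const card_ord -[X in X <= _]mulr_natl mulrA.
Qed.

Variable (uc : 'cV[R]_d -> 'cV[R]_m).
Hypotheses (a_per : torus_periodic a) (B_per : torus_periodic B) (uc_per : torus_periodic uc)
  (a_lip : lipschitz a) (B_lip : lipschitz B)
  (uc_lip : exists2 Lu, 0 <= Lu & forall x y, `|uc x - uc y| <= Lu * `|x - y|).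

Lemma closed_loop_field : exists L M, [/\ 0 < L, 0 <= M,
  forall x y, `|dynamics a B x (uc x) - dynamics a B y (uc y)| <= L * `|x - y|,
  forall x, `|dynamics a B x (uc x)| <= M &
  torus_periodic (fun x => dynamics a B x (uc x))].
Proof.
have [La La0 aL] := lipschitzP a_lip; have [LB LB0 BL] := lipschitzP B_lip.
have [Lu Lu0 uL] := uc_lip.
have [Ma Ma0 aM] := periodic_bounded a_per (lip_continuous aL).
have [MB MB0 BM] := periodic_bounded B_per (lip_continuous BL).
have [Mu Mu0 uM] := periodic_bounded uc_per (lip_continuous uL).
exists (La + m%:R * LB * Mu + m%:R * MB * Lu + 1), (Ma + m%:R * MB * Mu); split.
- by rewrite ltr_wpDl// !addr_ge0// !mulr_ge0.
- by rewrite addr_ge0// !mulr_ge0.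
- move=> x y; rewrite /dynamics opprD addrACA (le_trans (ler_normD _ _))//.
  have -> : B x *m uc x - B y *m uc y = (B x - B y) *m uc x + B y *m (uc x - uc y).
    by rewrite mulmxBl mulmxBr addrA subrK.
  have h1 : `|(B x - B y) *m uc x| <= m%:R * (LB * `|x - y|) * Mu.
    rewrite (le_trans (norm_mulmx_le _ _))// ler_pM ?mulr_ge0//.
    by rewrite ler_wpM2l.
  have h2 : `|B y *m (uc x - uc y)| <= m%:R * MB * (Lu * `|x - y|).
    rewrite (le_trans (norm_mulmx_le _ _))// ler_pM ?mulr_ge0//.
    by rewrite ler_wpM2l.
  have := ler_normD ((B x - B y) *m uc x) (B y *m (uc x - uc y)).
  have := aL x y; have := normr_ge0 (x - y).
  move: (`|x - y|) (`|a x - a y|) (`|_ + _|) h1 h2 => r A S h1 h2.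
  by lra.
- move=> x; rewrite (le_trans (ler_normD _ _))// lerD//.
  rewrite (le_trans (norm_mulmx_le _ _))// ler_pM ?mulr_ge0//.
  by rewrite ler_wpM2l.
- by move=> x i; rewrite /dynamics a_per B_per uc_per.
Qed.

End dynamics_estimates.

Lemma power_cost_ge0 (R : realType) n (q : R) (u : 'cV[R]_n) : 0 < q -> 0 <= power_cost q u.
Proof. by move=> q0; rewrite divr_ge0 ?powR_ge0// ltW. Qed.

Section perf_of_feedback.
Context {R : realType} {d m : nat}.
Local Notation tau := (@torus_measure R d).
Variables (rho q q' : R) (f : 'cV[R]_d -> R).
Variables (a : 'cV[R]_d -> 'cV[R]_d) (B : 'cV[R]_d -> 'M[R]_(d, m)).
Hypotheses (rho_gt0 : 0 < rho) (q_gt1 : 1 < q)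
  (f_per : torus_periodic f) (a_per : torus_periodic a) (B_per : torus_periodic B)
  (f_ge0 : forall x, 0 <= f x)
  (f_lip : lipschitz f) (a_lip : lipschitz a) (B_lip : lipschitz B).

Lemma closed_loop_solves (u : 'cV[R]_d -> 'cV[R]_m) : torus_periodic u ->
  (exists2 Lu, 0 <= Lu & forall x y, `|u x - u y| <= Lu * `|x - y|) ->
  forall z, solves (fun x => dynamics a B x (u x)) z (closed_loop a B u z).
Proof.
move=> uper ulip z.
have [L [M [L0 M0 bL bM _]]] := closed_loop_field a_per B_per uper a_lip B_lip ulip.
have [x xP] := solves_exists L0 M0 bL bM z.
by have := @xgetPex _ (fun=> z) [set x | is_trajectory a B z (u \o x) x]; apply; exists x.
Qed.

Lemma feedback_cost_lip (u : 'cV[R]_d -> 'cV[R]_m) C :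
  (exists2 Lu, 0 <= Lu & forall x y, `|u x - u y| <= Lu * `|x - y|) ->
  (forall x, norm2 (u x) <= C) ->
  exists2 Ll, 0 <= Ll & forall x y,
    `|(f x + power_cost q (u x)) - (f y + power_cost q (u y))| <= Ll * `|x - y|.
Proof.
move=> [Lu Lu0 uL] uC; have [Lf Lf0 fL] := lipschitzP f_lip.
have q0 : 0 < q by exact: lt_trans q_gt1.
exists (Lf + C `^ (q - 1) * (m%:R * Lu)).
  by rewrite addr_ge0// mulr_ge0 ?powR_ge0// mulr_ge0.
move=> x y; rewrite opprD addrACA (le_trans (ler_normD _ _))// mulrDl lerD//.
rewrite /power_cost -mulrBl normrM (ger0_norm (_ : 0 <= q^-1)) ?invr_ge0 ?(ltW q0)//.
have n2 z : 0 <= norm2 (u z) <= C by rewrite norm2_ge0 uC.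
rewrite ler_pdivrMr// (le_trans (powR_lip q_gt1 (n2 x) (n2 y)))//.
have h : `|norm2 (u x) - norm2 (u y)| <= m%:R * (Lu * `|x - y|).
  by rewrite (le_trans (norm2_lip _ _))// ler_wpM2l.
have P0 : 0 <= q * C `^ (q - 1) by rewrite mulr_ge0 ?powR_ge0// ltW.
have := ler_wpM2l P0 h; move: (_ `^ _) (`|_|) (`|_|) => A B1 B2; lra.
Qed.

(** The bound [Cu] on the controller keeps the running cost below [CV], the
    weight of the penalty in [J]. *)
Lemma perf_feedback_le_J (alpha : 'cV[R]_d -> 'cV[R]_m)
  (mu0 : 'cV[R]_d -> R) (P0 : probability 'cV[R]_d R)
  (w : 'cV[R]_d -> 'cV[R]_m) (mu : 'cV[R]_d -> R) (uc : 'cV[R]_d -> 'cV[R]_m) :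
  measurable_fun setT mu0 -> (forall x, 0 <= mu0 x) ->
  (forall A, measurable A -> P0 A = (\int[tau]_(x in A) (mu0 x)%:E)%E) ->
  (forall x, 0 <= mu x) -> tau.-integrable setT (EFin \o mu) ->
  (forall x, w x = mu x *: uc x) -> torus_periodic uc -> C1 uc ->
  (forall x, norm2 (uc x) <= Cu q q' f alpha) ->
  (perf rho q f P0 uc (closed_loop a B uc)
   <= J rho q f a B (CV q q' f alpha) mu0 w mu)%E.
Proof.
move=> mu0_meas mu0_ge0 P0_density mu_ge0 mu_int w_mu uc_per uc_C1 uc_le.
have q0 : 0 < q by exact: lt_trans q_gt1.
have uc_lip := C1_periodic_lipschitz uc_per uc_C1.
have [L [M [L0 M0 bL bM b_per]]] := closed_loop_field a_per B_per uc_per a_lip B_lip uc_lip.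
have X_sol := closed_loop_solves uc_per uc_lip.
pose l x := f x + power_cost q (uc x).
have [Ll Ll0 l_lip] := feedback_cost_lip uc_lip uc_le.
have [Lf Lf0 fL] := lipschitzP f_lip.
have l_ge0 x : 0 <= l x by rewrite addr_ge0// power_cost_ge0.
have l_per : torus_periodic l by move=> x i; rewrite /l f_per uc_per.
have Cu0 : 0 <= Cu q q' f alpha by exact: le_trans (norm2_ge0 _) (uc_le 0).
have l_le x : l x <= CV q q' f alpha.
  rewrite lerD//.
    by rewrite (le_trans (ler_norm _))// le_linf_norm//; exact: lip_continuous fL.
  rewrite ler_wpM2r ?invr_ge0 ?(ltW q0)//.
  by apply: ge0_ler_powR; rewrite ?nnegrE ?(ltW q0)// norm2_ge0.
have mu0_int := integrable_density mu0_meas mu0_ge0 P0_density.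
have := feedback_cost_le rho_gt0 L0 M0 bL bM b_per X_sol w_mu mu_ge0 mu_int
  mu0_ge0 mu0_int Ll0 l_lip l_ge0 l_le l_per mu0_meas P0_density.
move=> /le_trans; apply; rewrite /J leeD2r//.
have lc : continuous l by exact: lip_continuous l_lip.
have lC x : `|l x| <= CV q q' f alpha by rewrite ger0_norm.
rewrite /Rintegral fineK; last first.
  by apply: integrable_fin_num => //; exact: integrable_mul_continuous mu_int lc lC.
rewrite le_eqVlt; apply/orP; left; apply/eqP; apply: eq_integral => x _; congr EFin.
have [->|mux] := eqVneq (mu x) 0; first by rewrite mul0r mulr0.
by rewrite w_mu scalerA mulVf// scale1r mulrC.
Qed.

End perf_of_feedback.

(** * The chain rule along trajectories *)

Lemma Rintegral_sum (disp : measure_display) (T : measurableType disp) (R : realType)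
  (mu : {measure set T -> \bar R}) (D : set T) (I : Type) (s : seq I) (g : I -> T -> R) :
  measurable D -> (forall i, mu.-integrable D (EFin \o g i)) ->
  mu.-integrable D (EFin \o (fun x => \sum_(i <- s) g i x)) /\
  \int[mu]_(x in D) (\sum_(i <- s) g i x) = \sum_(i <- s) \int[mu]_(x in D) g i x.
Proof.
move=> mD gi; elim: s => [|i s [IHi IH]].
  rewrite (_ : (fun x => _) = (fun=> 0)); last by apply/funext => x; rewrite big_nil.
  rewrite big_nil.
  split; first exact: integrable0.
  by rewrite Rintegral_cst// mul0r.
have E : (fun x => \sum_(j <- i :: s) g j x) = (fun x => g i x + \sum_(j <- s) g j x).
  by apply/funext => x; rewrite big_cons.
rewrite E big_cons RintegralD// IH; split => //.
exact: (integrableD mD (gi i) IHi).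
Qed.

Section chain_rule.
Context {R : realType} {d : nat}.
Local Notation leb := (@lebesgue_measure R).
Variables (x beta : R -> 'cV[R]_d) (F : 'cV[R]_d -> R).
Hypotheses (F_C1 : C1_torus F) (x_meas : measurable_fun (`[0, +oo[ : set R) x)
  (beta_int : forall t, 0 <= t -> forall i, leb.-integrable `[0, t] (fun s => (beta s i 0)%:E))
  (x_eq : forall t, 0 <= t -> forall i,
     x t i 0 = x 0 i 0 + \int[leb]_(s in `[0, t]) beta s i 0).

Let sum_int (I : interval R) (g : 'I_d -> R -> R) :
  (forall i, leb.-integrable [set` I] (EFin \o g i)) ->
  leb.-integrable [set` I] (EFin \o (fun s => \sum_i g i s)) /\
  \int[leb]_(s in [set` I]) (\sum_i g i s) = \sum_i \int[leb]_(s in [set` I]) g i s.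
Proof. by move=> gi; exact: Rintegral_sum. Qed.

Let gam s := dot (beta s) (grad F (x s)).
Let absb s := \sum_i `|beta s i 0|.

Let grad_comp_meas (T : R) i : measurable_fun (`[0, T]%classic : set R) (fun s => grad F (x s) i 0).
Proof.
have [_ [dF cF]] := F_C1.
have gc : continuous (fun y => grad F y i 0).
  rewrite (_ : (fun x => _) = fun x => 'd F x (delta_mx i 0)); first exact: cF.
  by apply/funext => y; rewrite mxE; apply: deriveE; exact: dF.
apply: (@measurableT_comp _ _ _ _ _ _ (fun y => grad F y i 0)).
  exact: continuous_measurable_cV.
by apply: measurable_funS x_meas => //; apply: subset_itvl; rewrite bnd_simp.
Qed.

Let grad_bounded : exists2 G, 0 <= G & forall y i, `|grad F y i 0| <= G.
Proof.
have [Fper FC1] := F_C1; have [K K0 FK] := C1_periodic_diff_le Fper FC1.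
exists K => // y i; have [dF _] := FC1.
have -> : grad F y i 0 = 'd F y (delta_mx i 0) by rewrite mxE; apply: deriveE; exact: dF.
by rewrite (le_trans (FK _ _))// ler_piMr// norm_delta_le1.
Qed.

Lemma chain_rate_integrable T : 0 <= T -> leb.-integrable `[0, T] (EFin \o gam).
Proof.
move=> T0; have [G G0 FG] := grad_bounded.
suff H i : leb.-integrable `[0, T] (EFin \o (fun s => beta s i 0 * grad F (x s) i 0)).
  by have [] := sum_int H.
apply: (@integrableMl _ _ _ leb `[0, T] _ (fun s => (beta s i 0)%:E) (fun s => grad F (x s) i 0)) => //.
- exact: beta_int.
- exact: grad_comp_meas.
- by exists G; split; [exact: num_real|move=> M GM s _; exact: le_trans (FG _ _) (ltW GM)].
Qed.

Let absb_int T : 0 <= T -> leb.-integrable `[0, T] (EFin \o absb).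
Proof.
move=> T0; have H i : leb.-integrable `[0, T] (EFin \o (fun s => `|beta s i 0|)).
  exact: (integrable_norm (beta_int T0 i)).
by have [] := sum_int H.
Qed.

Let sub_int (g : R -> R) s t T : 0 <= s -> t <= T -> leb.-integrable `[0, T] (EFin \o g) ->
  leb.-integrable `]s, t] (EFin \o g).
Proof.
move=> s0 tT; apply: integrableS => //.
by apply: subset_itv; rewrite bnd_simp.
Qed.

Let increment s t i : 0 <= s -> s <= t ->
  x t i 0 - x s i 0 = \int[leb]_(r in `]s, t]) beta r i 0.
Proof.
move=> s0 st; have t0 := le_trans s0 st.
rewrite (x_eq t0) (x_eq s0) opprD addrACA subrr add0r Rintegral_itvB//.
exact: (beta_int t0).
Qed.

Let le_absb s i : `|beta s i 0| <= absb s.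
Proof. by rewrite /absb (bigD1 i)//= lerDl sumr_ge0. Qed.

Let increment_le s t : 0 <= s -> s <= t -> `|x t - x s| <= \int[leb]_(r in `]s, t]) absb r.
Proof.
move=> s0 st; have t0 := le_trans s0 st; apply: norm_le_col => [|i].
  by apply: Rintegral_ge0 => r _; exact: sumr_ge0.
have bi := sub_int s0 (lexx t) (beta_int t0 i).
rewrite !mxE increment// (le_trans (le_normr_Rintegral _ bi))//.
apply: le_Rintegral => [//||| r _]; first exact: integrable_norm.
  exact: sub_int (absb_int t0).
exact: le_absb.
Qed.

(** An upper bound for the variation of [x] over [0, t]. *)
Let tv t := \int[leb]_(s in `[0, t]) absb s.

Let tvB s t : 0 <= s -> s <= t -> \int[leb]_(r in `]s, t]) absb r = tv t - tv s.
Proof.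
by move=> s0 st; rewrite Rintegral_itvB//; exact: absb_int (le_trans s0 st).
Qed.

Let tv_nd s t : 0 <= s -> s <= t -> tv s <= tv t.
Proof.
move=> s0 st; rewrite -subr_ge0 -tvB// Rintegral_ge0// => r _.
exact: sumr_ge0.
Qed.

Let defect t := F (x t) - \int[leb]_(s in `[0, t]) gam s.

(** On an interval where [x] moves little, both the first-order expansion of [F]
    and the oscillation of its gradient cost at most half of [e] per unit of
    variation. *)
Let local_estimate e : 0 < e -> exists2 r, 0 < r & forall s t, 0 <= s -> s <= t ->
  tv t - tv s <= r -> `|defect t - defect s| <= e * (tv t - tv s).
Proof.
move=> e0; have e20 : 0 < e / 2 by rewrite divr_gt0.
have [r1 r10 est] := C1_torus_estimate F_C1 e20.
have [r2 r20 gunif] := grad_unif_continuous F_C1 e20.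
exists (Num.min r1 r2); first by rewrite lt_min r10.
move=> s t s0 st; rewrite le_min -tvB// => /andP[Pr1 Pr2]; have t0 := le_trans s0 st.
set P := \int[leb]_(u in `]s, t]) absb u in Pr1 Pr2 *.
have xst := increment_le s0 st.
have gi := sub_int s0 (lexx t) (chain_rate_integrable t0).
have ai := sub_int s0 (lexx t) (absb_int t0).
have -> : defect t - defect s = F (x t) - F (x s) - \int[leb]_(u in `]s, t]) gam u.
  have -> : \int[leb]_(u in `]s, t]) gam u =
      \int[leb]_(u in `[0, t]) gam u - \int[leb]_(u in `[0, s]) gam u.
    by rewrite Rintegral_itvB//; exact: chain_rate_integrable t0.
  by rewrite /defect opprD addrACA -opprD.
have dE : dot (x t - x s) (grad F (x s)) = \int[leb]_(u in `]s, t]) dot (beta u) (grad F (x s)).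
  have H i : leb.-integrable `]s, t] (EFin \o (fun u => beta u i 0 * grad F (x s) i 0)).
    exact: (integrableZr _ (grad F (x s) i 0) (sub_int s0 (lexx t) (beta_int t0 i))).
  have [_ ->] := sum_int H.
  apply: eq_bigr => i _; rewrite RintegralZr//; first by rewrite !mxE increment.
  exact: sub_int (beta_int t0 i).
have di : leb.-integrable `]s, t] (EFin \o (fun u => dot (beta u) (grad F (x s)))).
  have H i : leb.-integrable `]s, t] (EFin \o (fun u => beta u i 0 * grad F (x s) i 0)).
    exact: (integrableZr _ (grad F (x s) i 0) (sub_int s0 (lexx t) (beta_int t0 i))).
  by have [] := sum_int H.
rewrite -(subrKA (dot (x t - x s) (grad F (x s)))) (le_trans (ler_normD _ _))//.
rewrite [e]splitr mulrDl lerD//.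
  have := est (x s) (x t - x s) (le_trans xst Pr1); rewrite [x s + _]addrC subrK.
  by move=> /le_trans; apply; rewrite ler_wpM2l// ltW.
rewrite dE -RintegralB//.
have si : leb.-integrable `]s, t] (EFin \o (fun u => dot (beta u) (grad F (x s)) - gam u)).
  exact: (integrableB _ di gi).
rewrite (le_trans (le_normr_Rintegral _ si))// /P -RintegralZl//.
apply: le_Rintegral => //.
- exact: integrable_norm.
- exact: (integrableZl _ (e / 2) ai).
- move=> u /=; rewrite in_itv/= => /andP[su ut].
  rewrite /gam /dot -sumrB (le_trans (ler_norm_sum _ _ _))// /absb mulr_sumr.
  apply: ler_sum => i _; rewrite -mulrBr normrM mulrC ler_wpM2r//.
  apply: gunif; rewrite distrC (le_trans (increment_le s0 (ltW su)))// (le_trans _ Pr2)//.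
  by rewrite tvB ?(ltW su)// /P tvB// lerD2r tv_nd// (le_trans s0 (ltW su)).
Qed.

Let tv_unif T r : 0 <= T -> 0 < r -> exists2 h, 0 < h & forall s t, 0 <= s -> s <= t ->
  t <= T -> t - s < h -> tv t - tv s <= r.
Proof.
move=> T0 r0.
have pi : leb.-integrable setT (EFin \o (absb \_ `[0, T])).
  by rewrite -restrict_EFin; apply/integrable_restrict => //; rewrite setTI; exact: absb_int.
have [h [h0 H]] := integral_normr_continuous pi r0.
exists h => // s t s0 st tT tsh; rewrite -tvB//.
have -> : \int[leb]_(u in `]s, t]) absb u =
    \int[leb]_(u in `]s, t]) `|(absb \_ `[0, T]) u|.
  apply: eq_Rintegral => u; rewrite inE/= in_itv/= => /andP[su ut].
  rewrite patchE mem_set ?ger0_norm ?sumr_ge0//.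
  by rewrite /= in_itv/= (le_trans s0 (ltW su)) (le_trans ut tT).
apply/ltW/H => //; rewrite /= lebesgue_measure_itv/= lte_fin.
by case: ifPn => _; rewrite ?lte_fin.
Qed.

(** For a merely absolutely continuous [x] there is no pointwise derivative to
    work with. Instead the local errors are summed over a uniform subdivision:
    they are at most a small multiple of the variation of [x] on each step, so
    at most that multiple of the total variation. *)
Lemma chain_rule T : 0 <= T ->
  F (x T) = F (x 0) + \int[leb]_(s in `[0, T]) gam s.
Proof.
move=> T0; apply/eqP; rewrite -subr_eq -/(defect T).
have defect0 : defect 0 = F (x 0) by rewrite /defect set_itv1 Rintegral_set1 subr0.
rewrite -defect0 -subr_eq0 -normr_le0; apply/ler_addgt0Pr => eta eta0; rewrite add0r.
have tv0 : tv 0 = 0 by rewrite /tv set_itv1 Rintegral_set1.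
have tvT0 : 0 <= tv T by rewrite -tv0 tv_nd.
have e0 : 0 < eta / (tv T + 1) by rewrite divr_gt0// ltr_wpDl.
have [r r0 loc] := local_estimate e0; have [h h0 unif] := tv_unif T0 r0.
have [N NT] : exists N : nat, T / N.+1%:R < h.
  exists (Num.truncn (T / h)); rewrite ltr_pdivrMr// mulrC -ltr_pdivrMr//.
  exact: truncnS_gt.
pose t k := k%:R * (T / N.+1%:R).
have tN0 : 0 <= T / N.+1%:R by rewrite divr_ge0.
have tS k : t k.+1 - t k = T / N.+1%:R by rewrite /t -mulrBl -natrB// subSnn mul1r.
have t_le k : t k <= t k.+1 by rewrite -subr_ge0 tS.
have t_ge0 k : 0 <= t k by rewrite mulr_ge0.
have tT k : (k <= N.+1)%N -> t k <= T.
  move=> kN; rewrite /t mulrCA -[leRHS]mulr1 ler_wpM2l//.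
  by rewrite ler_pdivrMr// mul1r ler_nat.
have H k : (k <= N.+1)%N -> `|defect (t k) - defect 0| <= eta / (tv T + 1) * tv (t k).
  elim: k => [|k IH] kN; first by rewrite /t mul0r tv0 subrr normr0 mulr0.
  rewrite -(subrKA (defect (t k))) (le_trans (ler_normD _ _))//.
  have step := loc _ _ (t_ge0 k) (t_le k).
  have tkN : t k.+1 - t k < h by rewrite tS.
  rewrite -[tv (t k.+1)](subrK (tv (t k))) mulrDr lerD ?(IH (ltnW kN))//.
  exact: step (unif _ _ (t_ge0 k) (t_le k) (tT _ kN) tkN).
have := H N.+1 (leqnn _); have -> : t N.+1 = T by rewrite /t mulrC divfK.
move=> /le_trans; apply; rewrite mulrAC ler_pdivrMr; last by rewrite ltr_wpDl.
by rewrite ler_wpM2l ?(ltW eta0)// lerDl.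
Qed.
End chain_rule.

(** * Discounting as an exponential clock *)
Lemma integral_density (R : realType) (disp : measure_display)
  (T : measurableType disp) (mu : {sigma_finite_measure set T -> \bar R})
  (P : probability T R) (p g : T -> R) :
  measurable_fun setT p -> (forall x, 0 <= p x) ->
  (forall A, measurable A -> P A = (\int[mu]_(x in A) (p x)%:E)%E) ->
  measurable_fun setT g ->
  (\int[P]_x (g x)%:E = \int[mu]_x (g x * p x)%:E)%E.
Proof.
move=> mp p0 Pp mg; rewrite integralE [RHS]integralE.
have mE : measurable_fun setT (EFin \o g) by exact/measurable_EFinP.
have maxp (u v : R) : 0 <= v -> (maxe (u%:E * v%:E) 0 = maxe u%:E 0 * v%:E)%E.
  by move=> v0; rewrite -EFinM -!EFin_max -EFinM maxr_pMl// mul0r.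
congr (_ - _)%E; rewrite (ge0_integral_density mp p0 Pp)//.
- by apply: eq_integral => x _; rewrite /= !funeposE EFinM maxp.
- exact: measurable_funepos.
- apply: eq_integral => x _; rewrite /= !funenegE.
  by rewrite -!EFinN -maxp// -EFinM mulNr.
- exact: measurable_funeneg.
Qed.

(** The law of an exponential clock of rate [rho]: observing a trajectory at
    such a random time turns discounted time integrals into expectations. *)
Definition discount_law (R : realType) (rho : R) (rho_gt0 : 0 < rho) :
    probability (measurableTypeR R) R :=
  exponential_distribution_exponential_prob__canonical__probability_measure_Probability
    rho_gt0.

Section discount_law.
Context {R : realType}.
Local Notation leb := (@lebesgue_measure R).
Variables (rho : R) (rho_gt0 : 0 < rho).
Local Notation E := (discount_law rho_gt0).

Let pdf_ge0 (x : R) : 0 <= exponential_pdf rho x.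
Proof. by apply: exponential_pdf_ge0; exact: ltW. Qed.

Let pdf_meas : measurable_fun setT (exponential_pdf rho).
Proof. exact: measurable_exponential_pdf. Qed.

Lemma ge0_integral_discount_law (F : R -> R) : measurable_fun setT F ->
  (forall t, 0 <= F t) ->
  (\int[E]_t (F t)%:E =
   rho%:E * \int[leb]_(t in `[0%R, +oo[) (expR (- rho * t) * F t)%:E)%E.
Proof.
move=> mF F0; rewrite (integral_density (mu := leb) pdf_meas pdf_ge0)//.
rewrite -ge0_integralZl//; last 3 first.
- apply/measurable_EFinP; apply: measurable_funTS; apply: measurable_funM => //.
  by apply: continuous_measurable_fun; apply: continuous_expR_scale.
- by move=> t _; rewrite lee_fin mulr_ge0 ?expR_ge0.
- by rewrite lee_fin ltW.
rewrite [RHS]integral_mkcond; apply: eq_integral => t _.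
rewrite patchE /exponential_pdf patchE; case: ifPn => _; last by rewrite mulr0.
by rewrite -EFinM [in RHS]mulrA [in RHS]mulrC.
Qed.

Lemma discount_law_tail (s : R) : 0 <= s ->
  E (`]s, +oo[%classic : set R) = (expR (- rho * s))%:E.
Proof.
move=> s0.
have Es : E (`]-oo, s]%classic : set R) = (1 - (expR (- rho * s))%:E)%E.
  have -> : E (`]-oo, s]%classic : set R) = exponential_prob rho `[0, s].
    rewrite /exponential_prob [RHS]integral_mkcond.
    transitivity (\int[leb]_(x in `]-oo, s]) (exponential_pdf rho x)%:E)%E; first by [].
    rewrite [LHS]integral_mkcond; apply: eq_integral => t _.
    rewrite !patchE !mem_setE !in_itv/=; case: (ltP t 0) => t0 //=.
    by rewrite lt0_exponential_pdf// if_same.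
  have [<-|sn0] := eqVneq 0 s; last by rewrite exponential_prob_itv0c// lt_neqAle sn0.
  by rewrite mulr0 expR0 subee// /exponential_prob set_itv1 integral_set1.
rewrite -setCitvl probability_setC// Es; apply: (congr1 EFin); exact: subKr.
Qed.

(** Integration by parts against the exponential density: by Fubini the rate
    [gam s] is collected at all clock times beyond [s], that is with weight
    [expR (- rho * s)]. *)
Lemma discount_law_primitive (gam V : R -> R) (v0 : R) :
  measurable_fun setT gam -> E.-integrable setT (EFin \o gam) ->
  (forall t, leb.-integrable `[0, t] (EFin \o gam)) ->
  (forall t, V t = v0 + \int[leb]_(s in `[0, t]) gam s) ->
  (\int[E]_t (V t)%:E = v0%:E + (rho^-1)%:E * \int[E]_t (gam t)%:E)%E.
Proof.
move=> mgam igam lgam VE.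
pose S : set (measurableTypeR R * measurableTypeR R) :=
  [set p | 0 <= (p.2 : R) < (p.1 : R)].
pose k (p : measurableTypeR R * measurableTypeR R) := ((gam p.2 * \1_S p)%:E : \bar R).
have m2 : measurable_fun setT (fun p : measurableTypeR R * measurableTypeR R => (p.2 : R)).
  exact: measurable_snd.
have mS : measurable S.
  have -> : S = [set p | (0 <= (p.2 : R))%R] `&` [set p | ((p.2 : R) < p.1)%R].
    by apply/seteqP; split => p; [move=> /andP[]|move=> [p0 p1]; apply/andP].
  apply: measurableI.
    by rewrite -[X in measurable X]setTI; apply: measurable_fun_le.
  have -> : [set p | ((p.2 : R) < p.1)%R] =
      ~` [set p : measurableTypeR R * measurableTypeR R | ((p.1 : R) <= p.2)%R].
    by apply/seteqP; split => p /=; [rewrite ltNge => /negP|move/negP; rewrite -ltNge].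
  apply: measurableC; rewrite -[X in measurable X]setTI; apply: measurable_fun_le => //.
have mk : measurable_fun setT k.
  apply/measurable_EFinP; apply: measurable_funM; last exact: measurable_indic.
  exact: measurableT_comp mgam m2.
have kE (c s : R) : (\int[E]_t (c * \1_S (t, s))%:E =
    ((rho^-1 * c) * exponential_pdf rho s)%:E)%E.
  have [s0|s0] := ltP s 0.
    rewrite lt0_exponential_pdf// mulr0 integral0_eq// => t _.
    by rewrite indicE memNset ?mulr0// /S /= leNgt s0.
  have -> : (fun t : measurableTypeR R => (c * \1_S (t, s))%:E) =
      (fun t => (c%:E * (\1_(`]s, +oo[%classic : set R) t)%:E)%E).
    apply/funext => t; rewrite -EFinM !indicE; congr ((_ * _%:R)%:E).
    have -> : ((t, s) \in S) = (s < t) by apply/idP/idP; rewrite inE /S /= s0.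
    by rewrite mem_setE in_itv/= andbT.
  have mi : measurable (`]s, +oo[%classic : set (measurableTypeR R)) by [].
  rewrite integralZl//; last exact: integrable_indic.
  have -> : (\int[E]_t (\1_(`]s, +oo[%classic : set R) t)%:E = (expR (- rho * s))%:E)%E.
    by rewrite -(discount_law_tail s0) integral_indic// setIT.
  rewrite exponential_pdfE// -EFinM.
  by rewrite [rho^-1 * c]mulrC mulrA mulfVK// gt_eqF.
have ik : (E \x leb)%E.-integrable setT k.
  apply/integrable21ltyP => //.
  have -> : (\int[leb]_s \int[E]_t `|k (t, s)| = \int[E]_s (rho^-1 * `|gam s|)%:E)%E.
    rewrite [RHS](integral_density (mu := leb) pdf_meas pdf_ge0)//; last first.
      by apply: measurable_funM => //; exact: measurableT_comp.
    apply: eq_integral => s _; rewrite -kE; apply: eq_integral => t _.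
    by rewrite /k abse_EFin normrM [X in _ * X]ger0_norm// indicE.
  have /integrableP[_] := integrableZl measurableT rho^-1 igam.
  by under eq_integral => s _ do rewrite /= normrM ger0_norm ?invr_ge0 ?(ltW rho_gt0)//.
have FkE t : fubini_F leb k t = (V t - v0)%:E.
  rewrite VE addrAC subrr add0r /fubini_F /k.
  have -> : (fun s : measurableTypeR R => (gam s * \1_S (t, s))%:E) =
      (fun s => (gam s)%:E) \_ `[0, t[.
    apply/funext => s; rewrite patchE mem_setE in_itv indicE /=.
    have -> : ((t, s) \in S) = (0 <= s < t) by apply/idP/idP; rewrite inE.
    by case: ifP; rewrite ?mulr1 ?mulr0.
  rewrite -integral_mkcond integral_itv_bndo_bndc ?fineK//.
    exact: integrable_fin_num (lgam t).
  by apply/measurable_EFinP; apply: measurable_funTS.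
have -> : (\int[E]_t (V t)%:E = \int[E]_t (v0%:E + fubini_F leb k t))%E.
  by apply: eq_integral => t _; rewrite FkE -EFinD addrC subrK.
rewrite integralD//; last 2 first.
- exact: finite_measure_integrable_cst.
- exact: integrable_fubini_F.
congr (_ + _)%E.
  apply: etrans (integral_cst E measurableT v0%:E) _.
  by apply: etrans (congr1 (fun z => v0%:E * z)%E (probability_setT E)) _; rewrite mule1.
rewrite integral12_prod_meas1// -integral21_prod_meas1//.
rewrite -integralZl//.
apply: (@etrans _ _ (\int[leb]_s ((rho^-1 * gam s) * exponential_pdf rho s)%:E)%E).
  by apply: eq_integral => s _; rewrite -kE; apply: eq_integral => t _.
apply/esym/(integral_density (mu := leb) pdf_meas pdf_ge0) => //.
exact: measurable_funM.
Qed.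
End discount_law.

(** * The occupation measure as a law *)
Lemma torus_rep_measurable (R : realType) d :
  measurable_fun setT (@torus_rep R d).
Proof.
apply/measurable_fun_mxP => // i j; rewrite (ord1 j).
rewrite (_ : (fun x => _) = fun x : 'cV[R]_d => x i 0 - (Num.floor (x i 0))%:~R); last first.
  by apply/funext => x; rewrite mxE.
apply: measurable_funB; first exact: measurable_entry.
apply: (@measurableT_comp _ _ _ _ _ _ (fun r : R => (Num.floor r)%:~R : R) _
  (fun x : 'cV[R]_d => x i 0)); last exact: measurable_entry.
apply: nondecreasing_measurable => // r s rs.
by rewrite ler_int; exact: le_floor.
Qed.

Section occupation_measure.
Context {R : realType} {d : nat}.
Local Notation leb := (@lebesgue_measure R).
Variables (rho : R) (rho_gt0 : 0 < rho) (P0 : probability 'cV[R]_d R).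
Variable X : 'cV[R]_d -> R -> 'cV[R]_d.
Hypothesis X_meas : measurable_fun (setT `*` (`[0, +oo[ : set R))
     (fun p : 'cV[R]_d * measurableTypeR R => X p.1 p.2).
Variable mustar : {measure set 'cV[R]_d -> \bar R}.
Hypothesis mustar_occ : forall A, measurable A -> mustar A = occupation rho P0 X A.
Local Notation E := (discount_law rho_gt0).

(** The point of the unit cube occupied at a clock time. Times before 0, which are
    null for the clock, are sent to 0, so that the trajectory identities hold at
    all times. *)
Let Phi (p : 'cV[R]_d * measurableTypeR R) := torus_rep (X p.1 (Num.max (p.2 : R) 0)).

Lemma sampled_measurable : measurable_fun setT Phi.
Proof.
apply: (measurableT_comp (f := @torus_rep R d)); first exact: torus_rep_measurable.
pose g (p : 'cV[R]_d * measurableTypeR R) : 'cV[R]_d * measurableTypeR R :=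
  (p.1, Num.max (p.2 : R) 0).
apply: (@measurable_comp _ _ _ _ _ _ (setT `*` (`[0, +oo[ : set R)) _ setT g _ _ X_meas) => //.
- exact: measurableX.
- by move=> _ [p _ <-]; split => //=; rewrite in_itv/= andbT le_max lexx orbT.
- apply/measurable_fun_pair; first exact: measurable_fst.
  by apply: measurable_maxr => //; exact: measurable_snd.
Qed.

Let section_measurable x0 : measurable_fun setT (fun t => Phi (x0, t)).
Proof. exact: measurableT_comp sampled_measurable (measurable_pair1 x0). Qed.

(** The occupation measure is the law of the position at an independent
    exponential time, the initial point having law [P0]. *)
Lemma occupation_pushforward A : measurable A ->
  mustar A = pushforward (P0 \x E)%E Phi A.
Proof.
move=> mA; rewrite mustar_occ// /occupation /pushforward.
have mPA : measurable (Phi @^-1` A).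
  by rewrite -[X in measurable X]setTI; exact: sampled_measurable.
apply: (@etrans _ _ (\int[(P0 \x E)%E]_p (\1_(Phi @^-1` A) p)%:E)%E); last first.
  by apply: etrans (integral_indic _ measurableT mPA) _; rewrite setIT.
rewrite fubini_tonelli1//; last by apply/measurable_EFinP; exact: measurable_indic.
apply: eq_integral => x0 _; rewrite /fubini_F.
rewrite (ge0_integral_discount_law rho_gt0)//; last first.
  apply: measurable_indic; rewrite -[X in measurable X]setTI.
  exact: (section_measurable x0 measurableT mA).
congr (_ * _)%E; apply: eq_integral => t; rewrite inE/= in_itv/= andbT => t0.
have PhiE : Phi (x0, t) = torus_rep (X x0 t) by rewrite /Phi max_l.
rewrite -PhiE !indicE; congr (_ * _%:R)%:E.
Qed.

Lemma ge0_integral_occupation (g : 'cV[R]_d -> R) : measurable_fun setT g ->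
  (forall x, 0 <= g x) ->
  (\int[mustar]_x (g x)%:E = \int[P0]_x0 \int[E]_t (g (Phi (x0, t)))%:E)%E.
Proof.
move=> mg g0; have mE : measurable_fun setT (EFin \o g) by exact/measurable_EFinP.
pose nu := measure_function_pushforward__canonical__measure_function_Measure
  (P0 \x E)%E sampled_measurable.
rewrite (eq_measure_integral nu); last by move=> A mA _; exact: occupation_pushforward.
apply: etrans (ge0_integral_pushforward sampled_measurable _ measurableT mE _) _.
  by move=> x _; rewrite lee_fin.
rewrite preimage_setT; apply: fubini_tonelli1; last by move=> p; rewrite lee_fin.
exact: (measurableT_comp mE sampled_measurable).
Qed.

Lemma integrable_occupation (g : 'cV[R]_d -> R) : measurable_fun setT g ->
  mustar.-integrable setT (EFin \o g) ->
  (P0 \x E)%E.-integrable setT (fun p => (g (Phi p))%:E) /\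
  (\int[mustar]_x (g x)%:E = \int[P0]_x0 \int[E]_t (g (Phi (x0, t)))%:E)%E.
Proof.
move=> mg ig; have mE : measurable_fun setT (EFin \o g) by exact/measurable_EFinP.
have igP : (P0 \x E)%E.-integrable setT (fun p => (g (Phi p))%:E).
  apply/integrable12ltyP; first exact: (measurableT_comp mE sampled_measurable).
  have mng : measurable_fun setT (fun x => `|g x|) by exact: measurableT_comp.
  have /integrableP[_] := ig.
  by rewrite (ge0_integral_occupation mng)// => x; exact: normr_ge0.
split => //; pose nu := measure_function_pushforward__canonical__measure_function_Measure
  (P0 \x E)%E sampled_measurable.
rewrite (eq_measure_integral nu); last by move=> A mA _; exact: occupation_pushforward.
apply: etrans (integral_pushforward sampled_measurable mE _ measurableT) _.
  by rewrite preimage_setT.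
by rewrite preimage_setT -integral12_prod_meas1.
Qed.

Let sampled_cost (g : 'cV[R]_d -> R) x0 : measurable_fun setT g ->
  (forall x, 0 <= g x) -> torus_periodic g ->
  (\int[E]_t (g (Phi (x0, t)))%:E =
   rho%:E * \int[leb]_(t in `[0%R, +oo[) (expR (- rho * t) * g (X x0 t))%:E)%E.
Proof.
move=> mg g0 g_per; rewrite (ge0_integral_discount_law rho_gt0)//; last first.
  exact: measurableT_comp (section_measurable x0).
congr (_ * _)%E; apply: eq_integral => t; rewrite inE/= in_itv/= andbT => t0.
by rewrite /Phi/= max_l// periodic_torus_rep.
Qed.

Lemma occupation_cost (g : 'cV[R]_d -> R) : measurable_fun setT g ->
  (forall x, 0 <= g x) -> torus_periodic g ->
  (\int[mustar]_x (g x)%:E =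
   \int[P0]_x0 (rho%:E * \int[leb]_(t in `[0%R, +oo[) (expR (- rho * t) * g (X x0 t))%:E))%E.
Proof.
move=> mg g0 g_per; rewrite ge0_integral_occupation//; apply: eq_integral => x0 _.
exact: sampled_cost.
Qed.

Lemma occupation_integrable_cost (g : 'cV[R]_d -> R) (C : R) : measurable_fun setT g ->
  (forall x, 0 <= g x) -> torus_periodic g -> 0 <= C ->
  {ae P0, forall x0,
    (rho%:E * \int[leb]_(t in `[0%R, +oo[) (expR (- rho * t) * g (X x0 t))%:E <= C%:E)%E} ->
  mustar.-integrable setT (EFin \o g).
Proof.
move=> mg g0 g_per C0 gC; apply/integrableP; split; first exact/measurable_EFinP.
rewrite (_ : (fun x => _) = EFin \o g); last first.
  by apply/funext => x /=; rewrite ger0_norm.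
have mE : measurable_fun setT (fun p => (g (Phi p))%:E).
  by apply/measurable_EFinP; exact: measurableT_comp sampled_measurable.
rewrite (ge0_integral_occupation mg g0); apply: (@le_lt_trans _ _ (\int[P0]_x C%:E)%E).
  apply: ae_ge0_le_integral => //.
  - by move=> x0 _; apply: integral_ge0 => t _; rewrite lee_fin.
  - have p0 p : (0 <= (g (Phi p))%:E)%E by rewrite lee_fin.
    exact: (measurable_fun_fubini_tonelli_F (m2 := E) _ mE p0).
  - by apply: filterS gC => x0 gx0 _; rewrite sampled_cost.
exact: integral_fune_lt_pinfty (finite_measure_integrable_cst P0 C measurableT).
Qed.

Lemma occupation_finite : (mustar setT < +oo)%E.
Proof.
rewrite (occupation_pushforward measurableT) /pushforward preimage_setT.
by apply: le_lt_trans (ltry 1); exact: probability_le1.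
Qed.

Section stationarity.
Variables (b : 'cV[R]_d -> 'cV[R]_d) (V : 'cV[R]_d -> R).
Hypotheses (b_meas : measurable_fun setT b) (b_per : torus_periodic b)
  (V_C1 : C1_torus V)
  (b_int : mustar.-integrable setT (EFin \o (fun x => dot (b x) (grad V x))))
  (X_flow : {ae P0, forall x0, solves b x0 (X x0)}).

(** The continuity equation tested against [V]. For almost every initial point
    the chain rule makes [V] along the trajectory a primitive of its rate, and
    the expectation of a primitive at the clock time is its initial value plus
    [rho^-1] times the expected rate. Integrability of the rate for almost every
    initial point comes from Fubini's theorem. *)
Lemma occupation_stationary :
  (\int[mustar]_x (V x)%:E =
   \int[P0]_x (V x)%:E + (rho^-1)%:E * \int[mustar]_x (dot (b x) (grad V x))%:E)%E.
Proof.
have [V_per [dV cV]] := V_C1.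
pose h x := dot (b x) (grad V x).
have h_meas : measurable_fun setT h.
  by have /integrableP[/measurable_EFinP] := b_int.
have V_cont := C1_torus_continuous V_C1.
have V_meas : measurable_fun setT V by exact: continuous_measurable_cV.
have [C C0 VC] := periodic_bounded V_per V_cont.
have iV (P : {measure set 'cV[R]_d -> \bar R}) :
    (P setT < +oo)%E -> P.-integrable setT (EFin \o V).
  move=> PT; apply: measurable_bounded_integrable => //.
  by exists C; split; [exact: num_real|move=> M CM x _; exact: le_trans (VC _) (ltW CM)].
have h_per : torus_periodic h.
  move=> x i; rewrite /h -!dot_grad// b_per.
  exact: (diff_periodic (b x) V_per (conj dV cV)).
have [ihP hE] := integrable_occupation h_meas b_int.
have iVs : mustar.-integrable setT (EFin \o V).
  by apply: iV; exact: occupation_finite.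
have [iVP VE] := integrable_occupation V_meas iVs.
rewrite VE -/h hE.
rewrite -integralZl//; last exact: (integrable_fubini_F ihP).
rewrite -integralD//; last 2 first.
- by apply: iV; apply: le_lt_trans (ltry 1); exact: probability_le1.
- by apply: integrableZl => //; exact: (integrable_fubini_F ihP).
apply: ae_eq_integral => //.
- by have /integrableP[] := integrable_fubini_F iVP.
- apply: emeasurable_funD; first exact/measurable_EFinP.
  by apply: emeasurable_funM => //; have /integrableP[] := integrable_fubini_F ihP.
apply: filterS2 X_flow (ae_integrable1 ihP) => x0 flow ih _.
have flow0 t : 0 <= t -> torus_rep (X x0 t) = Phi (x0, t) by move=> t0; rewrite /Phi/= max_l.
have x_meas : measurable_fun (`[0, +oo[ : set R) (X x0).
  apply: (@measurable_comp _ _ _ _ _ _ (setT `*` (`[0, +oo[ : set R)) _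
    (`[0, +oo[ : set R) (pair x0) _ _ X_meas).
  - exact: measurableX.
  - by move=> _ [t t0 <-].
  - exact: measurable_funTS (measurable_pair1 x0).
have beta_int t (t0 : 0 <= t) i := (flow t t0 i).1.
have X0 : X x0 0 = x0 := solves_at0 flow.
have x_eq t (t0 : 0 <= t) i : X x0 t i 0 = X x0 0 i 0 + \int[leb]_(s in `[0, t]) b (X x0 s) i 0.
  by rewrite X0; exact: (flow t t0 i).2.
have hPhi s : 0 <= s -> h (Phi (x0, s)) = h (X x0 s).
  by move=> s0; rewrite -flow0// periodic_torus_rep.
apply: (discount_law_primitive (rho_gt0 := rho_gt0) (gam := fun t => h (Phi (x0, t)))).
- exact: (measurableT_comp h_meas (section_measurable x0)).
- exact: ih.
- move=> t; have [t0|t0] := leP 0 t; last first.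
    by rewrite set_itv_ge ?bnd_simp -?ltNge//; exact: integrable_set0.
  apply: eq_integrable (chain_rate_integrable V_C1 x_meas beta_int t0) => // s.
  by rewrite inE/= in_itv/= => /andP[s0 _]; rewrite /= hPhi.
- move=> t; have [t0|t0] := leP 0 t; last first.
    rewrite set_itv_ge ?bnd_simp -?ltNge// Rintegral_set0 addr0.
    by rewrite /Phi/= max_r ?ltW// periodic_torus_rep// X0.
  rewrite -flow0// periodic_torus_rep// (chain_rule V_C1 x_meas beta_int x_eq t0) X0.
  apply: (congr1 (fun z => V x0 + z)); apply: eq_Rintegral => s.
  by rewrite inE/= in_itv/= => /andP[s0 _]; rewrite hPhi.
Qed.
End stationarity.
End occupation_measure.

(** * The optimal controller and its occupation measure *)

Section optimal_cost.
Context {R : realType} {d m : nat}.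
Local Notation leb := (@lebesgue_measure R).
Local Notation tau := (@torus_measure R d).
Variables (rho q q' : R) (f : 'cV[R]_d -> R).
Variables (a : 'cV[R]_d -> 'cV[R]_d) (B : 'cV[R]_d -> 'M[R]_(d, m)).
Hypotheses (rho_gt0 : 0 < rho) (q_gt1 : 1 < q)
  (f_per : torus_periodic f) (a_per : torus_periodic a) (B_per : torus_periodic B)
  (f_ge0 : forall x, 0 <= f x)
  (f_lip : lipschitz f) (a_lip : lipschitz a) (B_lip : lipschitz B).

Let q_gt0 : 0 < q. Proof. exact: lt_trans q_gt1. Qed.

Let norm2_0 : norm2 (0 : 'cV[R]_m) = 0.
Proof.
rewrite /norm2 big1 ?sqrtr0// => i _.
by rewrite mxE expr0n.
Qed.

(** The null control costs at most the supremum of [f]. *)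
Lemma value_function_bounded : exists2 C, 0 <= C &
  forall x0, (value_function rho q f a B x0 <= C%:E)%E.
Proof.
have [Lf Lf0 fL] := lipschitzP f_lip.
have [C C0 fC] := periodic_bounded f_per (lip_continuous fL).
exists C => // x0; pose u0 : 'cV[R]_d -> 'cV[R]_m := fun=> 0.
have u0_per : torus_periodic u0 by [].
have u0_lip : exists2 Lu, 0 <= Lu & forall x y, `|u0 x - u0 y| <= Lu * `|x - y|.
  by exists 0 => // x y; rewrite subrr normr0 mul0r.
have u0_le x : norm2 (u0 x) <= 0 by rewrite norm2_0.
have [L [M [L0 M0 bL bM b_per]]] := closed_loop_field a_per B_per u0_per a_lip B_lip u0_lip.
have X_sol := closed_loop_solves a_per B_per a_lip B_lip u0_per u0_lip.
have [Ll Ll0 l_lip] := feedback_cost_lip q_gt1 f_lip u0_lip u0_le.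
have l_ge0 x : 0 <= f x + power_cost q (u0 x) by rewrite addr_ge0// power_cost_ge0.
have l_le x : f x + power_cost q (u0 x) <= C.
  rewrite /power_cost norm2_0 powR0 ?gt_eqF// mul0r addr0.
  exact: le_trans (ler_norm _) (fC x).
pose X := closed_loop a B u0.
apply: (@le_trans _ _ (discounted_cost rho q f (X x0) (u0 \o X x0))).
  apply: ereal_inf_lbound; exists (u0 \o X x0), (X x0); split => //.
    by rewrite (_ : u0 \o X x0 = fun=> 0)//; exact: measurable_cst.
  exact: X_sol.
have cvg := discounted_cost_cvg (rho := rho) M0 bM X_sol l_lip l_ge0 (x := x0).
rewrite /discounted_cost -(cvg_lim _ cvg)//; apply: lime_le.
  by apply/cvg_ex; eexists; exact: cvg.
apply: nearW => n; rewrite lee_fin.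
exact: (trunc_value_le M0 bM l_lip l_ge0 l_le X_sol rho_gt0).
Qed.

Lemma norm2_measurable n : measurable_fun setT (@norm2 R n).
Proof.
apply: continuous_measurable_cV; apply: (@lip_continuous _ _ _ _ n%:R) => u v.
exact: norm2_lip.
Qed.

Lemma CV_ge0 (alpha : 'cV[R]_d -> 'cV[R]_m) : 0 <= CV q q' f alpha.
Proof.
by rewrite addr_ge0 ?fine_ge0 ?Lnorm_ge0// divr_ge0 ?powR_ge0// ltW.
Qed.

(** As [q > 1] the control cost dominates the speed; this makes the rates
    integrable against the occupation measure. *)
Let norm_le_cost n (u : 'cV[R]_n) : `|u| <= 1 + q * power_cost q u.
Proof.
rewrite /power_cost mulrC divfK ?gt_eqF//.
have uN : `|u| <= norm2 u.
  by apply: norm_le_col; [exact: norm2_ge0|move=> i; exact: entry_le_norm2].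
rewrite (le_trans uN)//; have [u1|/ltW u1] := leP (norm2 u) 1.
  by rewrite (le_trans u1)// lerDl powR_ge0.
rewrite -[leLHS]powRr1 ?norm2_ge0// (@le_trans _ _ (norm2 u `^ q))//.
  by rewrite ler_powR// ltW.
by rewrite lerDr.
Qed.

Variables (mu0 : 'cV[R]_d -> R) (P0 : probability 'cV[R]_d R).
Hypotheses (mu0_meas : measurable_fun setT mu0) (mu0_ge0 : forall x, 0 <= mu0 x)
  (P0_density : forall A, measurable A -> P0 A = (\int[tau]_(x in A) (mu0 x)%:E)%E).
Variables (ustar : 'cV[R]_d -> 'cV[R]_m) (xstar : 'cV[R]_d -> R -> 'cV[R]_d).
Hypotheses (ustar_meas : measurable_fun setT ustar) (ustar_per : torus_periodic ustar)
  (xstar_meas : measurable_fun (setT `*` (`[0, +oo[ : set R))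
     (fun p : 'cV[R]_d * measurableTypeR R => xstar p.1 p.2))
  (xstar_opt : {ae P0, forall x0,
     is_trajectory a B x0 (ustar \o xstar x0) (xstar x0) /\
     discounted_cost rho q f (xstar x0) (ustar \o xstar x0) =
       value_function rho q f a B x0}).
Variable mustar : {measure set 'cV[R]_d -> \bar R}.
Hypothesis mustar_occ : forall A, measurable A -> mustar A = occupation rho P0 xstar A.

Let b x := dynamics a B x (ustar x).
Let g x := f x + power_cost q (ustar x).

Let g_meas : measurable_fun setT g.
Proof.
have [Lf Lf0 fL] := lipschitzP f_lip.
apply: measurable_funD; first by apply: continuous_measurable_cV; exact: lip_continuous fL.
apply: measurable_funM => //; apply: (measurableT_comp (measurable_powR _)).
apply: (@measurableT_comp _ _ _ _ _ _ (@norm2 R m) _ ustar) => //.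
exact: norm2_measurable.
Qed.

Let g_ge0 x : 0 <= g x. Proof. by rewrite addr_ge0// power_cost_ge0. Qed.

Let g_per : torus_periodic g. Proof. by move=> x i; rewrite /g f_per ustar_per. Qed.

Let g_int : mustar.-integrable setT (EFin \o g).
Proof.
have [C C0 vC] := value_function_bounded.
apply: (occupation_integrable_cost rho_gt0 xstar_meas mustar_occ g_meas g_ge0 g_per C0).
by apply: filterS xstar_opt => x0 [_ E]; rewrite (le_trans _ (vC x0))// -E.
Qed.

Let b_meas : measurable_fun setT b.
Proof.
have [La La0 aL] := lipschitzP a_lip; have [LB LB0 BL] := lipschitzP B_lip.
apply/measurable_fun_mxP => // i j; rewrite (ord1 j).
rewrite (_ : (fun x => _) = fun x => a x i 0 + \sum_k B x i k * ustar x k 0); last first.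
  by apply/funext => x; rewrite !mxE.
have entry_lip n1 n2 (F : 'cV[R]_d -> 'M[R]_(n1, n2)) L i1 i2 :
    (forall x y, `|F x - F y| <= L * `|x - y|) -> measurable_fun setT (fun x => F x i1 i2).
  move=> FL; apply: continuous_measurable_cV; apply: (@lip_continuous _ _ _ _ L) => x y.
  by have := entry_le_norm (F x - F y) i1 i2; rewrite !mxE => /le_trans; apply.
apply: measurable_funD; first exact: entry_lip aL.
apply: measurable_sum => k; apply: measurable_funM; first exact: entry_lip BL.
exact: measurableT_comp (measurable_entry _ _) ustar_meas.
Qed.

Let b_per : torus_periodic b.
Proof. by move=> x i; rewrite /b /dynamics a_per B_per ustar_per. Qed.

Let b_grad_int V : C1_torus V -> mustar.-integrable setT (EFin \o (fun x => dot (b x) (grad V x))).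
Proof.
move=> V_C1; have [V_per [dV cV]] := V_C1.
have [La La0 aL] := lipschitzP a_lip; have [LB LB0 BL] := lipschitzP B_lip.
have [Ma Ma0 aM] := periodic_bounded a_per (lip_continuous aL).
have [MB MB0 BM] := periodic_bounded B_per (lip_continuous BL).
have [K K0 VK] := C1_periodic_diff_le V_per (conj dV cV).
pose c := m%:R * MB; have c0 : 0 <= c by rewrite mulr_ge0.
have bg x : `|b x| <= (Ma + c) + c * q * g x.
  rewrite /b /dynamics (le_trans (ler_normD _ _))// -addrA lerD//.
  rewrite (le_trans (norm_mulmx_le _ _))//.
  apply: (@le_trans _ _ (c * (1 + q * power_cost q (ustar x)))).
    by rewrite ler_pM ?mulr_ge0 ?norm_le_cost// ler_wpM2l.
  rewrite mulrDr mulr1 lerD2l mulrA ler_wpM2l ?mulr_ge0 ?(ltW q_gt0)//.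
  by rewrite lerDr.
have igc : mustar.-integrable setT (EFin \o (fun x => K * ((Ma + c) + c * q * g x))).
  have ic : mustar.-integrable setT (EFin \o (fun=> Ma + c)).
    apply: measurable_bounded_integrable => //.
      by have := occupation_finite rho_gt0 xstar_meas mustar_occ.
    by exists `|Ma + c|; split; [exact: num_real|move=> N cN x _; exact: ltW].
  have icg := integrableZl measurableT (c * q) g_int.
  exact: (integrableZl measurableT K (integrableD measurableT ic icg)).
apply: le_integrable igc => //.
  apply/measurable_EFinP; apply: measurable_sum => i; apply: measurable_funM.
    exact: measurableT_comp (measurable_entry _ _) b_meas.
  rewrite (_ : (fun x => _) = fun x => 'd V x (delta_mx i 0)).
    by apply: continuous_measurable_cV; exact: cV.
  by apply/funext => y; rewrite mxE; apply: deriveE; exact: dV.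
move=> x _; rewrite /= lee_fin.
have -> : dot (b x) (grad V x) = 'd V x (b x) by rewrite dot_grad.
by rewrite (le_trans (VK _ _))// (le_trans _ (ler_norm _))// ler_wpM2l.
Qed.

Let residual_le0 V : C1_torus V -> residual_measure rho a B mu0 ustar mustar V <= 0.
Proof.
move=> V_C1; have [V_per [dV cV]] := V_C1.
have V_cont := C1_torus_continuous V_C1.
have [C C0 VC] := periodic_bounded V_per V_cont.
have flow : {ae P0, forall x0, solves b x0 (xstar x0)}.
  by apply: filterS xstar_opt => x0 [].
have := occupation_stationary rho_gt0 xstar_meas mustar_occ b_per V_C1 (b_grad_int V_C1) flow.
rewrite (integral_density (mu := tau) mu0_meas mu0_ge0 P0_density); last first.
  exact: continuous_measurable_cV.
have mu0_int := integrable_density mu0_meas mu0_ge0 P0_density.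
have iV := integrable_mul_continuous mu0_int V_cont VC.
have VE : (\int[tau]_x (V x * mu0 x)%:E = (\int[tau]_x (mu0 x * V x))%:E)%E.
  rewrite /Rintegral fineK; last exact: integrable_fin_num.
  by apply: eq_integral => x _; rewrite mulrC.
have hE : (\int[mustar]_x (dot (b x) (grad V x))%:E =
    (\int[mustar]_x dot (b x) (grad V x))%:E)%E.
  rewrite /Rintegral fineK//; exact: integrable_fin_num (b_grad_int V_C1).
rewrite VE hE -EFinM -EFinD => /(congr1 fine) /= sE.
by rewrite /residual_measure [X in _ - X]sE opprD addrA subrr add0r addNr.
Qed.

(** The running cost integrates to the performance, and the penalty contributes
    at most 0 because the occupation measure solves the continuity equation. *)
Lemma J_measure_le_perf (alpha : 'cV[R]_d -> 'cV[R]_m) :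
  (J_measure rho q f a B (CV q q' f alpha) mu0 ustar mustar
   <= perf rho q f P0 ustar xstar)%E.
Proof.
rewrite /J_measure (occupation_cost rho_gt0 xstar_meas mustar_occ g_meas g_ge0 g_per).
rewrite -[leRHS]adde0 leeD2l//; apply: mule_ge0_le0; first by rewrite lee_fin CV_ge0.
by apply: ub_ereal_sup => _ [V [V_C1 _] <-]; rewrite lee_fin residual_le0.
Qed.
End optimal_cost.

(** * The performance gap *)

Theorem proposition9 (R : realType) (d m : nat) (d_gt0 : (0 < d)%N)
  (m_gt0 : (0 < m)%N) (rho q q' : R) (rho_gt0 : 0 < rho) (q_gt1 : 1 < q)
  (q_le2 : q <= 2) (q_conj : q^-1 + q'^-1 = 1)
  (f : 'cV[R]_d -> R) (a : 'cV[R]_d -> 'cV[R]_d) (B : 'cV[R]_d -> 'M[R]_(d, m))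
  (f_per : torus_periodic f) (a_per : torus_periodic a) (B_per : torus_periodic B)
  (f_ge0 : forall x, 0 <= f x)
  (f_lip : lipschitz f) (a_lip : lipschitz a) (B_lip : lipschitz B)
  (alpha : 'cV[R]_d -> 'cV[R]_m) (alpha_per : torus_periodic alpha)
  (alpha_meas : measurable_fun setT alpha)
  (alpha_Linf : (linf_norm (@norm2 R m \o alpha) < +oo)%E)
  (a_alpha : forall x, a x = B x *m alpha x)
  (* the initial distribution P0, with density mu0 *)
  (mu0 : 'cV[R]_d -> R) (P0 : probability 'cV[R]_d R)
  (mu0_per : torus_periodic mu0) (mu0_meas : measurable_fun setT mu0)
  (mu0_ge0 : forall x, 0 <= mu0 x)
  (mu0_bounded : (linf_norm mu0 < +oo)%E)
  (P0_density : forall A, measurable A ->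
     P0 A = (\int[torus_measure d]_(x in A) (mu0 x)%:E)%E)
  (P0_full_support : forall U : set 'cV[R]_d, open U ->
     U `&` @unit_cube R d !=set0 -> (0 < P0 U)%E)
  (* the optimal controller and the optimal trajectories x(t | x0) = xstar x0 t *)
  (ustar : 'cV[R]_d -> 'cV[R]_m)
  (ustar_opt : is_optimal_controller rho q q' f a B ustar)
  (xstar : 'cV[R]_d -> R -> 'cV[R]_d)
  (xstar_meas : measurable_fun (setT `*` (`[0, +oo[ : set R))
     (fun p : 'cV[R]_d * measurableTypeR R => xstar p.1 p.2))
  (xstar_opt : {ae P0, forall x0,
     is_trajectory a B x0 (ustar \o xstar x0) (xstar x0) /\
     discounted_cost rho q f (xstar x0) (ustar \o xstar x0) =
       value_function rho q f a B x0})
  (* the optimal occupation measure *)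
  (mustar : {measure set 'cV[R]_d -> \bar R})
  (mustar_occ : forall A, measurable A ->
     mustar A = occupation rho P0 xstar A)
  (* the candidate pair *)
  (w : 'cV[R]_d -> 'cV[R]_m) (mu : 'cV[R]_d -> R) (uc : 'cV[R]_d -> 'cV[R]_m)
  (mu_per : torus_periodic mu) (mu_ge0 : forall x, 0 <= mu x)
  (mu_int : (torus_measure d).-integrable setT (EFin \o mu))
  (w_mu : forall x, w x = mu x *: uc x)
  (uc_per : torus_periodic uc) (uc_C1 : C1 uc)
  (uc_le : forall x, norm2 (uc x) <= Cu q q' f alpha) :
  (perf rho q f P0 uc (closed_loop a B uc) - perf rho q f P0 ustar xstar
   <= J rho q f a B (CV q q' f alpha) mu0 w mu
      - J_measure rho q f a B (CV q q' f alpha) mu0 ustar mustar)%E.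

Proof.
apply: leeB.
  exact: (perf_feedback_le_J rho_gt0 q_gt1 f_per a_per B_per f_ge0 f_lip a_lip B_lip
    mu0_meas mu0_ge0 P0_density mu_ge0 mu_int w_mu uc_per uc_C1 uc_le).
have [ustar_meas ustar_per _] := ustar_opt.
exact: (J_measure_le_perf q' rho_gt0 q_gt1 f_per a_per B_per f_ge0 f_lip a_lip B_lip
  mu0_meas mu0_ge0 P0_density ustar_meas ustar_per xstar_meas xstar_opt mustar_occ).
Qed.
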